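(* Let $L_t,R_t,\alpha_t$ be as defined in the context, and for $t\in(t_{i-1},t_i]$, $i=1,\dots,n$, set $$U_t:=L_t^*R_t^{-1}L_t,\qquad V_t:=L_t^*R_t^{-1}(y_i^+-\alpha_t),$$ with $U_0:=U_0^+$ and $V_0:=V_0^+$. Then on each interval $(t_{i-1},t_i]$, $i=1,\dots,n$, $U$ is the unique mild solution to the backward Riccati equation $$dU_t=\big[-A^*U_t-U_tA+U_tQU_t\big]dt,\qquad U_{t_i}=L^*\Sigma^{-1}L+U^+_{t_i},$$ and $V$ is the unique mild solution to the backward equation $$dV_t=\big[-A^*V_t+U_tQV_t+U_ta_t\big]dt,\qquad V_{t_i}=L^*\Sigma^{-1}y_i+V^+_{t_i},$$ where $U^+_{t_i}:=\lim_{s\downarrow t_i}U_s$, $V^+_{t_i}:=\lim_{s\downarrow t_i}V_s$ for $i<n$, and for $i=n$ the terminal values are $U_{t_n}=L^*\Sigma^{-1}L$ and $V_{t_n}=L^*\Sigma^{-1}y_n$.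
   Context: $H$ is a Hilbert space, $A$ generates a strongly continuous semigroup $(S_t)_{t\ge0}$ on $H$, $Q$ is a symmetric, positive, trace class operator on $H$, $Q_r:=\int_0^rS_uQS_u^*\,du$, and $(a_t)_{t\ge0}$ is a predictable $H$-valued process with integrable trajectories, defined on a stochastic basis $(\Omega,\mathcal F,(\mathcal F_t)_{t\ge0},\mathbb P)$. $0=t_0<t_1<\dots<t_n=T$; $L:H\to\mathbb R^m$ is bounded linear with adjoint $L^*$; $\Sigma\in\mathbb R^{m\times m}$ is a positive definite (covariance) matrix; $y_1,\dots,y_n\in\mathbb R^m$ are fixed; $y_i^+:=(y_i,\dots,y_n)\in\mathbb R^{m_i^+}$ with $m_i^+:=(n-i+1)m$. Superscript $+$ on a function of time denotes the right-sided limit. For $t\in(t_{i-1},t_i]$: $L_t:H\to\mathbb R^{m_i^+}$ is the stacked operator $L_t:=(LS_{t_i-t},LS_{t_{i+1}-t},\dots,LS_{t_n-t})^{\top}$. For $i=n$: $R_t:=\Sigma+LQ_{t_n-t}L^*$ and $\alpha_t:=L\int_t^{t_n}S_{t_n-s}a_s\,ds$. For $i<n$: $$R_t:=\begin{bmatrix}\Sigma&0\\0&R^+_{t_i}\end{bmatrix}+L_{t_i}Q_{t_i-t}L_{t_i}^*,\qquad \alpha_t:=\begin{bmatrix}0\\ \alpha^+_{t_i}\end{bmatrix}+L_{t_i}\int_t^{t_i}S_{t_i-s}a_s\,ds.$$ Mild solutions. $U$ is a mild solution of the Riccati equation on $(t_{i-1},t_i]$ with the given terminal value $U_{t_i}$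 if $U_t=S^*_{t_i-t}U_{t_i}S_{t_i-t}-\int_t^{t_i}S^*_{s-t}U_sQU_sS_{s-t}\,ds$ for $t\in(t_{i-1},t_i]$. $V$ is a mild solution of its equation with the given terminal value $V_{t_i}$ if $V_t=S^*_{t_i-t}V_{t_i}-\int_t^{t_i}\big(S^*_{s-t}U_sQV_s+S^*_{s-t}U_sa_s\big)\,ds$ for $t\in(t_{i-1},t_i]$.
   Formalization: Uniqueness of U is among mild solutions that are bounded on each [t,t_i] with t>t_{i-1} (this includes all strongly continuous ones); without local boundedness the integral equation can have several solutions, even for L=0 and rank-one Q. *)

(* Defs.v *)
From HB Require Import structures.
From mathcomp Require Import all_boot all_order all_algebra.
From mathcomp Require Import all_classical all_reals all_analysis.
Set Implicit Arguments.
Unset Strict Implicit.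
Unset Printing Implicit Defensive.
Import Order.TTheory GRing.Theory Num.Theory.
Import numFieldNormedType.Exports.
Local Open Scope classical_set_scope.
Local Open Scope ring_scope.

(** ** Bochner integral *)

Section Bochner.
Context {d : measure_display} {T : measurableType d} {R : realType}
  {E : normedModType R}.
Variables (mu : {measure set T -> \bar R}) (D : set T).
Implicit Types (s : seq (set T * E)) (f : T -> E).

(* [:: (A_1, v_1); ...; (A_k, v_k)] encodes the simple function
   1_(A_1) v_1 + ... + 1_(A_k) v_k; the A_j may overlap *)
Definition simple_fun s (x : T) : E := \sum_(p <- s) \1_(p.1) x *: p.2.

Definition simple_integrable s : Prop :=
  {in s, forall p, measurable p.1 /\ (mu (D `&` p.1) < +oo)%E}.

Definition simple_integral s : E :=
  \sum_(p <- s) fine (mu (D `&` p.1)) *: p.2.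

Definition is_bochner f (v : E) : Prop :=
  exists s : nat -> seq (set T * E),
    [/\ forall n, simple_integrable (s n),
        {ae mu, forall x, D x -> simple_fun (s n) x @[n --> \oo] --> f x},
        (\int[mu]_(x in D) `|f x - simple_fun (s n) x|%:E)%E
           @[n --> \oo] --> 0%E
      & simple_integral (s n) @[n --> \oo] --> v].

End Bochner.

Section BochnerLine.
Context {R : realType} {E : completeNormedModType R}.
Implicit Types (f : R -> E) (a b : R).

Definition is_bochner_itv a b f (v : E) : Prop :=
  is_bochner (@lebesgue_measure R) `[a, b]%classic f v.

Definition bochner_exists a b f : Prop := exists v, is_bochner_itv a b f v.

(* meaningful when bochner_exists a b f and a <= b *)
Definition bint a b f : E := get (is_bochner_itv a b f).

End BochnerLine.

(** ** Operators on Hilbert spaces *)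

Definition bounded_op {R : realType} {E F : normedModType R} (f : E -> F) :
  Prop := linear f /\ continuous f.

Definition euclid {R : realType} {p : nat} (u v : 'cV[R]_p) : R :=
  \sum_(j < p) u j ord0 * v j ord0.

Definition op_mx {R : realType} {p q : nat} (f : 'cV[R]_q -> 'cV[R]_p) :
  'M[R]_(p, q) := \matrix_(i, j) f (delta_mx j ord0) i ord0.

Definition posdef {R : realType} {p : nat} (M : 'M[R]_p) : Prop :=
  M^T = M /\ forall x : 'cV[R]_p, x != 0 -> 0 < euclid x (M *m x).

(* the vector at which get is evaluated exists, by the Riesz representation
   theorem, as soon as f is bounded and E is complete *)
Definition adjoint {R : realType} {E F : normedModType R}
    (ipE : E -> E -> R) (ipF : F -> F -> R) (f : E -> F) (y : F) : E :=
  get [set z | forall x, ipF (f x) y = ipE x z].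

Section Hilbert.
Context {R : realType} {H : completeNormedModType R}.
Variable ip : H -> H -> R.

Definition orthonormal_basis (B : set H) : Prop :=
  [/\ forall e, B e -> ip e e = 1,
      forall e e', B e -> B e' -> e != e' -> ip e e' = 0
    & forall x, (forall e, B e -> ip x e = 0) -> x = 0].

(* symmetric, positive and trace class: as Q is positive, |Q| = Q, and the
   trace does not depend on the orthonormal basis *)
Definition covariance_op (Q : H -> H) : Prop :=
  [/\ bounded_op Q,
      forall x y, ip (Q x) y = ip x (Q y),
      forall x, 0 <= ip (Q x) x
    & exists2 B, orthonormal_basis B &
        (\esum_(e in B) (ip (Q e) e)%:E < +oo)%E].

Definition C0_semigroup (S : R -> H -> H) : Prop :=
  [/\ forall t, 0 <= t -> bounded_op (S t),
      forall x, S 0 x = x,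
      forall s t x, 0 <= s -> 0 <= t -> S (s + t) x = S s (S t x)
    & forall x, S t x @[t --> 0^'+] --> x].

Definition generates (domA : set H) (A : H -> H) (S : R -> H -> H) : Prop :=
  domA = [set x | cvg (h^-1 *: (S h x - x) @[h --> 0^'+])] /\
  forall x, domA x -> h^-1 *: (S h x - x) @[h --> 0^'+] --> A x.

(* W is the limit of F s as s decreases to t, in operator norm *)
Definition op_right_limit (F : R -> H -> H) (t : R) (W : H -> H) : Prop :=
  bounded_op W /\
  forall e : R, 0 < e ->
    \forall s \near t^'+, forall x, `|F s x - W x| <= e * `|x|.

Definition op_right_lim (F : R -> H -> H) (t : R) (x : H) : H :=
  lim (F s x @[s --> t^'+]).

End Hilbert.

(** ** Predictable processes *)

Section Predictable.
Context {d : measure_display} {Omega : measurableType d} {R : realType}.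
Variable Ft : R -> set (set Omega).

Definition filtration : Prop :=
  [/\ forall t, 0 <= t -> sigma_algebra setT (Ft t),
      forall t, 0 <= t -> Ft t `<=` measurable
    & forall s t, 0 <= s -> s <= t -> Ft s `<=` Ft t].

(* the predictable sigma-algebra on [0, +oo[ x Omega *)
Definition predictable_set : set (set (R * Omega)) :=
  <<s [set p | 0 <= p.1],
    [set C | (exists2 F, Ft 0 F & C = [set 0] `*` F) \/
             (exists s t F, [/\ 0 <= s, s < t, Ft s F
                              & C = `]s, t]%classic `*` F])] >>.

Definition predictable {H : normedModType R} (a : R -> Omega -> H) : Prop :=
  forall B : set H, <<s [set O : set H | open O] >> B ->
    predictable_set [set p | 0 <= p.1 /\ B (a p.1 p.2)].

End Predictable.

(** ** The functions L_t, R_t, alpha_t, U_t and V_t *)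

(* stacked_dim m k = k.+1 * m, in a form that makes block matrices and stacked
   vectors of consecutive sizes fit without casts *)
Fixpoint stacked_dim (m k : nat) : nat :=
  if k is k'.+1 then (m + stacked_dim m k')%N else m.

Lemma stacked_dimE m k : stacked_dim m k = (k.+1 * m)%N.
Proof. by elim: k => [|k /= ->]; rewrite ?mul1n // [RHS]mulSn. Qed.

(* On ]t_(i-1), t_i] everything is indexed by k = n - i, the number of
   observation times after t_i; thus t_i is tm (n - k) and
   m_i^+ = stacked_dim m k. *)
Section Model.
Context {R : realType} {H : completeNormedModType R}.
Variables (ip : H -> H -> R) (S : R -> H -> H) (Q : H -> H).
Variables (m : nat) (L : H -> 'cV[R]_m) (Sigma : 'M[R]_m).
Variables (n : nat) (tm : nat -> R).

Definition Sadj (t : R) : H -> H := adjoint ip ip (S t).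

Definition Ladj : 'cV[R]_m -> H := adjoint ip euclid L.

Definition Qint (r : R) (x : H) : H := bint 0 r (fun u => S u (Q (Sadj u x))).

Fixpoint Lstack (k : nat) (t : R) (x : H) : 'cV[R]_(stacked_dim m k) :=
  match k with
  | 0%N => L (S (tm n - t) x)
  | k'.+1 => col_mx (L (S (tm (n - k'.+1)%N - t) x)) (Lstack k' t x)
  end.

Definition Lstack_adj (k : nat) (t : R) : 'cV[R]_(stacked_dim m k) -> H :=
  adjoint ip euclid (Lstack k t).
Arguments Lstack_adj : clear implicits.

Fixpoint Rmx (k : nat) (t : R) : 'M[R]_(stacked_dim m k) :=
  match k with
  | 0%N => Sigma + op_mx (fun z => L (Qint (tm n - t) (Ladj z)))
  | k'.+1 =>
      let ti := tm (n - k'.+1)%N in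
      block_mx Sigma 0 0 (lim (Rmx k' s @[s --> ti^'+]))
      + op_mx (fun z : 'cV[R]_(stacked_dim m k'.+1) =>
                 Lstack k'.+1 ti (Qint (ti - t) (Lstack_adj k'.+1 ti z)))
  end.

Fixpoint alpha (a : R -> H) (k : nat) (t : R) : 'cV[R]_(stacked_dim m k) :=
  match k with
  | 0%N => L (bint t (tm n) (fun s => S (tm n - s) (a s)))
  | k'.+1 =>
      let ti := tm (n - k'.+1)%N in
      (col_mx 0 (lim (alpha a k' s @[s --> ti^'+]))
         : 'cV[R]_(stacked_dim m k'.+1))
      + Lstack k'.+1 ti (bint t ti (fun s => S (ti - s) (a s)))
  end.

Fixpoint yplus (y : nat -> 'cV[R]_m) (k : nat) : 'cV[R]_(stacked_dim m k) :=
  match k with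
  | 0%N => y n
  | k'.+1 => col_mx (y (n - k'.+1)%N) (yplus y k')
  end.

(* the i such that t \in ]t_(i-1), t_i], for 0 < t <= t_n *)
Definition obs_index (t : R) : nat := (\sum_(0 <= j < n.+1) (tm j < t)%R)%N.

Definition Upos (t : R) (x : H) : H :=
  let k := (n - obs_index t)%N in
  Lstack_adj k t (invmx (Rmx k t) *m Lstack k t x).

Definition Vpos (a : R -> H) (y : nat -> 'cV[R]_m) (t : R) : H :=
  let k := (n - obs_index t)%N in
  Lstack_adj k t (invmx (Rmx k t) *m (yplus y k - alpha a k t)).

Definition Ufun (t : R) : H -> H :=
  if t == 0 then op_right_lim Upos 0 else Upos t.

Definition Vfun (a : R -> H) (y : nat -> 'cV[R]_m) (t : R) : H :=
  if t == 0 then lim (Vpos a y s @[s --> 0^'+]) else Vpos a y t.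

Definition Uterm (i : nat) (x : H) : H :=
  Ladj (invmx Sigma *m L x)
  + (if (i < n)%N then op_right_lim Ufun (tm i) x else 0).

Definition Vterm (a : R -> H) (y : nat -> 'cV[R]_m) (i : nat) : H :=
  Ladj (invmx Sigma *m y i)
  + (if (i < n)%N then lim (Vfun a y s @[s --> (tm i)^'+]) else 0).

(** ** Mild solutions on ]tl, tr] *)

(* Operator-valued integrals are strong Bochner integrals.  Local boundedness
   of U is part of the notion of solution: without it the integral equation
   may have several solutions, even with UT = 0 and Q of rank one. *)
Definition riccati_mild (tl tr : R) (UT : H -> H) (U : R -> H -> H) : Prop :=
  [/\ forall t, tl < t <= tr -> bounded_op (U t),
      forall t, tl < t <= tr ->
        exists C : R, forall s x, t <= s <= tr -> `|U s x| <= C * `|x|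
    & forall t x, tl < t <= tr ->
        let g s := Sadj (s - t) (U s (Q (U s (S (s - t) x)))) in
        bochner_exists t tr g /\
        U t x = Sadj (tr - t) (UT (S (tr - t) x)) - bint t tr g].

Definition backward_mild (tl tr : R) (U : R -> H -> H) (a : R -> H) (VT : H)
    (V : R -> H) : Prop :=
  forall t, tl < t <= tr ->
    let g s := Sadj (s - t) (U s (Q (V s))) + Sadj (s - t) (U s (a s)) in
    bochner_exists t tr g /\
    V t = Sadj (tr - t) VT - bint t tr g.

Definition unique_riccati_mild (tl tr : R) (UT : H -> H) (U : R -> H -> H) :
  Prop :=
  riccati_mild tl tr UT U /\
  forall U', riccati_mild tl tr UT U' ->
    forall t x, tl < t <= tr -> U' t x = U t x.

Definition unique_backward_mild (tl tr : R) (U : R -> H -> H) (a : R -> H)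
    (VT : H) (V : R -> H) : Prop :=
  backward_mild tl tr U a VT V /\
  forall V', backward_mild tl tr U a VT V' ->
    forall t, tl < t <= tr -> V' t = V t.

End Model.

(* Main.v *)
Require Import Defs.
From HB Require Import structures.
From mathcomp Require Import all_boot all_order all_algebra.
From mathcomp Require Import all_classical all_reals all_analysis.
From mathcomp Require Import measurable_realfun ring lra.
Set Implicit Arguments.
Unset Strict Implicit.
Unset Printing Implicit Defensive.
Import Order.TTheory GRing.Theory Num.Theory.
Import numFieldNormedType.Exports.
Local Open Scope classical_set_scope.
Local Open Scope ring_scope.

(* On the interval ]t_(i-1), t_i] let b_j be the image of the j-th basis vector
   under L_(t_i)^*, and b_j(t) = S_(t_i - t)^* b_j.  Every object is then of
   finite rank: with (P_t)_ij = <Q b_j(t), b_i(t)>, R_t has derivative - P_t,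
   hence N_t = R_t^-1 satisfies N' = N P N; alpha_t has derivative
   - (<a_t, b_i(t)>)_i; U_t x = sum_ij (N_t)_ij <x, b_j(t)> b_i(t) and
   V_t = sum_i (N_t (y_i^+ - alpha_t))_i b_i(t).  As S_(s-t)^* b_i(s) = b_i(t),
   the integrands of the mild equations are, for fixed t, combinations of the
   fixed vectors b_i(t) with scalar coefficients, and the equations reduce to
   the fundamental theorem of calculus for N and for N (y_i^+ - alpha).

   Locally bounded solutions of the Riccati equation are compared by a Gronwall
   argument.  A solution V of the second equation is not assumed to be bounded,
   so the difference W of two solutions is only known to have an integrable
   integrand.  But that integrand is S_(s-t)^* applied to a combination of the
   b_i(s), and the linear relations between the b_i(s) are constant for s in an
   interval to the left of any given time; this bounds W to the left of the
   infimum of the times after which W vanishes, and Gronwall applies again. *)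

(** Three obstacles shape the argument. The inverses must exist and stay bounded: since [Q] is
    positive, the form of [R_t] dominates its value at the right end of the interval, and positive
    definiteness then passes from one interval to the preceding one through the block with [Sigma].
    The trajectories of [a] are only integrable, so [alpha] is only absolutely continuous:
    derivatives are encoded by integrals of densities, and the rules for products and inverses come
    from an estimate of increments over fine partitions instead of almost everywhere
    differentiation. The vectors [b_j(t)] must depend continuously on [t]: this is the strong
    continuity of the adjoint semigroup, a Hilbert space fact proved here from weak integrals and
    the Riesz theorem. Vector integrals are values chosen by [get]; they are identified by pairing
    with arbitrary vectors, which reduces them to scalar integrals. All formulas extend continuously
    to the left end of their interval, and this is how the limits inside the definitions of [R],
    [alpha] and the terminal values are computed. *)

Section Squeeze.
Context {R : realType} {V : normedModType R} {T : Type} {F : set_system T}.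
Context {FF : Filter F}.
Implicit Types (f : T -> V) (y : V).

Lemma squeeze_norm f y (g : T -> R) : (\forall t \near F, `|f t - y| <= g t) ->
  g @ F --> 0 -> f @ F --> y.
Proof.
move=> fg g0; apply/cvgrPdist_le => e e0.
have h : \forall t \near F, `|0 - g t| <= e by move/cvgrPdist_le : g0; exact.
apply: filterS2 fg h => t fg; rewrite sub0r normrN distrC => h.
exact: le_trans fg (le_trans (ler_norm _) h).
Qed.

Lemma cvg_dist0 f y : f @ F --> y -> `|f t - y| @[t --> F] --> 0.
Proof.
move=> fy; rewrite -(normr0 V) -(subrr y); apply: cvg_norm.
by apply: cvgB => //; exact: cvg_cst.
Qed.

Lemma cvg_near_eq f g y : (\forall t \near F, f t = g t) ->
  g @ F --> y -> f @ F --> y.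
Proof.
by move=> fg; apply: cvg_trans; apply: near_eq_cvg; apply: filterS fg => t ->.
Qed.

End Squeeze.

Definition inner {R : realType} {H : completeNormedModType R}
    (ip : H -> H -> R) : Prop :=
  [/\ forall x y, ip x y = ip y x,
      forall x y z, ip (x + y) z = ip x z + ip y z,
      forall c x z, ip (c *: x) z = c * ip x z
    & forall x, ip x x = `|x| ^+ 2].

Section Inner.
Context {R : realType} {H : completeNormedModType R}.
Variables (ip : H -> H -> R) (ipH : inner ip).
Implicit Types x y z : H.

Lemma ipC x y : ip x y = ip y x. Proof. by case: ipH. Qed.
Lemma ipDl x y z : ip (x + y) z = ip x z + ip y z. Proof. by case: ipH. Qed.
Lemma ipZl c x z : ip (c *: x) z = c * ip x z. Proof. by case: ipH. Qed.
Lemma ipxx x : ip x x = `|x| ^+ 2. Proof. by case: ipH. Qed.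
Lemma ipDr x y z : ip x (y + z) = ip x y + ip x z.
Proof. by rewrite !(ipC x) ipDl. Qed.
Lemma ipZr c x z : ip x (c *: z) = c * ip x z.
Proof. by rewrite !(ipC x) ipZl. Qed.
Lemma ip0l z : ip 0 z = 0. Proof. by rewrite -(scale0r 0) ipZl mul0r. Qed.
Lemma ip0r z : ip z 0 = 0. Proof. by rewrite ipC ip0l. Qed.
Lemma ipNl x z : ip (- x) z = - ip x z.
Proof. by rewrite -scaleN1r ipZl mulN1r. Qed.
Lemma ipNr x z : ip x (- z) = - ip x z. Proof. by rewrite !(ipC x) ipNl. Qed.
Lemma ipBl x y z : ip (x - y) z = ip x z - ip y z.
Proof. by rewrite ipDl ipNl. Qed.
Lemma ipBr x y z : ip x (y - z) = ip x y - ip x z.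
Proof. by rewrite ipDr ipNr. Qed.
Lemma ip_suml I (r : seq I) P (F : I -> H) z :
  ip (\sum_(i <- r | P i) F i) z = \sum_(i <- r | P i) ip (F i) z.
Proof. by elim/big_rec2: _ => [|i u v _ <-]; rewrite ?ip0l ?ipDl. Qed.
Lemma ip_sumr I (r : seq I) P (F : I -> H) z :
  ip z (\sum_(i <- r | P i) F i) = \sum_(i <- r | P i) ip z (F i).
Proof. by rewrite ipC ip_suml; under eq_bigr do rewrite ipC. Qed.

Lemma ip_ge0 x : 0 <= ip x x. Proof. by rewrite ipxx sqr_ge0. Qed.

Lemma ip_cauchy x y : `|ip x y| <= `|x| * `|y|.
Proof.
have [->|y0] := eqVneq y 0; first by rewrite ip0r !normr0 mulr0.
have y1 : 0 < `|y| by rewrite normr_gt0.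
have := ip_ge0 (`|y| ^+ 2 *: x - ip x y *: y).
rewrite !(ipBl, ipBr, ipZl, ipZr) (ipC y x) !ipxx => h.
have {h} : 0 <= `|y| ^+ 2 * (`|x| ^+ 2 * `|y| ^+ 2 - (ip x y) ^+ 2).
  by rewrite (le_trans h)// le_eqVlt; apply/orP; left; apply/eqP; ring.
rewrite pmulr_rge0 ?exprn_gt0// subr_ge0 -exprMn => h.
by rewrite -ler_sqr ?nnegrE ?mulr_ge0// real_normK ?num_real.
Qed.

Lemma ip_le x y : ip x y <= `|x| * `|y|.
Proof. exact: le_trans (ler_norm _) (ip_cauchy _ _). Qed.

Lemma ip_inj x y : (forall z, ip x z = ip y z) -> x = y.
Proof.
move=> h; apply/eqP; rewrite -subr_eq0 -normr_eq0 -sqrf_eq0 -ipxx.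
by rewrite ipBl h subrr.
Qed.

Lemma ip_cvg {T} {F : set_system T} {FF : Filter F} (f g : T -> H) x y :
  f @ F --> x -> g @ F --> y -> ip (f t) (g t) @[t --> F] --> ip x y.
Proof.
move=> fx gy.
have -> : (fun t => ip (f t) (g t)) =
   (fun t => ip x y + (ip (f t - x) (g t - y) + ip x (g t - y) + ip (f t - x) y)).
  by apply/funext => t; rewrite !(ipBl, ipBr); ring.
rewrite -[X in _ --> X]addr0; apply: cvgD; first exact: cvg_cst.
have fx0 := cvg_dist0 fx; have gy0 := cvg_dist0 gy.
apply: norm_cvg0 => /=.
have : (`|f t - x| * `|g t - y| + `|x| * `|g t - y| + `|f t - x| * `|y|) @[t --> F] --> 0 * 0 + `|x| * 0 + 0 * `|y|.
  apply: cvgD; [apply: cvgD|]; apply: cvgM;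
    solve [exact: fx0|exact: gy0|exact: cvg_cst].
rewrite !(mul0r, mulr0, addr0) => h.
apply: (squeeze_cvgr _ (cvg_cst 0) h).
apply: nearW => t; rewrite normr_ge0/=.
by rewrite (le_trans (ler_normD _ _))// lerD ?ip_cauchy// 
  (le_trans (ler_normD _ _))// lerD ?ip_cauchy.
Qed.

End Inner.

(** * Bounded operators and adjoints *)

Section Operators.
Context {R : realType} {E F : normedModType R}.
Implicit Types f : E -> F.

Lemma linear_bounded_op f C : linear f -> (forall x, `|f x| <= C * `|x|) ->
  bounded_op f.
Proof.
move=> lf fC; split=> // x.
pose g : {linear E -> F} := HB.pack f (GRing.isLinear.Build _ _ _ _ _ lf).
apply: (@linear_bounded_continuous _ _ _ g).1.
apply/linear_boundedP; near=> r => y; apply: le_trans (fC y) _.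
by rewrite ler_wpM2r.
Unshelve. all: by end_near. Qed.

Lemma bounded_opP f : bounded_op f ->
  exists2 C, 0 <= C & forall x, `|f x| <= C * `|x|.
Proof.
move=> [lf cf].
pose g : {linear E -> F} := HB.pack f (GRing.isLinear.Build _ _ _ _ _ lf).
have /linear_boundedP h : bounded_near g (nbhs 0).
  by apply: (@continuous_linear_bounded R E F 0 g); exact: cf.
near +oo_R => C; exists C; first by near: C; exact: nbhs_pinfty_ge.
by near: C.
Unshelve. all: by end_near. Qed.

Lemma bounded_opD f x y : bounded_op f -> f (x + y) = f x + f y.
Proof. by case=> + _ => /(_ 1 x y); rewrite !scale1r. Qed.

Lemma bounded_op0 f : bounded_op f -> f 0 = 0.
Proof.
by move=> bf; apply: (addrI (f 0)); rewrite -bounded_opD// !addr0.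
Qed.

Lemma bounded_opZ f c x : bounded_op f -> f (c *: x) = c *: f x.
Proof.
by move=> bf; case: (bf) => /(_ c x 0); rewrite !addr0 bounded_op0// addr0.
Qed.

Lemma bounded_opB f x y : bounded_op f -> f (x - y) = f x - f y.
Proof.
by move=> bf; rewrite -scaleN1r bounded_opD// bounded_opZ// scaleN1r.
Qed.

Lemma bounded_op_sum f I (r : seq I) P (G : I -> E) : bounded_op f ->
  f (\sum_(i <- r | P i) G i) = \sum_(i <- r | P i) f (G i).
Proof.
move=> bf; elim/big_rec2: _ => [|i u v _ <-]; first exact: bounded_op0.
exact: bounded_opD.
Qed.

End Operators.

(** * The Riesz representation theorem and existence of adjoints *)

Section Riesz.
Context {R : realType} {H : completeNormedModType R}.
Variables (ip : H -> H -> R) (ipH : inner ip).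
Implicit Types x y z : H.

Lemma quad_ge0_eq0 (p q : R) : (forall t, 0 <= t ^+ 2 * p + t * q) -> q = 0.
Proof.
move=> h; apply/eqP/contraT => q0; exfalso.
have p0 : 0 <= p by have := h 1; have := h (-1); lra.
have p1 : 0 < p + 1 by lra.
(* The value here is minus a square; the denominator [p + 1] stays positive even when [p = 0]. *)
have := h (- q / (p + 1)).
have -> : (- q / (p + 1)) ^+ 2 * p + - q / (p + 1) * q =
   - (q / (p + 1)) ^+ 2.
  by field; lra.
rewrite oppr_ge0 leNgt exprn_even_gt0//= mulf_neq0// invr_neq0//; lra.
Qed.

(* The representing vector minimises [|x|^2 - 2 f x] over [C]. *)
Lemma riesz_subspace (C : set H) (f : H -> R) M :
  0 <= M -> C 0 -> (forall c x y, C x -> C y -> C (c *: x + y)) -> closed C ->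
  (forall c x y, f (c *: x + y) = c * f x + f y) ->
  (forall x, `|f x| <= M * `|x|) ->
  exists2 z, C z & forall x, C x -> f x = ip x z.
Proof.
move=> M0 C0 CL Ccl fL fM.
have f0 : f 0 = 0.
  by have := fL (-1) 0 0; rewrite scaler0 addr0; lra.
pose phi x := `|x| ^+ 2 - 2 * f x.
have phiE c x y : phi (c *: x + y) =
    phi y + c ^+ 2 * `|x| ^+ 2 + c * (2 * (ip x y - f x)).
  rewrite /phi -!(ipxx ipH) fL !(ipDl ipH, ipDr ipH, ipZl ipH, ipZr ipH).
  by rewrite (ipC ipH y x); ring.
pose V := phi @` C.
have lbV : lbound V (- M ^+ 2).
  move=> _ [x _ <-]; rewrite /phi.
  have := ler_norm (f x); have := fM x; have := sqr_ge0 (`|x| - M).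
  rewrite sqrrB; lra.
have infV : has_inf V by split; [exists (phi 0), 0|exists (- M ^+ 2)].
set m := inf V.
have mle x : C x -> m <= phi x.
  by move=> Cx; apply: (ge_inf infV.2); exists x.
have approx n : exists x, C x /\ phi x < m + n.+1%:R^-1.
  have [|_ [x Cx <-] h] := @inf_adherent _ V n.+1%:R^-1 _ infV; first by [].
  by exists x.
have [u uP] := choice approx.
have Cu n : C (u n) by have [] := uP n.
have uu n k : `|u n - u k| ^+ 2 <= 2 * (n.+1%:R^-1 + k.+1%:R^-1).
  have := mle (2^-1 *: u n + 2^-1 *: u k).
  have Ck : C (2^-1 *: u k) by rewrite -[_ *: _]addr0; exact: CL.
  move=> /(_ (CL _ _ _ (Cu n) Ck)).
  (* Parallelogram identity for [phi]: the midpoint has value at least [m], so two near-minimisers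
     are close and [u] is Cauchy. *)
  have : phi (2^-1 *: u n + 2^-1 *: u k) =
    (phi (u n) + phi (u k)) / 2 - `|u n - u k| ^+ 2 / 4.
    rewrite -[2^-1 *: u k]addr0 !phiE /phi !(ip0r ipH) f0 normr0.
    rewrite -!(ipxx ipH) !(ipBl ipH, ipBr ipH, ipDr ipH, ipZr ipH, ip0r ipH).
    by rewrite (ipC ipH (u k)); field.
  move=> ->; have [_] := uP n; have [_] := uP k.
  move: (n.+1%:R^-1) (k.+1%:R^-1) => p q; lra.
have /cauchy_cvgP cu : cauchy (u @ \oo).
  apply/cauchy_exP => e e0.
  have e2 : 0 < (e ^+ 2) / 4 by rewrite divr_gt0// exprn_gt0.
  have [N _ hN] := near_infty_natSinv_lt (PosNum e2).
  exists (u N), N => // n /= Nn; rewrite -ball_normE /=.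
  rewrite -ltr_sqr ?nnegrE// ?ltW//.
  apply: le_lt_trans (uu _ _) _.
  have := hN _ Nn; have := hN N (leqnn _) => /=.
  move: (n.+1%:R^-1) (N.+1%:R^-1) => p q; lra.
set z := lim (u @ \oo).
have uz : u @ \oo --> z by [].
have Cz : C z by apply: (closed_cvg _ Ccl _ _ uz); exact: nearW.
have fz : f \o u @ \oo --> f z.
  apply: (@squeeze_norm _ _ _ _ _ _ _ (fun n => M * `|u n - z|)).
    apply: nearW => n /=; have -> : f (u n) - f z = f (-1 *: z + u n).
      by rewrite fL; ring.
    by apply: le_trans (fM _) _; rewrite scaleN1r addrC.
  rewrite -[X in _ --> X](mulr0 M); apply: cvgM; first exact: cvg_cst.
  exact: cvg_dist0.
have phiz : phi z <= m.
  have h1 : phi \o u @ \oo --> phi z.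
    apply: cvgB; last by apply: cvgM => //; exact: cvg_cst.
    by apply: (cvgM (cvg_norm uz) (cvg_norm uz)).
  have h2 : (m + n.+1%:R^-1) @[n --> \oo] --> m + 0.
    by apply: cvgD; [exact: cvg_cst|exact: cvg_harmonic].
  rewrite -[m]addr0; apply: ler_cvg_to h1 h2 _.
  by apply: nearW => n; apply/ltW; have [] := uP n.
exists z => // x Cx; apply/esym/eqP; rewrite -subr_eq0; apply/eqP.
(* Moving the minimiser to [t *: x + z] changes [phi] by a quadratic in [t] that is never negative,
   so its linear coefficient is zero. *)
suff : 2 * (ip x z - f x) = 0 by lra.
apply: (@quad_ge0_eq0 (`|x| ^+ 2)) => t.
have := mle _ (CL t _ _ Cx Cz); rewrite phiE; lra.
Unshelve. all: by end_near. Qed.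

Lemma riesz (f : H -> R) : bounded_op f -> exists z, forall x, f x = ip x z.
Proof.
move=> bf; have [M M0 fM] := bounded_opP bf.
have [z _ zP] : exists2 z, setT z & forall x, setT x -> f x = ip x z.
  apply: (riesz_subspace M0) => //.
  by move=> c x y; rewrite bf.1.
by exists z => x; exact: zP.
Qed.

(** Pairing with [x] is represented on [C] by some [z] in [C], the orthogonal projection of [x];
    then [x - z] is orthogonal to [C], hence zero. *)
Lemma orthocomplement0 (C : set H) :
  C 0 -> (forall c x y, C x -> C y -> C (c *: x + y)) -> closed C ->
  (forall z, (forall x, C x -> ip x z = 0) -> z = 0) -> C = setT.
Proof.
move=> C0 CL Ccl Cp; apply/seteqP; split=> // x _.
have [z Cz zP] : exists2 z, C z & forall y, C y -> ip y x = ip y z.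
  apply: (riesz_subspace (normr_ge0 x) C0 CL Ccl) => [c y w|w].
    by rewrite (ipDl ipH) (ipZl ipH).
  by rewrite mulrC; exact: ip_cauchy.
suff -> : x = z by [].
apply/eqP; rewrite -subr_eq0; apply/eqP/Cp => y Cy.
by rewrite (ipBr ipH) zP// subrr.
Qed.

Section Adjoint.
Context {F : normedModType R}.
Variable ipF : F -> F -> R.
Hypothesis ipF_linear : forall y : F, linear (ipF^~ y).
Hypothesis ipF_bounded : exists K, forall x y : F, `|ipF x y| <= K * (`|x| * `|y|).
Variables (f : H -> F) (bf : bounded_op f).

(** By the Riesz theorem the set in [adjoint] is nonempty, so [get] returns a true adjoint vector.
    The form on the target is only tied to its norm by a bound, because ['cV[R]_p] carries the
    maximum norm, which [euclid] does not induce. *)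
Lemma adjointP x (y : F) : ipF (f x) y = ip x (adjoint ip ipF f y).
Proof.
suff : [set z | forall x, ipF (f x) y = ip x z] !=set0.
  by move=> /getPex; exact.
suff : bounded_op (fun x => ipF (f x) y) by move=> /riesz[z hz]; exists z.
have [M M0 fM] := bounded_opP bf; have [K hK] := ipF_bounded.
apply: (@linear_bounded_op _ _ _ _ (`|K| * M * `|y|)).
  by move=> c u v; rewrite (bf.1 c u v) ipF_linear.
move=> u; apply: le_trans (hK _ _) _.
rewrite -[leRHS]mulrA (mulrC `|y|) mulrA -!mulrA.
apply: (@le_trans _ _ (`|K| * (`|f u| * `|y|))).
  by apply: ler_wpM2r; rewrite ?mulr_ge0// ler_norm.
by apply: ler_wpM2l => //; rewrite mulrA ler_wpM2r// fM.
Qed.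

End Adjoint.
End Riesz.

(** * Integrals over real intervals *)

Section LineIntegral.
Context {R : realType}.
Implicit Types (f g F G : R -> R) (a b c t : R).
Local Notation mu := (@lebesgue_measure R).

Definition lint f a b : R := \int[mu]_(x in `[a, b]) f x.

Definition itv_integrable a b f : Prop := mu.-integrable `[a, b] (EFin \o f).

Let mcc a b : measurable (`[a, b]%classic : set (measurableTypeR R)).
Proof. exact: measurable_itv. Qed.

Lemma itv_integrableS a b c t f : a <= c -> t <= b ->
  itv_integrable a b f -> itv_integrable c t f.
Proof.
move=> ac tb; apply: integrableS => //.
by apply: subset_itv; rewrite bnd_simp.
Qed.

Lemma continuous_itv_integrable a b f : continuous f -> itv_integrable a b f.
Proof.
move=> cf; apply: continuous_compact_integrable; first exact: segment_compact.
by apply: continuous_subspaceT => x; exact: cf.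
Qed.

Lemma itv_integrableD a b f g : itv_integrable a b f -> itv_integrable a b g ->
  itv_integrable a b (fun x => f x + g x).
Proof. by move=> fi gi; exact: (integrableD (mcc a b) fi gi). Qed.

Lemma itv_integrableZ a b k f : itv_integrable a b f ->
  itv_integrable a b (fun x => k * f x).
Proof. by move=> fi; exact: (integrableZl (mcc a b) k fi). Qed.

Lemma itv_integrable_sum a b I (r : seq I) (f : I -> R -> R) :
  (forall i, itv_integrable a b (f i)) ->
  itv_integrable a b (fun x => \sum_(i <- r) f i x).
Proof.
move=> fi; elim: r => [|i r ih].
  have -> : (fun x => \sum_(i <- [::]) f i x) = cst 0 :> (R -> R).
    by apply/funext => x; rewrite big_nil.
  exact: integrable0.
have -> : (fun x => \sum_(j <- i :: r) f j x) =
    (fun x => f i x + \sum_(j <- r) f j x) :> (R -> R).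
  by apply/funext => x; rewrite big_cons.
exact: itv_integrableD.
Qed.

Lemma itv_integrable_le a b f g : measurable_fun `[a, b] f ->
  (forall x, a <= x <= b -> `|f x| <= g x) -> itv_integrable a b g ->
  itv_integrable a b f.
Proof.
move=> mf fg gi; apply: le_integrable gi => //.
  exact/measurable_EFinP.
move=> x /=; rewrite in_itv/= => xab; rewrite lee_fin.
by apply: le_trans (fg _ xab) _; rewrite ler_norm.
Qed.

Lemma itv_measurable a b f : itv_integrable a b f -> measurable_fun `[a, b] f.
Proof. by move=> /measurable_int/measurable_EFinP. Qed.

Lemma itv_integrable_norm a b f : itv_integrable a b f ->
  itv_integrable a b (fun x => `|f x|).
Proof. by move=> fi; exact: (integrable_norm fi). Qed.

Lemma itv_integrableM a b f g C : (forall x, a <= x <= b -> `|f x| <= C) ->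
  measurable_fun `[a, b] f -> itv_integrable a b g ->
  itv_integrable a b (fun x => f x * g x).
Proof.
move=> fC mf gi; apply: (@itv_integrable_le _ _ _ (fun x => C * `|g x|)).
- by apply: measurable_funM => //; exact: itv_measurable.
- by move=> x xab; rewrite normrM ler_wpM2r// fC.
- exact/itv_integrableZ/itv_integrable_norm.
Qed.

Lemma lintD f g a b : itv_integrable a b f -> itv_integrable a b g ->
  lint (fun x => f x + g x) a b = lint f a b + lint g a b.
Proof. exact: RintegralD. Qed.

Lemma lintB f g a b : itv_integrable a b f -> itv_integrable a b g ->
  lint (fun x => f x - g x) a b = lint f a b - lint g a b.
Proof. exact: RintegralB. Qed.

Lemma lintZ k f a b : itv_integrable a b f ->
  lint (fun x => k * f x) a b = k * lint f a b.
Proof. exact: RintegralZl. Qed.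

Lemma lint_sum I (r : seq I) (f : I -> R -> R) a b :
  (forall i, itv_integrable a b (f i)) ->
  lint (fun x => \sum_(i <- r) f i x) a b = \sum_(i <- r) lint (f i) a b.
Proof.
move=> fi; elim: r => [|i r ih].
  rewrite big_nil /lint (@eq_Rintegral _ _ _ mu _ (cst 0)); last first.
    by move=> x _; rewrite big_nil.
  by rewrite Rintegral_cst// mul0r.
rewrite big_cons -ih -lintD//; last exact: itv_integrable_sum.
by apply: eq_Rintegral => x _; rewrite big_cons.
Qed.

Lemma eq_lint f g a b : (forall x, a <= x <= b -> f x = g x) ->
  lint f a b = lint g a b.
Proof.
by move=> fg; apply: eq_Rintegral => x; rewrite inE/= in_itv/= => /fg.
Qed.

Lemma lint_le f g a b : itv_integrable a b f -> itv_integrable a b g ->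
  (forall x, a <= x <= b -> f x <= g x) -> lint f a b <= lint g a b.
Proof. by move=> fi gi fg; apply: le_Rintegral => // x; exact: fg. Qed.

Lemma lint_norm f a b : itv_integrable a b f ->
  `|lint f a b| <= lint (fun x => `|f x|) a b.
Proof. by move=> fi; exact: le_normr_Rintegral. Qed.

Lemma lint_ge0 f a b : (forall x, a <= x <= b -> 0 <= f x) -> 0 <= lint f a b.
Proof. by move=> f0; apply: Rintegral_ge0 => x; exact: f0. Qed.

Lemma lint_cst k a b : a <= b -> lint (fun=> k) a b = k * (b - a).
Proof.
move=> ab; rewrite /lint Rintegral_cst//= lebesgue_measure_itv/= lte_fin.
move: ab; rewrite le_eqVlt => /predU1P[->|->] //=.
by rewrite ltxx subrr.
Qed.

Lemma lint_bound f a b C : a <= b -> itv_integrable a b f ->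
  (forall x, a <= x <= b -> `|f x| <= C) -> `|lint f a b| <= C * (b - a).
Proof.
move=> ab fi fC; apply: le_trans (lint_norm fi) _; rewrite -lint_cst//.
apply: lint_le => //; first exact: itv_integrable_norm.
by apply: continuous_itv_integrable; exact: cst_continuous.
Qed.

Lemma lint_split f a b c : a <= b -> b <= c -> itv_integrable a c f ->
  lint f a c = lint f a b + lint f b c.
Proof.
move=> ab bc fi; apply/eqP; rewrite addrC -subr_eq; apply/eqP; rewrite /lint Rintegral_itvB ?bnd_simp//.
apply: Rintegral_itv_obnd_cbnd; apply: integrableS fi => //.
by apply: subset_itv; rewrite bnd_simp.
Qed.

Lemma lint_itv1 f a b : b <= a -> lint f a b = 0.
Proof.
rewrite le_eqVlt => /predU1P[->|ba]; first by rewrite /lint set_itv1 Rintegral_set1.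
by rewrite /lint set_itv_ge ?Rintegral_set0// bnd_simp -ltNge.
Qed.

Lemma lint_derive f a t : a < t -> continuous f ->
  is_derive t (1 : R) (lint f a) (f t).
Proof.
move=> at_ cf.
have [|//|d1 d2] := @continuous_FTC1_closed R f a t (t + 1) _ _ at_ (cf t).
  lra.
  exact: continuous_itv_integrable.
apply: DeriveDef; first exact: d1.
by have := derive1E (lint f a) t; rewrite d2 => <-.
Qed.

Lemma FTC2 f F a b : a <= b -> continuous f ->
  (forall t, a <= t <= b -> is_derive t (1 : R) F (f t)) ->
  lint f a b = F b - F a.
Proof.
rewrite le_eqVlt => /predU1P[-> cf _|ab cf dF].
  by rewrite lint_itv1// subrr.
have cF t : a <= t <= b -> {for t, continuous F}.
  move=> tab; apply: differentiable_continuous; apply/derivable1_diffP.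
  by have [] := dF _ tab.
rewrite /lint /Rintegral (@continuous_FTC2 R f F)// -?EFinB//.
- by apply: continuous_subspaceT => x; exact: cf.
- split.
  + by move=> x; rewrite in_itv/= => /andP[ax xb]; have [] := dF x; rewrite ?ltW.
  + by apply: cvg_at_right_filter; apply: cF; rewrite lexx ltW.
  + by apply: cvg_at_left_filter; apply: cF; rewrite lexx ltW.
- move=> x; rewrite in_itv/= => /andP[ax xb]; rewrite derive1E.
  by apply: derive_val; apply: dF; rewrite !ltW.
Qed.

End LineIntegral.

(** * Semigroups and their adjoints *)

Section Semigroup.
Context {R : realType} {H : completeNormedModType R}.
Variables (S : R -> H -> H) (S_sg : C0_semigroup S).

Let Sb t : 0 <= t -> bounded_op (S t). Proof. by case: S_sg => + _ _ _; exact. Qed.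
Let S0 x : S 0 x = x. Proof. by case: S_sg. Qed.
Let SD s t x : 0 <= s -> 0 <= t -> S (s + t) x = S s (S t x).
Proof. by case: S_sg => _ _ + _; exact. Qed.

Lemma semigroup_modulus x e : 0 < e ->
  exists2 d : R, 0 < d & forall h, 0 <= h < d -> `|S h x - x| <= e.
Proof.
move=> e0; case: S_sg => _ _ _ /(_ x) /cvgrPdistC_le /(_ _ e0).
move=> [d /= d0 hd]; exists d => // h /andP[]; rewrite le_eqVlt.
move=> /predU1P[<- _|h0 hl]; first by rewrite S0 subrr normr0 ltW.
by apply: hd => //=; rewrite sub0r normrN gtr0_norm.
Qed.

(** Uniform boundedness: failure would give times at most [1 / (k + 1)] where the operator norm
    exceeds [k + 1], although strong continuity at 0 bounds every orbit along these times. *)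
Lemma semigroup_bound_near0 :
  exists2 d : R, 0 < d & exists2 M, 1 <= M &
    forall t x, 0 <= t <= d -> `|S t x| <= M * `|x|.
Proof.
apply: contrapT => hn.
have bad (k : nat) : exists tx : R * H,
    0 <= tx.1 <= k.+1%:R^-1 /\ k.+1%:R * `|tx.2| < `|S tx.1 tx.2|.
  apply: contrapT => hk; apply: hn; exists k.+1%:R^-1; first by [].
  exists k.+1%:R; first by rewrite ler1n.
  move=> t x tk; rewrite leNgt; apply/negP => h; apply: hk.
  by exists (t, x).
have [tx txP] := choice bad.
pose F := [set f | exists k, f = S (tx k).1].
have t0 k : 0 <= (tx k).1 by have [/andP[]] := txP k.
have [||M hM] := @Banach_Steinhauss R H H F _ _ 1.
- move=> _ [k ->]; have bS := Sb (t0 k); split; last exact: bS.1.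
  move=> r; have [C C0 hC] := bounded_opP bS.
  exists (C * r) => x xr; apply: le_trans (hC x) _; exact: ler_wpM2l.
- move=> x; have [d d0 hd] := @semigroup_modulus x 1 ltr01.
  have [N _ hN] := near_infty_natSinv_lt (PosNum d0).
  (* From index [N] on the orbit stays within 1 of [x]; the finitely many earlier values are
     absorbed by the sum. *)
  exists (`|x| + 1 + \sum_(k < N) `|S (tx k).1 x|) => _ [k ->].
  have s0 : 0 <= \sum_(k < N) `|S (tx k).1 x| by exact: sumr_ge0.
  have [kN|Nk] := ltnP k N.
    rewrite (bigD1 (Ordinal kN))//= addrCA lerDl addr_ge0//.
    exact: sumr_ge0.
  have : `|S (tx k).1 x - x| <= 1.
    apply: hd; rewrite t0/=; have [/andP[_ h] _] := txP k.
    by apply: le_lt_trans h _; exact: hN.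
  have := ler_normD (S (tx k).1 x - x) x; rewrite subrK; lra.
have [k kM] : exists k : nat, M < k.+1%:R.
  by exists (Num.bound `|M|); apply: le_lt_trans (ler_norm _) _;
     rewrite (lt_le_trans (archi_boundP _))// ler_nat.
have [_] := txP k; set x := (tx k).2; set t := (tx k).1 => h.
have x0 : 0 < `|x|.
  rewrite normr_gt0; apply: contraTneq h => ->.
  by rewrite (bounded_op0 (Sb (t0 k))) normr0 mulr0 ltxx.
have := hM _ (ex_intro _ k erefl) (`|x|^-1 *: x).
rewrite normrZ normfV normr_id mulVf ?gt_eqF// => /(_ (lexx _)).
rewrite (bounded_opZ _ _ (Sb (t0 k))) normrZ normfV normr_id.
rewrite ler_pdivrMl//; apply/negP; rewrite -ltNge -/t.
apply: le_lt_trans h; rewrite mulrC ler_wpM2r// ltW//.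
Qed.

Lemma semigroup_bound T : exists2 M, 0 <= M &
  forall t x, 0 <= t <= T -> `|S t x| <= M * `|x|.
Proof.
have [d d0 [M M1 hM]] := semigroup_bound_near0.
have M0 : 0 <= M by apply: le_trans M1.
have step (k : nat) t x : 0 <= t <= k%:R * d -> `|S t x| <= M ^+ k.+1 * `|x|.
  elim: k t x => [|k ih] t x /andP[t0 tk].
    by apply: hM; rewrite t0/=; rewrite mul0r in tk; lra.
  have [td|dt] := lerP t d.
    apply: le_trans (hM _ _ _) _; first by rewrite t0.
    by rewrite ler_wpM2r// exprS ler_peMr// exprn_ege1.
  have -> : t = d + (t - d) by rewrite addrC subrK.
  rewrite SD ?subr_ge0; [|exact: ltW|exact: ltW].
  apply: le_trans (hM _ _ _) _; first by rewrite lexx ltW.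
  rewrite [M ^+ _]exprS -mulrA ler_wpM2l// ih// subr_ge0 ltW//=.
  by move: tk; rewrite -natr1 mulrDl mul1r; lra.
exists (M ^+ (Num.bound (T / d)).+1); first by rewrite exprn_ge0.
move=> t x /andP[t0 tT]; apply: step; rewrite t0/=.
rewrite -ler_pdivrMr//; apply: le_trans (ltW (archi_boundP _)) => //.
  by rewrite ler_pdivrMr// divfK ?gt_eqF.
by rewrite divr_ge0// ?(le_trans t0 tT)// ltW.
Qed.

(** Freezing the orbit at negative times makes it continuous on the whole line, the form used by the
    integration lemmas. Left continuity rests on the local bound: for [s <= t] the increment is
    [S s] applied to [S (t - s) x - x]. *)
Lemma semigroup_continuous x : continuous (fun t : R => S (Num.max 0 t) x).
Proof.
move=> t0; apply/cvgrPdistC_le => e e0.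
have [M M0 hM] := semigroup_bound (`|t0| + 1).
have [|d d0 hd] := @semigroup_modulus x (e / (M + 1)).
  by rewrite divr_gt0//; lra.
have key s t : 0 <= s -> s <= t -> t <= `|t0| + 1 -> t - s < d ->
    `|S t x - S s x| <= e.
  move=> s0 st tT tsd.
  have -> : t = s + (t - s) by rewrite addrC subrK.
  rewrite SD ?subr_ge0// -(bounded_opB _ _ (Sb s0)).
  apply: le_trans (hM _ _ _) _; first by rewrite s0/= (le_trans st).
  have := hd (t - s); rewrite subr_ge0 st tsd => /(_ isT).
  rewrite ler_pdivlMr; last lra.
  move=> h; apply: le_trans h; rewrite mulrC ler_wpM2l//; lra.
have m0 : 0 < Num.min d 1 by rewrite lt_min d0 ltr01.
near=> t.
have : `|t - t0| < Num.min d 1.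
  by near: t; exists (Num.min d 1) => //= t; rewrite /ball_/= distrC.
rewrite lt_min => /andP[td t1].
have [mt mt0] : Num.max 0 t <= `|t0| + 1 /\ Num.max 0 t0 <= `|t0| + 1.
  have := ler_norm t0; have := normr_ge0 t0; rewrite !ge_max.
  by have := ler_norm (t - t0); split; apply/andP; split; lra.
have tt : `|Num.max 0 t - Num.max 0 t0| <= `|t - t0|.
  rewrite /Num.max; case: ltrP => ?; case: ltrP => ?; rewrite ?subrr//;
  rewrite ler_norml; have := ler_norm (t - t0); have := ler_norm (t0 - t);
  rewrite (distrC t0); lra.
have [le|le] := leP (Num.max 0 t0) (Num.max 0 t).
  apply: key => //; first by rewrite le_max lexx.
  by apply: le_lt_trans td; apply: le_trans tt; exact: ler_norm.
rewrite distrC; apply: key => //; first by rewrite le_max lexx.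
  exact: ltW.
by apply: le_lt_trans td; apply: le_trans tt; rewrite distrC; exact: ler_norm.
Unshelve. all: by end_near. Qed.

End Semigroup.

(** * The adjoint semigroup and its strong continuity *)

Section AdjointSemigroup.
Context {R : realType} {H : completeNormedModType R}.
Variables (ip : H -> H -> R) (ipH : inner ip).
Variables (S : R -> H -> H) (S_sg : C0_semigroup S).

Let Sb t : 0 <= t -> bounded_op (S t). Proof. by case: S_sg => + _ _ _; exact. Qed.

Lemma ip_adjoint (f : H -> H) x y : bounded_op f ->
  ip (f x) y = ip x (adjoint ip ip f y).
Proof.
move=> bf; apply: (adjointP ipH) => //.
  by move=> z c u v; rewrite (ipDl ipH) (ipZl ipH).
by exists 1 => u v; rewrite mul1r; exact: ip_cauchy.
Qed.

Lemma SadjP t x y : 0 <= t -> ip (S t x) y = ip x (Sadj ip S t y).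
Proof. by move=> t0; apply: ip_adjoint; exact: Sb. Qed.

Lemma Sadj_bound t C : 0 <= t -> 0 <= C -> (forall x, `|S t x| <= C * `|x|) ->
  forall y, `|Sadj ip S t y| <= C * `|y|.
Proof.
move=> t0 C0 hC y; have [->|y0] := eqVneq (Sadj ip S t y) 0.
  by rewrite normr0 mulr_ge0.
have : 0 < `|Sadj ip S t y| by rewrite normr_gt0.
move=> h; rewrite -(ler_pM2l h) -expr2 -(ipxx ipH) -SadjP//.
apply: le_trans (ip_le ipH _ _) _; apply: le_trans (ler_wpM2r _ (hC _)) _ => //.
by rewrite le_eqVlt; apply/orP; left; apply/eqP; ring.
Qed.

Lemma Sadj_linear t : 0 <= t -> linear (Sadj ip S t).
Proof.
move=> t0 c x y; apply: (ip_inj ipH) => z.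
rewrite !(ipC ipH _ z) -SadjP// !(ipDr ipH, ipZr ipH).
by rewrite !SadjP.
Qed.

Lemma Sadj_bounded t : 0 <= t -> bounded_op (Sadj ip S t).
Proof.
move=> t0; have [C C0 hC] := bounded_opP (Sb t0).
by apply: (linear_bounded_op (C := C)) (Sadj_linear t0) _; exact: Sadj_bound.
Qed.

Lemma SadjD s t x : 0 <= s -> 0 <= t ->
  Sadj ip S (s + t) x = Sadj ip S s (Sadj ip S t x).
Proof.
move=> s0 t0; apply: (ip_inj ipH) => z; rewrite !(ipC ipH _ z).
rewrite -!SadjP ?addr_ge0// addrC; case: S_sg => _ _ -> //.
Qed.

Let phi z x (u : R) := ip (S (Num.max 0 u) z) x.

Let phi_continuous z x : continuous (phi z x).
Proof.
by move=> u; apply: (ip_cvg ipH); [exact: semigroup_continuous|exact: cvg_cst].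
Qed.

Let phi_bound T : exists2 M, 0 <= M & forall z x u, 0 <= u <= T ->
  `|phi z x u| <= M * `|x| * `|z|.
Proof.
have [M M0 hM] := semigroup_bound S_sg T; exists M => // z x u /andP[u0 uT].
rewrite /phi max_r//; apply: le_trans (ip_cauchy ipH _ _) _.
by rewrite mulrAC ler_wpM2r// hM// u0.
Qed.

Lemma lint_shift (f : R -> R) h a b : continuous f -> a <= b ->
  lint (fun u => f (u + h)) a b = lint f (a + h) (b + h).
Proof.
(* The primitive starts one unit further left, because [lint_derive] differentiates only at points
   strictly beyond the base point. *)
move=> cf ab; pose c := a + h - 1.
have -> : lint (fun u => f (u + h)) a b = lint f c (b + h) - lint f c (a + h).
  apply: (FTC2 (F := fun u => lint f c (u + h))) => //.
- move=> u; apply: continuous_comp; last exact: cf.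
  by apply: cvgD; [exact: cvg_id|exact: cvg_cst].
- move=> t /andP[at_ tb].
  have d1 : is_derive (t + h) (1 : R) (lint f c) (f (t + h)).
    by apply: lint_derive => //; rewrite /c; lra.
  have d2 : is_derive t (1 : R) (+%R^~ h) 1.
    by apply: is_derive_eq; rewrite addr0.
  have := @is_derive1_comp _ (lint f c) (+%R^~ h) t _ _ d1 d2.
  by rewrite mulr1; exact.
have ca : c <= a + h by rewrite /c; lra.
have ab' : a + h <= b + h by lra.
have := lint_split ca ab' (continuous_itv_integrable c (b + h) cf); lra.
Qed.

(* The vectors [y] given by [<z, y> = int_0^r <S_u z, x> du] are strongly
   continuous for [S^*], and nothing is orthogonal to all of them. *)
Lemma Sadj_cvg0 x : Sadj ip S t x @[t --> 0^'+] --> x.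
Proof.
pose C : set H := [set y | Sadj ip S t y @[t --> 0^'+] --> y].
have near0 (P : R -> Prop) : (forall t, 0 <= t -> P t) -> \forall t \near 0^'+, P t.
  by move=> hP; near=> t; apply: hP; near: t; exact: nbhs_right_ge.
suff : C x by [].
suff -> : C = setT by [].
have [M M0 hM] := semigroup_bound S_sg 1.
apply: (orthocomplement0 ipH).
- rewrite /C/=; apply: cvg_near_cst.
  by apply: near0 => t t0; rewrite (bounded_op0 (Sadj_bounded t0)).
- move=> c u v cu cv; rewrite /C/=.
  apply: (cvg_near_eq _ (cvgD (cvgZ (cvg_cst c) cu) cv)).
  by apply: near0 => t t0; rewrite (Sadj_linear t0).
- move=> y cy; apply/cvgrPdistC_le => e e0.
  have e1 : 0 < e / (M + 2) by rewrite divr_gt0//; lra.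
  have [c [Cc yc]] := cy _ (nbhsx_ballx y _ e1).
  have e2 : 0 < e / (M + 2) by [].
  move/cvgrPdistC_le : Cc => /(_ _ e2) ct.
  near=> t.
  have t0 : 0 <= t by near: t; exact: nbhs_right_ge.
  have t1 : t <= 1 by near: t; exact: nbhs_right_le.
  have h1 : `|Sadj ip S t c - c| <= e / (M + 2) by near: t.
  have h2 : `|y - c| <= e / (M + 2).
    by move: yc; rewrite -ball_normE /= => /ltW.
  have h3 : `|Sadj ip S t (y - c)| <= M * (e / (M + 2)).
    apply: le_trans (Sadj_bound t0 M0 _ _) _; last exact: ler_wpM2l.
    by move=> u; apply: hM; rewrite t0.
  have -> : Sadj ip S t y - y =
      Sadj ip S t (y - c) + (Sadj ip S t c - c) - (y - c).
    by rewrite (bounded_opB _ _ (Sadj_bounded t0)) opprB !subrKA.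
  apply: le_trans (ler_normB _ _) _; apply: le_trans (lerD (ler_normD _ _) h2) _.
  apply: le_trans (lerD (lerD h3 h1) (lexx _)) _.
  by rewrite le_eqVlt; apply/orP; left; apply/eqP; field; lra.
move=> z zC; apply: (ip_inj ipH) => y; rewrite (ip0l ipH).
have phiL u c v v' : 0 <= u -> phi (c *: v + v') y u = c * phi v y u + phi v' y u.
  by move=> u0; rewrite /phi max_r// (Sb u0).1 (ipDl ipH) (ipZl ipH).
have phii v r r' : itv_integrable r r' (phi v y).
  exact: continuous_itv_integrable.
(* The Riesz theorem provides the weak integral [w] of [Sadj u y] over [[0, r]], without any
   vector-valued integration. *)
have wP r : 0 <= r -> exists w, forall v, lint (phi v y) 0 r = ip v w.
  move=> r0; apply: (riesz ipH (f := fun v => lint (phi v y) 0 r)).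
  have [N N0 hN] := phi_bound r.
  apply: (linear_bounded_op (C := N * `|y| * r)).
    move=> c v v'.
    change (lint (phi (c *: v + v') y) 0 r =
      c * lint (phi v y) 0 r + lint (phi v' y) 0 r).
    rewrite -lintZ// -lintD//; last exact: itv_integrableZ.
    by apply: eq_lint => u /andP[u0 _]; rewrite phiL.
  move=> v; apply: le_trans (lint_bound r0 _ _) _ => //; first by move=> u; apply: hN.
  by rewrite subr0 le_eqVlt; apply/orP; left; apply/eqP; ring.
have lint0 r : 0 <= r -> lint (phi z y) 0 r = 0.
  (* [w] lies in [C]: shifting [[0, r]] by [h] alters the integral only on two pieces of length [h],
     so the norm of [Sadj h w - w] is at most a multiple of [h]. As [z] is orthogonal to [C], the
     integral of [phi z y] vanishes. *)
  move=> r0; have [w hw] := wP _ r0; rewrite hw (ipC ipH); apply: zC.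
  have [N N0 hN] := phi_bound (r + 1).
  apply: (squeeze_norm (g := fun h => 2 * (N * `|y|) * h)); last first.
    rewrite -[X in _ --> X](mulr0 (2 * (N * `|y|))); apply: cvgM; first exact: cvg_cst.
    by apply: cvg_at_right_filter; exact: cvg_id.
  near=> h.
  have h0 : 0 <= h by near: h; exact: nbhs_right_ge.
  have h1 : h <= 1 by near: h; exact: nbhs_right_le.
  set v := _ - w; have [->|v0] := eqVneq v 0; first by rewrite normr0 !mulr_ge0.
  have v1 : 0 < `|v| by rewrite normr_gt0.
  rewrite -(ler_pM2l v1) -expr2 -(ipxx ipH) {2}/v (ipBr ipH) -SadjP// -!hw.
  have -> : lint (phi (S h v) y) 0 r = lint (phi v y) h (r + h).
    have := lint_shift h (@phi_continuous v y) r0; rewrite add0r => <-.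
    apply: eq_lint => u /andP[u0 _]; rewrite /phi !max_r ?addr_ge0//.
    by case: S_sg => _ _ -> //.
  have e1 := @lint_split _ (phi v y) 0 h (r + h) h0 _ (phii _ _ _).
  have e2 := @lint_split _ (phi v y) 0 r (r + h) r0 _ (phii _ _ _).
  have -> : lint (phi v y) h (r + h) - lint (phi v y) 0 r =
      lint (phi v y) r (r + h) - lint (phi v y) 0 h.
    by have := e1 _; have := e2 _; lra.
  have b1 : `|lint (phi v y) r (r + h)| <= N * `|y| * `|v| * (r + h - r).
    apply: lint_bound => //; first lra.
    by move=> u /andP[u1 u2]; apply: hN; apply/andP; split; lra.
  have b2 : `|lint (phi v y) 0 h| <= N * `|y| * `|v| * (h - 0).
    apply: lint_bound => // u /andP[u1 u2]; apply: hN; apply/andP; split; lra.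
  apply: le_trans (ler_norm _) _; apply: le_trans (ler_normB _ _) _.
  apply: le_trans (lerD b1 b2) _.
  by rewrite le_eqVlt; apply/orP; left; apply/eqP; ring.
(* A continuous function whose integral over every [[0, r]] is zero vanishes at 0: near 0 its value
   differs by at most [e] from its average. *)
have -> : ip z y = phi z y 0 by rewrite /phi maxxx; case: S_sg => _ -> _ _.
apply/eqP; rewrite -normr_le0; apply/ler_addgt0Pr => e e0; rewrite add0r.
have /cvgrPdistC_le/(_ e e0)/nbhs_ballP[d /= d0 hd] := @phi_continuous z y 0.
have d2 : 0 < d / 2 by lra.
rewrite -(ler_pM2r d2).
have := @lint_bound _ (fun u => phi z y u - phi z y 0) 0 (d / 2) e (ltW d2).
have ci : itv_integrable 0 (d / 2) (fun=> - phi z y 0).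
  by apply: continuous_itv_integrable; exact: cst_continuous.
have -> : lint (fun u => phi z y u - phi z y 0) 0 (d / 2) = - phi z y 0 * (d / 2).
  rewrite (lintD (phii z 0 (d / 2)) ci) lint0 ?ltW// lint_cst ?ltW//.
  by rewrite subr0 add0r.
rewrite subr0 normrM normrN.
rewrite (gtr0_norm d2); apply; first exact: itv_integrableD.
move=> u /andP[u0 ud]; apply: hd; rewrite -ball_normE/= sub0r normrN ger0_norm//.
lra.
Unshelve. all: by end_near. Qed.

Lemma Sadj_semigroup : C0_semigroup (Sadj ip S).
Proof.
split; [exact: Sadj_bounded| |exact: SadjD|exact: Sadj_cvg0].
move=> x; apply: (ip_inj ipH) => z; rewrite !(ipC ipH _ z) -SadjP//.
by case: S_sg => _ -> _ _.
Qed.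

End AdjointSemigroup.

(** * Bochner integral *)

Section LowerIntegral.
Context {d : measure_display} {T : measurableType d} {R : realType}.
Variable mu : {measure set T -> \bar R}.
Implicit Types (f g : T -> R) (D N : set T).

Import HBNNSimple.

(* No measurability of [f] and [g] is assumed: the integral of a nonnegative
   function is a supremum over simple functions. *)
Lemma le_integral_off_null f g D D' N : measurable N -> mu N = 0 ->
  (forall x, 0 <= f x) -> (forall x, 0 <= g x) ->
  (forall x, D x -> ~ N x -> D' x /\ f x <= g x) ->
  (\int[mu]_(x in D) (f x)%:E <= \int[mu]_(x in D') (g x)%:E)%E.
Proof.
move=> mN N0 f0 g0 fg; rewrite !ge0_integralE//; try by move=> x _; rewrite lee_fin.
apply: ge_ereal_sup => _ [h /= hf <-].
have mNC : measurable (~` N) by exact: measurableC.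
apply: ereal_sup_ubound; exists (proj_nnsfun h mNC) => /=.
  move=> x; rewrite /proj_nnsfun/= mindicE.
  have [xN|xN] := boolP (x \in ~` N); last first.
    by rewrite mulr0 /patch; case: ifP => // _; rewrite lee_fin.
  rewrite mulr1; apply: le_trans (hf x) _; rewrite /patch.
  case: ifPn => [/set_mem xD|_].
    have [D'x fgx] := fg _ xD (set_mem xN).
    by rewrite mem_set// lee_fin.
  by case: ifP => // _; rewrite lee_fin.
have E (k : {nnsfun T >-> R}) : sintegral mu k = (\int[mu]_x (k x)%:E)%E.
  by rewrite integral_nnsfun// patch_setT.
rewrite !E; apply: ge0_ae_eq_integral => //.
- exact/measurable_EFinP/measurable_funP.
- exact/measurable_EFinP/measurable_funP.
- by move=> x _; rewrite lee_fin.
- by move=> x _; rewrite lee_fin.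
exists N; split => // x /= hx; apply: contrapT => xN; apply: hx => _.
by rewrite mindicE mem_set// mulr1.
Qed.

Lemma eq_integral_off_null f g D D' N : measurable N -> mu N = 0 ->
  (forall x, 0 <= f x) -> (forall x, 0 <= g x) ->
  (forall x, ~ N x -> D x <-> D' x) ->
  (forall x, D x -> ~ N x -> f x = g x) ->
  (\int[mu]_(x in D) (f x)%:E = \int[mu]_(x in D') (g x)%:E)%E.
Proof.
move=> mN N0 f0 g0 DD fg; apply/eqP; rewrite eq_le; apply/andP; split.
  apply: (le_integral_off_null mN) => // x Dx Nx.
  by split; [exact/DD|rewrite fg].
apply: (le_integral_off_null mN) => // x Dx Nx; have Dx' := (DD _ Nx).2 Dx.
by split => //; rewrite fg.
Qed.

End LowerIntegral.

Section SimpleFun.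
Context {d : measure_display} {T : measurableType d} {R : realType}
  {E : normedModType R}.
Variables (mu : {measure set T -> \bar R}).
Implicit Types (s : seq (set T * E)) (D : set T).

Lemma simple_fun_cons p s x :
  simple_fun (p :: s) x = \1_(p.1) x *: p.2 + simple_fun s x.
Proof. by rewrite /simple_fun big_cons. Qed.

Lemma simple_fun_cat s1 s2 x :
  simple_fun (s1 ++ s2) x = simple_fun s1 x + simple_fun s2 x.
Proof. by rewrite /simple_fun big_cat. Qed.

Lemma simple_integrable_cons D p s : simple_integrable mu D (p :: s) ->
  [/\ measurable p.1, (mu (D `&` p.1) < +oo)%E & simple_integrable mu D s].
Proof.
move=> h; have [? ?] := h p (mem_head _ _).
by split => // q qs; apply: h; rewrite inE qs orbT.
Qed.

Lemma simple_integrable_cat D s1 s2 : simple_integrable mu D s1 ->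
  simple_integrable mu D s2 -> simple_integrable mu D (s1 ++ s2).
Proof. by move=> h1 h2 p; rewrite mem_cat => /orP[/h1|/h2]. Qed.

(** A simple function takes finitely many values, each on a measurable set, so any [F] may be
    applied. The induction generalises over [F]: its argument is shifted by [p.2] on [p.1] and
    unchanged elsewhere. *)
Lemma measurable_simple_comp D s (F : E -> R) D' : simple_integrable mu D s ->
  measurable_fun D' (fun x => F (simple_fun s x)).
Proof.
move=> hs; apply: measurable_funTS; rewrite -[X in measurable_fun X _]setTI.
elim: s F hs => [|p s ih] F /=.
  move=> _; rewrite (_ : (fun _ => _) = cst (F 0)); first exact: measurable_cst.
  by apply/funext => x; rewrite /simple_fun big_nil.
move=> /simple_integrable_cons[mp _ /ih {}ih].
rewrite (_ : (fun _ => _) = (fun x => \1_(p.1) x * F (p.2 + simple_fun s x)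
   + (1 - \1_(p.1) x) * F (simple_fun s x))); last first.
  apply/funext => x; rewrite simple_fun_cons indicE.
  case: (x \in p.1); rewrite /= ?scale1r ?mul1r ?subrr ?mul0r ?addr0//.
  by rewrite scale0r !add0r subr0 mul1r.
have m1 : measurable_fun setT (\1_(p.1) : T -> R) by exact: measurable_indic.
apply: measurable_funD; apply: measurable_funM => //.
- exact: (ih (fun y => F (p.2 + y))).
- by apply: measurable_funB.
Qed.

End SimpleFun.

Section BochnerHilbert.
Context {d : measure_display} {T : measurableType d} {R : realType}
  {H : completeNormedModType R}.
Variables (ip : H -> H -> R) (ipH : inner ip).
Variables (mu : {measure set T -> \bar R}) (D : set T).
Hypothesis mD : measurable D.
Implicit Types (s : seq (set T * H)) (f : T -> H) (N : set T).

Definition null_measurable N := measurable N /\ mu N = 0.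

Lemma null_measurableU N1 N2 : null_measurable N1 -> null_measurable N2 -> null_measurable (N1 `|` N2).
Proof.
move=> [m1 z1] [m2 z2]; split; first exact: measurableU.
by apply/eqP; rewrite -measure_le0 -[leRHS](adde0 0%E) -{1}z1 -z2 measureU2.
Qed.

Lemma null_measurable0 : null_measurable set0.
Proof. by split; [exact: measurable0|exact: measure0]. Qed.

Lemma measurable_off N : null_measurable N -> measurable (D `\` N).
Proof. by move=> [mN _]; exact: measurableD. Qed.

Lemma measure_off N A : null_measurable N -> measurable A ->
  mu ((D `\` N) `&` A) = mu (D `&` A).
Proof.
move=> [mN N0] mA; apply/eqP; rewrite eq_le; apply/andP; split.
  by apply: le_measure; rewrite ?inE; [exact/measurableI/mA/measurableD|exact: measurableI|
    move=> x [[]]].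
have : D `&` A `<=` ((D `\` N) `&` A) `|` N.
  by move=> x [Dx Ax]; have [Nx|Nx] := pselect (N x); [right|left].
have mDA : measurable ((D `\` N) `&` A) by exact/measurableI/mA/measurableD.
move=> sub; apply: le_trans (le_measure mu _ _ sub) _.
- by rewrite inE; exact: measurableI.
- by rewrite inE; exact: measurableU.
by apply: le_trans (measureU2 mu mDA mN) _; rewrite [X in (_ + X)%E]N0 adde0.
Qed.

(** Pairing with a fixed [z] reduces vector integrals to scalar ones. A null set is removed because
    limits of simple functions will be available only outside one. *)
Lemma simple_test s z N : null_measurable N -> simple_integrable mu D s ->
  mu.-integrable (D `\` N) (EFin \o (fun x => ip (simple_fun s x) z)) /\
  \int[mu]_(x in D `\` N) ip (simple_fun s x) z = ip (simple_integral mu D s) z.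
Proof.
move=> nN; have mDN := measurable_off nN.
elim: s => [_|p s ih].
  rewrite (_ : (fun x => _) = cst 0); last first.
    by apply/funext => x; rewrite /simple_fun big_nil (ip0l ipH).
  split; first exact: integrable0.
  by rewrite Rintegral_cst// mul0r /simple_integral big_nil (ip0l ipH).
move=> /simple_integrable_cons[mp fp /ih[ih1 ih2]].
have -> : (fun x => ip (simple_fun (p :: s) x) z) =
    (fun x => ip p.2 z * \1_(p.1) x + ip (simple_fun s x) z).
  by apply/funext => x; rewrite simple_fun_cons (ipDl ipH) (ipZl ipH) mulrC.
have fp' : (mu ((D `\` N) `&` p.1) < +oo)%E by rewrite measure_off.
have i1 : mu.-integrable (D `\` N) (EFin \o (\1_(p.1) : T -> R)).
  apply/integrableP; split; first exact/measurable_EFinP/measurable_funTS/measurable_indic.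
  under eq_integral do rewrite /= ger0_norm//.
  by rewrite integral_indic// setIC.
have i2 : mu.-integrable (D `\` N) (EFin \o (fun x => ip p.2 z * \1_(p.1) x)).
  exact: (integrableZl mDN (ip p.2 z) i1).
split; first exact: (integrableD mDN i2 ih1).
rewrite RintegralD// ih2 RintegralZl// /simple_integral big_cons (ipDl ipH) (ipZl ipH).
rewrite {1}/Rintegral integral_indic// setIC measure_off//.
by rewrite mulrC.
Qed.

End BochnerHilbert.

Section BochnerTest.
Context {d : measure_display} {T : measurableType d} {R : realType}
  {H : completeNormedModType R}.
Variables (ip : H -> H -> R) (ipH : inner ip).
Variables (mu : {measure set T -> \bar R}) (D : set T).
Hypothesis mD : measurable D.
Implicit Types (s : seq (set T * H)) (f : T -> H) (N : set T).

Let opps s := [seq (p.1, - p.2) | p <- s].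

Let simple_fun_opp s x : simple_fun (opps s) x = - simple_fun s x.
Proof.
rewrite /simple_fun big_map /= -sumrN; apply: eq_bigr => p _.
by rewrite scalerN.
Qed.

Let simple_integrable_opp s : simple_integrable mu D s -> simple_integrable mu D (opps s).
Proof. by move=> h _ /mapP[p /h hp ->]. Qed.

Let subs s1 s2 := s1 ++ opps s2.

Let simple_fun_sub s1 s2 x : simple_fun (subs s1 s2) x = simple_fun s1 x - simple_fun s2 x.
Proof. by rewrite simple_fun_cat simple_fun_opp. Qed.

Let simple_integrable_sub s1 s2 : simple_integrable mu D s1 ->
  simple_integrable mu D s2 -> simple_integrable mu D (subs s1 s2).
Proof. by move=> h1 h2; apply: simple_integrable_cat => //; exact: simple_integrable_opp. Qed.

Section Limit.
Variables (f : T -> H) (s : nat -> seq (set T * H)) (N : set T).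
Hypothesis nN : null_measurable mu N.
Hypothesis si : forall n, simple_integrable mu D (s n).
Hypothesis sf : forall x, D x -> ~ N x -> simple_fun (s n) x @[n --> \oo] --> f x.

Lemma measurable_lim_norm : measurable_fun (D `\` N) (fun x => `|f x|).
Proof.
apply: (@measurable_fun_cvg _ _ _ _ (fun n x => `|simple_fun (s n) x|)).
  by move=> n; exact: (measurable_simple_comp (fun y : H => `|y|) (@si n)).
by move=> x [Dx Nx]; apply: cvg_norm; exact: sf.
Qed.

Lemma measurable_lim_test z : measurable_fun (D `\` N) (fun x => ip (f x) z).
Proof.
apply: (@measurable_fun_cvg _ _ _ _ (fun n x => ip (simple_fun (s n) x) z)).
  by move=> n; exact: (measurable_simple_comp (fun y : H => ip y z) (@si n)).
by move=> x [Dx Nx]; apply: (ip_cvg ipH); [exact: sf|exact: cvg_cst].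
Qed.

Lemma measurable_lim_dist s' : simple_integrable mu D s' ->
  measurable_fun (D `\` N) (fun x => `|f x - simple_fun s' x|).
Proof.
move=> si'; apply: (@measurable_fun_cvg _ _ _ _
    (fun n x => `|simple_fun (subs (s n) s') x|)).
  move=> n; apply: (measurable_simple_comp (fun y : H => `|y|) (D := D)).
  exact: simple_integrable_sub.
move=> x [Dx Nx]; apply: cvg_norm.
under eq_fun do rewrite simple_fun_sub.
by apply: cvgB; [exact: sf|exact: cvg_cst].
Qed.

End Limit.

Lemma integrable_simple_norm s N : null_measurable mu N -> simple_integrable mu D s ->
  mu.-integrable (D `\` N) (EFin \o (fun x => `|simple_fun s x|)).
Proof.
move=> nN; have mDN := measurable_off mD nN; elim: s => [|p s ih] hs.
  rewrite (_ : (fun x => _) = cst 0); first exact: integrable0.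
  by apply/funext => x; rewrite /simple_fun big_nil normr0.
have mn : measurable_fun (D `\` N) _ := measurable_simple_comp (fun y : H => `|y|) hs.
have [mp fp hs'] := simple_integrable_cons hs.
have i1 : mu.-integrable (D `\` N) (EFin \o (\1_(p.1) : T -> R)).
  apply/integrableP; split; first exact/measurable_EFinP/measurable_funTS/measurable_indic.
  under eq_integral do rewrite /= ger0_norm//.
  by rewrite integral_indic// setIC measure_off.
have i2 := integrableD mDN (integrableZl mDN `|p.2| i1) (ih hs').
apply: le_integrable i2 => //; first exact/measurable_EFinP.
move=> x _ /=; rewrite lee_fin normr_id.
apply: le_trans (ler_norm _); rewrite simple_fun_cons.
apply: le_trans (ler_normD _ _) _; rewrite lerD2r normrZ mulrC.
by rewrite ger0_norm.
Qed.

(** Replacing [f] by a simple function changes the paired integral by at most the norm of [z] times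
    the L1 distance, so the equality for simple functions passes to the limit. [N] may be any null
    set containing [N0], which allows the exceptional sets of several functions to be merged. *)
Lemma bochner_test f v : is_bochner mu D f v ->
  exists2 N0, null_measurable mu N0 & forall N, null_measurable mu N -> N0 `<=` N ->
  [/\ mu.-integrable (D `\` N) (EFin \o (fun x => `|f x|)),
      forall z, mu.-integrable (D `\` N) (EFin \o (fun x => ip (f x) z))
    & forall z, \int[mu]_(x in D `\` N) ip (f x) z = ip v z].
Proof.
move=> [s [si [N0 [mN0 N00 sub]] L1 lim]]; exists N0; first by split.
move=> N nN N0N; have mDN := measurable_off mD nN.
have sf x : D x -> ~ N x -> simple_fun (s n) x @[n --> \oo] --> f x.
  move=> Dx Nx; apply: contrapT => h; apply/Nx/N0N/sub => /= h'.
  exact/h/h'.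
have L1' : (\int[mu]_(x in D `\` N) `|f x - simple_fun (s n) x|%:E)%E
    @[n --> \oo] --> 0%E.
  apply: (squeeze_cvge _ (cvg_cst 0%E) L1); apply: nearW => n.
  apply/andP; split; first exact: integral_ge0.
  apply: (le_integral_off_null (N := set0)) => //.
  by move=> x [].
have [nfin rlim] := (fine_cvgP _ _).1 L1'.
have idist n : (\int[mu]_(x in D `\` N) `|f x - simple_fun (s n) x|%:E)%E \is a fin_num ->
   mu.-integrable (D `\` N) (EFin \o (fun x => `|f x - simple_fun (s n) x|)).
  move=> h; apply/integrableP; split.
    by apply/measurable_EFinP; exact: (measurable_lim_dist si sf).
  under eq_integral do rewrite /= normr_id.
  by rewrite ltey_eq h.
(* Distances tending to 0 are finite from some index on, and one such index bounds the norm of [f]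
   by a sum of two integrable functions. *)
have inorm : mu.-integrable (D `\` N) (EFin \o (fun x => `|f x|)).
  have [n /idist hn] := filter_ex nfin.
  have i2 := integrableD mDN hn (integrable_simple_norm nN (si n)).
  apply: le_integrable i2 => //.
    by apply/measurable_EFinP; exact: (measurable_lim_norm si sf).
  move=> x _ /=; rewrite lee_fin normr_id; apply: le_trans (ler_norm _).
  by apply: le_trans (ler_normD _ _); rewrite subrK.
have itest z : mu.-integrable (D `\` N) (EFin \o (fun x => ip (f x) z)).
  apply: le_integrable (integrableZl mDN `|z| inorm) => //.
    by apply/measurable_EFinP; exact: (measurable_lim_test si sf).
  move=> x _ /=; rewrite lee_fin normrM !normr_id mulrC.
  exact: ip_cauchy.
split=> // z.
have h1 : ip (simple_integral mu D (s n)) z @[n --> \oo] --> ip v z.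
  by apply: (ip_cvg ipH) => //; exact: cvg_cst.
apply: (@cvg_unique _ _ _ _ _ _ _ h1) => //.
apply: (squeeze_norm (g := fun n => `|z| *
    \int[mu]_(x in D `\` N) `|f x - simple_fun (s n) x|)); last first.
  rewrite -[X in _ --> X](mulr0 `|z|); apply: cvgM => //; exact: cvg_cst.
apply: filterS nfin => n /idist hn.
have [i1 <-] := simple_test ipH mD z nN (si n).
rewrite -RintegralB// -RintegralZl//; apply: le_trans (le_normr_Rintegral _ _) _ => //.
  exact: (integrableB mDN i1 (itest z)).
apply: le_Rintegral => //.
- exact/integrable_norm/(integrableB mDN i1 (itest z)).
- exact: (integrableZl mDN `|z| hn).
- by move=> x _; rewrite -(ipBl ipH) mulrC distrC; exact: ip_cauchy.
Qed.

Lemma bochner_unique f v v' : is_bochner mu D f v -> is_bochner mu D f v' -> v = v'.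
Proof.
move=> /bochner_test[N1 n1 h1] /bochner_test[N2 n2 h2].
apply: (ip_inj ipH) => z; have n12 := null_measurableU n1 n2.
have [_ _ <-] := h1 _ n12 (@subsetUl _ _ _).
by have [_ _ <-] := h2 _ n12 (@subsetUr _ _ _).
Qed.

(** Tested with [z = v1 - v2] itself, the squared distance becomes a scalar integral, at most the
    norm of [z] times the integral of [h]. Both uniqueness proofs estimate their integrals in this
    way. *)
Lemma bochner_dist f1 f2 v1 v2 h N : is_bochner mu D f1 v1 ->
  is_bochner mu D f2 v2 -> null_measurable mu N -> mu.-integrable D (EFin \o h) ->
  (forall x, D x -> ~ N x -> `|f1 x - f2 x| <= h x) ->
  `|v1 - v2| <= \int[mu]_(x in D) h x.
Proof.
move=> /bochner_test[N1 n1 h1] /bochner_test[N2 n2 h2] nN ih fh.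
pose M := N1 `|` N2 `|` N; have nM : null_measurable mu M by do 2 apply: null_measurableU => //.
have mDM := measurable_off mD nM.
have ihM : mu.-integrable (D `\` M) (EFin \o h).
  by apply: integrableS ih => //; move=> x [].
have -> : \int[mu]_(x in D) h x = \int[mu]_(x in D `\` M) h x.
  by rewrite /Rintegral (negligible_integral nM.1 mD ih nM.2).
have [->|v0] := eqVneq (v1 - v2) 0.
  rewrite normr0; apply: Rintegral_ge0 => x [Dx Mx].
  by apply: le_trans (fh x Dx _); [exact: normr_ge0|move=> Nx; apply: Mx; right].
have v1p : 0 < `|v1 - v2| by rewrite normr_gt0.
rewrite -(ler_pM2l v1p) -expr2 -(ipxx ipH); set z := v1 - v2.
rewrite {1}/z (ipBl ipH).
have [_ it1 <-] := h1 M nM (fun x hx => or_introl (or_introl hx)).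
have [_ it2 <-] := h2 M nM (fun x hx => or_introl (or_intror hx)).
rewrite -RintegralB// -RintegralZl//; apply: le_Rintegral => //.
- exact: (integrableB mDM (it1 z) (it2 z)).
- exact: (integrableZl mDM `|z| ihM).
- move=> x [Dx Mx]; rewrite -(ipBl ipH) mulrC; apply: le_trans (ip_le ipH _ _) _.
  by rewrite ler_wpM2r// fh// => Nx; apply: Mx; right.
Qed.

Lemma bochner_congr f g v N : null_measurable mu N ->
  (forall x, D x -> ~ N x -> f x = g x) -> is_bochner mu D f v -> is_bochner mu D g v.
Proof.
move=> nN fg [s [si [N0 [mN0 N00 sub]] L1 lim]]; exists s; split=> //.
  have [mU U0] := null_measurableU (conj mN0 N00) nN.
  exists (N0 `|` N); split=> // x /= hx.
  have [Nx|Nx] := pselect (N x); [by right|left].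
  by apply: sub => /= h; apply: hx => Dx; rewrite -fg//; exact: h.
rewrite (_ : (fun n => _) = (fun n => \int[mu]_(x in D) `|f x - simple_fun (s n) x|%:E))%E//.
apply/funext => n; apply: (eq_integral_off_null nN.1 nN.2) => //.
by move=> x Dx Nx; rewrite fg.
Qed.

End BochnerTest.

Section BochnerExistence.
Context {d : measure_display} {T : measurableType d} {R : realType}
  {H : completeNormedModType R}.
Variables (ip : H -> H -> R) (ipH : inner ip).
Variables (mu : {measure set T -> \bar R}) (D : set T).
Hypothesis mD : measurable D.

(* Truncating the simple functions where their norm exceeds [2 h] makes the
   dominated convergence theorem applicable. *)
Lemma bochner_existence (f : T -> H) (s : nat -> seq (set T * H)) N (h : T -> R) :
  null_measurable mu N -> (forall n, simple_integrable mu D (s n)) ->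
  (forall x, D x -> ~ N x -> simple_fun (s n) x @[n --> \oo] --> f x) ->
  mu.-integrable D (EFin \o h) ->
  (forall x, D x -> ~ N x -> `|f x| <= h x) ->
  exists v, is_bochner mu D f v.
Proof.
move=> nN si sf ih fh; have mDN := measurable_off mD nN.
pose B n := D `&` [set x | `|simple_fun (s n) x| <= 2 * h x].
have mh : measurable_fun D h by exact/measurable_EFinP/(measurable_int mu).
have mB n : measurable (B n).
  rewrite /B (_ : [set x | _] = (fun x => 2 * h x - `|simple_fun (s n) x|) @^-1` `[0, +oo[%classic).
    suff : measurable_fun D (fun x => 2 * h x - `|simple_fun (s n) x|).
      by move=> /(_ mD); apply; exact: measurable_itv.
    apply: measurable_funB; first exact: measurable_funM.
    exact: (measurable_simple_comp (fun y : H => `|y|) (si n)).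
  by apply/seteqP; split=> x /=; rewrite in_itv/= andbT subr_ge0.
pose t n := [seq (p.1 `&` B n, p.2) | p <- s n].
have tE n x : simple_fun (t n) x = \1_(B n) x *: simple_fun (s n) x.
  rewrite /simple_fun big_map scaler_sumr; apply: eq_bigr => p _ /=.
  by rewrite indicI scalerA mulrC.
have ti n : simple_integrable mu D (t n).
  move=> _ /mapP[p /(si n)[mp fp] ->]/=; split; first exact: measurableI.
  apply: le_lt_trans fp; apply: le_measure; rewrite ?inE.
  - by apply: measurableI => //; exact: measurableI.
  - exact: measurableI.
  - by move=> x [Dx []].
have tf x : D x -> ~ N x -> simple_fun (t n) x @[n --> \oo] --> f x.
  move=> Dx Nx; have := fh x Dx Nx; have := normr_ge0 (f x).
  (* Where [f x] is nonzero its norm is strictly below [2 * h x], so the truncation is eventually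
     inactive. Where [f x = 0] the bound [h x] may vanish too, but the truncated values are then
     dominated by values tending to 0. *)
  rewrite le_eqVlt => /predU1P[/esym/eqP f0|f0] fhx.
    move: f0; rewrite normr_eq0 => /eqP f0; rewrite f0.
    have s0 := sf x Dx Nx; rewrite f0 in s0.
    apply: (squeeze_norm (g := fun n => `|simple_fun (s n) x|)).
      apply: nearW => n; rewrite subr0 tE normrZ indicE.
      by case: (x \in B n); rewrite ?normr1 ?mul1r// normr0 mul0r.
    by rewrite -(normr0 H); exact: cvg_norm.
  apply: (cvg_near_eq _ (sf x Dx Nx)).
  have h2 : `|f x| < 2 * h x by lra.
  near=> n; have hn : `|simple_fun (s n) x| < 2 * h x.
    by near: n; exact: (cvgr_lt _ (cvg_norm (sf x Dx Nx))).
  rewrite tE indicE (_ : x \in B n) ?scale1r// inE; split=> //.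
  exact: ltW.
have tb n x : D x -> `|simple_fun (t n) x| <= 2 * `|h x|.
  move=> Dx; rewrite tE normrZ indicE.
  have [/set_mem[_ /= h1]|_] := boolP (x \in B n); last by rewrite normr0 mul0r.
  by rewrite normr1 mul1r (le_trans h1)// ler_wpM2l// ler_norm.
have mg n := measurable_lim_dist ti tf (ti n).
have ih3 : mu.-integrable (D `\` N) (EFin \o (fun x => 3 * `|h x|)).
  apply: (integrableS mD mDN) => [x []//|].
  exact: (integrableZl mD 3 (integrable_norm ih)).
have gb n x : (D `\` N) x -> `|f x - simple_fun (t n) x| <= 3 * `|h x|.
  move=> [Dx Nx]; apply: le_trans (ler_normB _ _) _.
  have := tb n x Dx; have := fh x Dx Nx; have := ler_norm (h x); lra.
have L1' : (\int[mu]_(x in D `\` N) `|f x - simple_fun (t n) x|%:E)%E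
    @[n --> \oo] --> 0%E.
  rewrite -[X in _ --> X](@integral0 _ _ _ mu (D `\` N)).
  apply: (@dominated_cvg _ _ _ mu _ mDN _ _ (EFin \o (fun x => 3 * `|h x|))) => //.
  - by move=> n; apply/measurable_EFinP; exact: mg.
  - move=> x [Dx Nx]; apply: cvg_EFin; first exact: nearW.
    apply: (cvg_near_eq _ (cvg_dist0 (tf x Dx Nx))).
    by apply: nearW => n /=; rewrite distrC.
  - by move=> n x Dx /=; rewrite lee_fin normr_id gb.
have L1 : (\int[mu]_(x in D) `|f x - simple_fun (t n) x|%:E)%E @[n --> \oo] --> 0%E.
  rewrite (_ : (fun n => _) = (fun n => \int[mu]_(x in D `\` N) `|f x - simple_fun (t n) x|%:E))%E//.
  apply/funext => n; apply: (eq_integral_off_null nN.1 nN.2) => //.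
  by move=> x Nx; split=> [|[]].
have ig n : mu.-integrable (D `\` N) (EFin \o (fun x => `|f x - simple_fun (t n) x|)).
  apply: le_integrable ih3 => //; first by apply/measurable_EFinP; exact: mg.
  move=> x Dx /=; rewrite lee_fin normr_id; apply: le_trans (ler_norm _).
  exact: gb.
pose I n := \int[mu]_(x in D `\` N) `|f x - simple_fun (t n) x|.
have I0 : I n @[n --> \oo] --> 0 by have [] := (fine_cvgP _ _).1 L1'.
(* Again tested with the difference itself; [f] serves as the intermediate function, so the
   integrals form a Cauchy sequence. *)
have dist n m : `|simple_integral mu D (t n) - simple_integral mu D (t m)| <= I n + I m.
  set z := _ - _; have [->|z0] := eqVneq z 0.
    by rewrite normr0 addr_ge0//; apply: Rintegral_ge0.
  have zp : 0 < `|z| by rewrite normr_gt0.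
  rewrite -(ler_pM2l zp) -expr2 -(ipxx ipH) {1}/z (ipBl ipH).
  have [i1 <-] := simple_test ipH mD z nN (ti n).
  have [i2 <-] := simple_test ipH mD z nN (ti m).
  rewrite -RintegralB// /I -RintegralD// -RintegralZl//; last first.
    exact: (integrableD mDN (ig n) (ig m)).
  apply: le_Rintegral => //.
  - exact: (integrableB mDN i1 i2).
  - exact: (integrableZl mDN _ (integrableD mDN (ig n) (ig m))).
  - move=> x _; rewrite -(ipBl ipH) mulrC; apply: le_trans (ip_le ipH _ _) _.
    rewrite ler_wpM2r//.
    have -> : simple_fun (t n) x - simple_fun (t m) x =
      (f x - simple_fun (t m) x) - (f x - simple_fun (t n) x).
      by rewrite opprB [RHS]addrC subrKA.
    by apply: le_trans (ler_normB _ _) _; rewrite addrC.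
have /cauchy_cvgP cu : cauchy (simple_integral mu D (t n) @[n --> \oo]).
  apply/cauchy_exP => e e0.
  have e2 : 0 < e / 2 by lra.
  have /cvgrPdistC_lt/(_ _ e2)[M _ hM] := I0.
  exists (simple_integral mu D (t M)), M => // n /= Mn.
  rewrite -ball_normE /=; apply: le_lt_trans (dist _ _) _.
  have := hM _ Mn; have := hM M (leqnn _) => /=; rewrite !subr0.
  have := ler_norm (I n); have := ler_norm (I M); lra.
exists (lim (simple_integral mu D (t n) @[n --> \oo])), t; split=> //.
by exists N; split; [exact: nN.1|exact: nN.2|move=> x /= /not_implyP[Dx h1] //;
   apply: contrapT => Nx; exact/h1/tf].
Unshelve. all: by end_near. Qed.

End BochnerExistence.

(** * Strongly measurable functions on an interval *)

Section StronglyMeasurable.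
Context {R : realType} {H : completeNormedModType R}.
Variables (ip : H -> H -> R) (ipH : inner ip).
Implicit Types (f g : R -> H) (a b : R).
Local Notation mu := (@lebesgue_measure R).

(** Convergence holds everywhere on [[a, b]], while [is_bochner] asks for it almost everywhere: sums
    and compositions then carry no exceptional sets. *)
Definition strongly_measurable a b f := exists s : nat -> seq (set (measurableTypeR R) * H),
  (forall n, simple_integrable mu `[a, b] (s n)) /\
  forall x, a <= x <= b -> simple_fun (s n) x @[n --> \oo] --> f x.

Let mcc a b : measurable (`[a, b]%classic : set (measurableTypeR R)).
Proof. exact: measurable_itv. Qed.

Lemma simple_integrable_itv a b (s : seq (set (measurableTypeR R) * H)) :
  {in s, forall p, measurable p.1} -> simple_integrable mu `[a, b] s.
Proof.
move=> ms p /ms mp; split=> //.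
have : (mu (`[a, b] : set (measurableTypeR R)) < +oo)%E.
  by rewrite lebesgue_measure_itv/=; case: ifP => _; rewrite ?ltry// -EFinB ltry.
apply: le_lt_trans; apply: le_measure; rewrite ?inE //=.
exact: measurableI.
Qed.

Lemma strongly_measurableS a b a' b' f : a <= a' -> b' <= b ->
  strongly_measurable a b f -> strongly_measurable a' b' f.
Proof.
move=> aa bb [s [si sf]]; exists s; split.
  by move=> n; apply: simple_integrable_itv => p /si[].
by move=> x /andP[ax xb]; apply: sf; rewrite (le_trans aa)// (le_trans xb).
Qed.

Lemma eq_strongly_measurable a b f g : (forall x, a <= x <= b -> f x = g x) ->
  strongly_measurable a b f -> strongly_measurable a b g.
Proof. by move=> fg [s [si sf]]; exists s; split=> // x xab; rewrite -fg//; exact: sf. Qed.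

Lemma strongly_measurable_cst a b v : strongly_measurable a b (fun=> v).
Proof.
exists (fun=> [:: (setT, v)]); split.
  by move=> n; apply: simple_integrable_itv => p; rewrite inE => /eqP -> /=.
move=> x _; rewrite /simple_fun big_seq1 /= indicT scale1r; exact: cvg_cst.
Qed.

Lemma strongly_measurableD a b f g : strongly_measurable a b f ->
  strongly_measurable a b g -> strongly_measurable a b (fun x => f x + g x).
Proof.
move=> [s [si sf]] [t [ti tg]]; exists (fun n => s n ++ t n); split.
  by move=> n; exact: simple_integrable_cat.
move=> x xab; under eq_fun do rewrite simple_fun_cat.
by apply: cvgD; [exact: sf|exact: tg].
Qed.

Lemma strongly_measurable_sum a b I (r : seq I) (F : I -> R -> H) :
  (forall i, strongly_measurable a b (F i)) ->
  strongly_measurable a b (fun x => \sum_(i <- r) F i x).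
Proof.
move=> mF; elim: r => [|i r ih].
  apply: (eq_strongly_measurable _ (strongly_measurable_cst a b 0)) => x _.
  by rewrite big_nil.
apply: (eq_strongly_measurable _ (strongly_measurableD (mF i) ih)) => x _.
by rewrite big_cons.
Qed.

(* [K r] is replaced by its value at the point below [r] of the grid of mesh
   [1 / n.+1]. *)
Lemma strongly_measurable_comp a b (c : R -> R) (K : R -> H -> H) f :
  measurable_fun `[a, b] c -> (forall r, bounded_op (K r)) ->
  (forall x, continuous (K^~ x)) ->
  (forall r0, exists M, forall r x, `|r| <= r0 -> `|K r x| <= M * `|x|) ->
  strongly_measurable a b f -> strongly_measurable a b (fun s => K (c s) (f s)).
Proof.
move=> mc bK cK lK [s [si sf]].
(* [J n j] is where [c] lies in the [j]-th cell of the grid of mesh [1 / n.+1] starting at [- n.+1],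
   and [r n j] is the left end of that cell; [2 * n.+1 ^ 2] cells reach up to [n.+1]. *)
pose y n (x : R) := (c x + n.+1%:R) * n.+1%:R.
pose J n (j : nat) : set (measurableTypeR R) :=
  `[a, b] `&` y n @^-1` `[j%:R, j.+1%:R[%classic.
pose r n (j : nat) : R := j%:R / n.+1%:R - n.+1%:R.
have [m mE] : exists m : nat -> nat, forall n, m n = (2 * n.+1 ^ 2)%N.
  by exists (fun n => (2 * n.+1 ^ 2)%N).
pose t n := flatten [seq [seq (p.1 `&` J n j, K (r n j) p.2) | p <- s n] | j <- iota 0 (m n)].
exists t; split.
  move=> n; apply: simple_integrable_itv => _ /flatten_mapP[j _ /mapP[p ps ->]]/=.
  apply: measurableI; first by have [] := si n p ps.
  have my : measurable_fun `[a, b] (y n).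
    by apply: measurable_funM => //; apply: measurable_funD.
  by apply: my => //; exact: measurable_itv.
move=> x xab.
have tE n : simple_fun (t n) x =
    \sum_(j <- iota 0 (m n)) \1_(J n j) x *: K (r n j) (simple_fun (s n) x).
  rewrite /simple_fun big_flatten big_map; apply: eq_bigr => j _.
  rewrite big_map (bounded_op_sum _ _ _ (bK _)) scaler_sumr; apply: eq_bigr => p _ /=.
  by rewrite indicI (bounded_opZ _ _ (bK _)) scalerA mulrC.
pose k n := r n (Num.truncn (y n x)).
have big n : `|c x| < n.+1%:R -> simple_fun (t n) x = K (k n) (simple_fun (s n) x) /\
    `|k n - c x| <= n.+1%:R^-1.
  move=> cn; have n0 : 0 < n.+1%:R :> R by [].
  have y0 : 0 <= y n x.
    by rewrite /y mulr_ge0//; have := ler_norm (- c x); rewrite normrN; lra.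
  have /andP[ty1 ty2] := truncn_itv y0.
  split; last first.
    rewrite /k /r; set j := Num.truncn _ in ty1 ty2 *.
    have -> : j%:R / n.+1%:R - n.+1%:R - c x = (j%:R - y n x) / n.+1%:R.
      by rewrite /y; field; rewrite gt_eqF.
    rewrite normrM normfV (gtr0_norm n0) ler_piMl ?invr_ge0//.
    move: ty2; rewrite -natr1 ler_norml; lra.
  rewrite tE (bigD1_seq (Num.truncn (y n x)))/= ?iota_uniq//; last first.
    rewrite mem_iota leq0n /= truncn_lt_nat//.
    have -> : (m n)%:R = (n.+1%:R + n.+1%:R) * n.+1%:R :> R.
      by rewrite mE natrM natrX; ring.
    rewrite /y ltr_pM2r// ltrD2r; apply: le_lt_trans cn; exact: ler_norm.
  rewrite indicE mem_set ?scale1r; last first.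
    by split; [rewrite /= in_itv|rewrite /= in_itv/= ty1 ty2].
  rewrite big1 ?addr0// => j jy.
  rewrite indicE memNset ?scale0r// => -[_ /=]; rewrite in_itv/= => /andP[j1 j2].
  move/negP: jy; apply; apply/eqP/esym/eqP.
  by rewrite truncn_eq// j1 j2.
have bound : \forall n \near \oo, `|c x| < n.+1%:R.
  near=> n; apply: lt_le_trans (archi_boundP (normr_ge0 (c x))) _.
  rewrite ler_nat; apply: leqW; near: n; exact: nbhs_infty_ge.
have kc : k n @[n --> \oo] --> c x.
  apply: (squeeze_norm (g := fun n => n.+1%:R^-1)); last exact: cvg_harmonic.
  by apply: filterS bound => n /big[].
have [M hM] := lK (`|c x| + 1).
(* The first term uses the local bound on [K], valid for all [k n] within distance 1 of [c x]; the
   second uses continuity of [K] at the fixed vector [f x]. *)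
apply: (squeeze_norm (g := fun n => `|M| * `|simple_fun (s n) x - f x| +
   `|K (k n) (f x) - K (c x) (f x)|)).
  apply: filterS bound => n /big[-> kn].
  have -> : K (k n) (simple_fun (s n) x) - K (c x) (f x) =
    K (k n) (simple_fun (s n) x - f x) + (K (k n) (f x) - K (c x) (f x)).
    by rewrite (bounded_opB _ _ (bK _)) subrKA.
  apply: le_trans (ler_normD _ _) _; rewrite lerD2r.
  apply: le_trans (hM _ _ _) _; last by rewrite ler_wpM2r// ler_norm.
  have := ler_normD (k n - c x) (c x); rewrite subrK => h.
  apply: le_trans h _; rewrite addrC lerD2l (le_trans kn)//.
  by rewrite invf_le1// ler1n.
rewrite -[X in _ --> X](addr0 0) -{1}(mulr0 `|M|); apply: cvgD.
  by apply: cvgM; [exact: cvg_cst|apply: cvg_dist0; exact: sf].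
by apply: cvg_dist0; exact: (cvg_comp _ _ kc (cK (f x) (c x))).
Unshelve. all: by end_near. Qed.

Lemma strongly_measurable_ip a b f (psi : R -> H) : strongly_measurable a b f ->
  (forall v, measurable_fun `[a, b] (fun x => ip v (psi x))) ->
  measurable_fun `[a, b] (fun x => ip (f x) (psi x)).
Proof.
move=> [s [si sf]] mpsi.
apply: (@measurable_fun_cvg _ _ _ _ (fun n x => ip (simple_fun (s n) x) (psi x))).
  move=> n; have := si n; elim: (s n) => [_|p q ih /simple_integrable_cons[mp _ /ih {}ih]].
    rewrite (_ : (fun x => _) = cst 0); first exact: measurable_cst.
    by apply/funext => x; rewrite /simple_fun big_nil (ip0l ipH).
  rewrite (_ : (fun x => _) = (fun x => \1_(p.1) x * ip p.2 (psi x) +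
      ip (simple_fun q x) (psi x))); last first.
    by apply/funext => x; rewrite simple_fun_cons (ipDl ipH) (ipZl ipH).
  apply: measurable_funD; last exact: ih.
  apply: measurable_funM; last exact: mpsi.
  apply: measurable_funTS; exact: measurable_indic.
move=> x xab.
by apply: (ip_cvg ipH); [exact: (sf x xab)|exact: cvg_cst].
Qed.

Lemma bint_eq a b f v : is_bochner_itv a b f v -> bint a b f = v.
Proof.
move=> h; have /getPex : exists v, is_bochner_itv a b f v by exists v.
by move=> /(bochner_unique ipH (mcc a b)); exact.
Qed.

Lemma bochner_itv a b f (h : R -> R) : strongly_measurable a b f ->
  itv_integrable a b h -> (forall x, a <= x <= b -> `|f x| <= h x) ->
  exists2 v, is_bochner_itv a b f v & forall z,
    itv_integrable a b (fun x => ip (f x) z) /\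
    ip v z = lint (fun x => ip (f x) z) a b.
Proof.
move=> mf ih fh; have [s [si sf]] := mf.
have [v fv] := @bochner_existence _ _ _ _ ip ipH mu _ (mcc a b) f s set0 h
  (null_measurable0 _) si (fun x Dx _ => sf x Dx) ih (fun x Dx _ => fh x Dx).
exists v => // z.
have iz : itv_integrable a b (fun x => ip (f x) z).
  apply: (itv_integrable_le (g := fun x => `|z| * h x)); last exact: itv_integrableZ.
    by apply: strongly_measurable_ip => // w; exact: measurable_cst.
  move=> x xab; rewrite mulrC; apply: le_trans (ip_cauchy ipH _ _) _.
  by rewrite ler_wpM2r// fh.
split=> //; have [N nN hN] := bochner_test ipH (mcc a b) fv.
have [_ _ <-] := hN N nN (fun x => id).
by rewrite /lint /Rintegral (negligible_integral nN.1 (mcc a b) iz nN.2).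
Qed.

(** The integrands of the mild equations for the explicit solutions are brought to this shape.
    Measurability comes from scaling viewed as an operator family [r *: x], and the value is
    identified by pairing. *)
Lemma bochner_finite_rank a b p (c : 'I_p -> R -> R) (v : 'I_p -> H) :
  (forall i, itv_integrable a b (c i)) ->
  is_bochner_itv a b (fun s => \sum_i c i s *: v i) (\sum_i lint (c i) a b *: v i).
Proof.
move=> ic.
have mf : strongly_measurable a b (fun s => \sum_i c i s *: v i).
  apply: strongly_measurable_sum => i.
  apply: (@strongly_measurable_comp a b (c i) (fun r x => r *: x) (fun=> v i)).
  - exact: itv_measurable.
  - move=> r; apply: (linear_bounded_op (C := `|r|)) => [k x y|x].
      by rewrite scalerDr !scalerA mulrC.
    by rewrite normrZ.
  - by move=> x r; apply: cvgZ; [exact: cvg_id|exact: cvg_cst].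
  - by move=> r0; exists r0 => r x rr; rewrite normrZ ler_wpM2r.
  - exact: strongly_measurable_cst.
have [||w fw hw] := @bochner_itv a b _ (fun s => \sum_i `|v i| * `|c i s|) mf.
- apply: itv_integrable_sum => i; exact/itv_integrableZ/itv_integrable_norm.
- move=> x _; apply: le_trans (ler_norm_sum _ _ _) _.
  by apply: ler_sum => i _; rewrite normrZ mulrC.
suff -> : \sum_i lint (c i) a b *: v i = w by [].
apply: (ip_inj ipH) => z; have [_ ->] := hw z; rewrite (ip_suml ipH).
rewrite (@eq_lint _ _ (fun x => \sum_i ip (v i) z * c i x)); last first.
  by move=> x _; rewrite (ip_suml ipH); apply: eq_bigr => i _; rewrite (ipZl ipH) mulrC.
rewrite lint_sum => [|i]; last exact: itv_integrableZ.
by apply: eq_bigr => i _; rewrite lintZ// (ipZl ipH) mulrC.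
Qed.

Lemma bochner_itv_dist a b f1 f2 v1 v2 h N : is_bochner_itv a b f1 v1 ->
  is_bochner_itv a b f2 v2 -> null_measurable mu N -> itv_integrable a b h ->
  (forall x, a <= x <= b -> ~ N x -> `|f1 x - f2 x| <= h x) ->
  `|v1 - v2| <= lint h a b.
Proof.
by move=> h1 h2 nN ih fh; exact: (bochner_dist ipH (mcc a b) h1 h2 nN ih).
Qed.

(** Supplies a majorant when nothing but the existence of the integral is known; the extension by 0
    makes it nonnegative everywhere. *)
Lemma bochner_itv_norm a b f v : is_bochner_itv a b f v ->
  exists h N, [/\ null_measurable mu N, itv_integrable a b h,
    forall x, 0 <= h x & forall x, a <= x <= b -> ~ N x -> `|f x| <= h x].
Proof.
move=> fv; have [N nN hN] := bochner_test ipH (mcc a b) fv.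
have [inorm _ _] := hN N nN (fun x => id).
exists ((fun x => `|f x|) \_ (`[a, b] `\` N)), N; split=> //.
- have := (integrable_mkcond _ (measurable_off (mcc a b) nN)).1 inorm.
  rewrite restrict_EFin => h; apply: integrableS h => //; exact: measurableT.
- by move=> x; rewrite patchE; case: ifP.
- by move=> x xab Nx; rewrite patchE mem_set.
Qed.

End StronglyMeasurable.

(** * Absolutely continuous functions *)

Section Primitive.
Context {R : realType}.
Implicit Types (f g F G : R -> R) (a b : R).

(** Absolute continuity with density [f], in integral form; no pointwise derivative is asserted. *)
Definition primitive a b F f : Prop := itv_integrable a b f /\
  forall s t, a <= s -> s <= t -> t <= b -> F t - F s = lint f s t.

(** Over [n.+1] equal steps the increments add up to at most [K * (b - a) * (Gam b - Gam a) / n.+1],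
    which is arbitrarily small. [Gam] will be the identity for Lipschitz data and the integral of an
    absolute value for merely integrable densities. *)
Lemma flat_increments Phi Gam K a b : a <= b ->
  (forall s t, a <= s -> s <= t -> t <= b ->
     `|Phi t - Phi s| <= K * (t - s) * (Gam t - Gam s)) -> Phi b = Phi a :> R.
Proof.
move=> ab h; apply/eqP; rewrite -subr_eq0 -normr_le0; apply/ler_addgt0Pl => e e0.
rewrite addr0; pose C := `|K * (b - a) * (Gam b - Gam a)|.
pose n := Num.bound (C / e).
have n0 : 0 < n.+1%:R :> R by [].
pose x (i : nat) := a + i%:R * ((b - a) / n.+1%:R).
have xS i : x i.+1 - x i = (b - a) / n.+1%:R by rewrite /x -natr1; ring.
have d0 : 0 <= (b - a) / n.+1%:R by rewrite divr_ge0// subr_ge0.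
have x0 : x 0%N = a by rewrite /x mul0r addr0.
have xn : x n.+1 = b by rewrite /x mulrC divfK ?gt_eqF// addrC subrK.
have le i j : (i <= j)%N -> x i <= x j.
  by move=> ij; rewrite /x lerD2l ler_wpM2r// ler_nat.
have -> : Phi b - Phi a = \sum_(0 <= i < n.+1) (Phi (x i.+1) - Phi (x i)).
  by rewrite telescope_sumr// xn x0.
apply: le_trans (ler_norm_sum _ _ _) _.
apply: (@le_trans _ _ (\sum_(0 <= i < n.+1)
    K * ((b - a) / n.+1%:R) * (Gam (x i.+1) - Gam (x i)))).
  rewrite big_nat [leRHS]big_nat; apply: ler_sum => i /andP[_ ni]; rewrite -(xS i).
  by apply: h; rewrite -?x0 -?xn ?le.
rewrite -mulr_sumr telescope_sumr// xn x0.
have -> : K * ((b - a) / n.+1%:R) * (Gam b - Gam a) =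
   K * (b - a) * (Gam b - Gam a) / n.+1%:R by field; rewrite gt_eqF.
rewrite ler_pdivrMr//; apply: le_trans (ler_norm _) _; rewrite -/C.
rewrite mulrC -ler_pdivrMr//; apply: le_trans (ltW (archi_boundP _)) _.
  by apply: divr_ge0; [exact: normr_ge0|exact: ltW].
by rewrite ler_nat.
Qed.

Lemma eq_primitive a b F F' f f' : (forall x, a <= x <= b -> F x = F' x) ->
  (forall x, a <= x <= b -> f x = f' x) -> primitive a b F f -> primitive a b F' f'.
Proof.
move=> FF ff [fi Ff]; split.
  apply: eq_integrable fi => // x; rewrite inE/= in_itv/= => xab.
  by rewrite /= ff.
move=> s t as_ st tb; rewrite -!FF; last first.
- by rewrite (le_trans as_ st).
- by rewrite as_ (le_trans st tb).
rewrite Ff//; apply: eq_lint => x /andP[sx xt]; apply: ff.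
by rewrite (le_trans as_ sx) (le_trans xt tb).
Qed.

Lemma primitive_lipschitz a b F f C s t : primitive a b F f ->
  (forall x, a <= x <= b -> `|f x| <= C) -> a <= s <= b -> a <= t <= b ->
  `|F t - F s| <= C * `|t - s|.
Proof.
move=> [fi Ff] fC; wlog st : s t / s <= t.
  move=> hw sab tab; have [st|/ltW ts] := leP s t; first exact: hw.
  by rewrite distrC (distrC t); exact: hw.
move=> /andP[as_ sb] /andP[at_ tb]; rewrite Ff// [`|t - s|]ger0_norm ?subr_ge0//.
apply: lint_bound => //; first exact: itv_integrableS fi.
by move=> x /andP[sx xt]; rewrite fC// (le_trans as_ sx) (le_trans xt tb).
Qed.

Lemma primitive_dist a b F f s t : primitive a b F f ->
  a <= s -> s <= t -> t <= b -> `|F t - F s| <= lint (fun x => `|f x|) s t.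
Proof.
move=> [fi Ff] as_ st tb; rewrite Ff//; apply: lint_norm.
exact: itv_integrableS fi.
Qed.

Lemma primitive_within a b F f : a <= b -> primitive a b F f ->
  {within `[a, b], continuous F}.
Proof.
move=> ab [fi Ff].
have h := @parameterized_integral_continuous R a b f ab fi.
have cc : {within `[a, b], continuous (fun x => F a + lint f a x)}.
  move=> x; apply: cvgD; [exact: cvg_cst|exact: h].
apply: (subspace_eq_continuous _ cc) => x; rewrite inE/= in_itv/= => /andP[ax xb].
change (F a + lint f a x = F x).
by rewrite -Ff// addrC subrK.
Qed.

Lemma primitive_measurable a b F f : a <= b -> primitive a b F f ->
  measurable_fun `[a, b] F.
Proof.
by move=> ab /(primitive_within ab); apply: subspace_continuous_measurable_fun.
Qed.

Lemma primitive_bounded a b F f : a <= b -> primitive a b F f ->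
  exists C, forall x, a <= x <= b -> `|F x| <= C.
Proof.
move=> ab pF; exists (`|F a| + lint (fun x => `|f x|) a b) => x /andP[ax xb].
have := primitive_dist pF (lexx a) ax xb.
have := ler_normD (F x - F a) (F a); rewrite subrK.
have fi := itv_integrable_norm pF.1.
have := lint_split ax xb fi.
have : 0 <= lint (fun x => `|f x|) x b by apply: lint_ge0.
lra.
Qed.

(** The asymmetry is that of the application: [F] is an entry of an inverse matrix, with bounded
    density, and [G] a component of [y - alpha], whose density contains the trajectory. *)
Lemma primitiveM a b F f G g C : a <= b -> primitive a b F f ->
  (forall x, a <= x <= b -> `|f x| <= C) -> primitive a b G g ->
  primitive a b (fun x => F x * G x) (fun x => f x * G x + F x * g x).
Proof.
move=> ab pF fC pG.
have [CF hF] := primitive_bounded ab pF; have [CG hG] := primitive_bounded ab pG.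
have mF := primitive_measurable ab pF; have mG := primitive_measurable ab pG.
have i1 : itv_integrable a b (fun x => f x * G x).
  have -> : (fun x => f x * G x) = (fun x => G x * f x).
    by apply/funext => x; rewrite mulrC.
  exact: itv_integrableM hG mG pF.1.
have i2 : itv_integrable a b (fun x => F x * g x) by exact: itv_integrableM hF mF pG.1.
have i12 := itv_integrableD i1 i2.
have ig := itv_integrable_norm pG.1.
have C0 : 0 <= C by apply: le_trans (fC a _); rewrite ?lexx.
split=> // s0 t0 as0 s0t0 t0b.
pose Phi u := F u * G u - lint (fun x => f x * G x + F x * g x) s0 u.
suff : Phi t0 = Phi s0.
  by rewrite /Phi [in RHS]lint_itv1// subr0; lra.
apply: (@flat_increments Phi (lint (fun x => `|g x|) a) (2 * C)) => //.
move=> s t s0s st tt0.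
have as_ := le_trans as0 s0s; have tb := le_trans tt0 t0b.
have sub h : itv_integrable a b h -> itv_integrable s t h by exact: itv_integrableS.
set gam := lint (fun x => `|g x|) s t.
have -> : lint (fun x => `|g x|) a t - lint (fun x => `|g x|) a s = gam.
  rewrite (lint_split as_ st (itv_integrableS (lexx a) tb ig)).
  by rewrite addrAC subrr add0r.
(* Freezing [G] at [t] and [F] at [s] accounts for the increment of the product; each remaining term
   is at most [C * (t - s) * gam]. *)
have -> : Phi t - Phi s = lint (fun x => f x * (G t - G x)) s t +
    lint (fun x => (F s - F x) * g x) s t.
  have -> : lint (fun x => f x * (G t - G x)) s t =
     G t * lint f s t - lint (fun x => f x * G x) s t.
    rewrite -lintZ; last exact: sub pF.1.
    rewrite -lintB; [|exact: sub (itv_integrableZ _ pF.1)|exact: sub].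
    by apply: eq_lint => x _; ring.
  have -> : lint (fun x => (F s - F x) * g x) s t =
     F s * lint g s t - lint (fun x => F x * g x) s t.
    rewrite -lintZ; last exact: sub pG.1.
    rewrite -lintB; [|exact: sub (itv_integrableZ _ pG.1)|exact: sub].
    by apply: eq_lint => x _; ring.
  rewrite /Phi (lint_split s0s st (itv_integrableS as0 tb i12)).
  rewrite (lintD (sub _ i1) (sub _ i2)) -pF.2// -pG.2//; ring.
have gG x : s <= x <= t -> `|G t - G x| <= gam.
  move=> /andP[sx xt]; apply: le_trans (primitive_dist pG _ xt tb) _.
    exact: le_trans as_ sx.
  rewrite /gam (lint_split sx xt (sub _ ig)) lerDr.
  exact: lint_ge0.
have ab' x : s <= x <= t -> a <= x <= b.
  by move=> /andP[sx xt]; rewrite (le_trans as_ sx) (le_trans xt tb).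
apply: le_trans (ler_normD _ _) _.
have b1 : `|lint (fun x => f x * (G t - G x)) s t| <= C * gam * (t - s).
  apply: lint_bound => //.
    have -> : (fun x => f x * (G t - G x)) = (fun x => G t * f x + (-1) * (f x * G x)).
      by apply/funext => x; ring.
    apply: sub; apply: itv_integrableD; first exact: itv_integrableZ pF.1.
    exact: itv_integrableZ.
  move=> x xst; rewrite normrM; apply: ler_pM => //; [exact/fC/ab'|exact: gG].
have b2 : `|lint (fun x => (F s - F x) * g x) s t| <= C * (t - s) * gam.
  have ii : itv_integrable s t (fun x => (F s - F x) * g x).
    have -> : (fun x => (F s - F x) * g x) = (fun x => F s * g x + (-1) * (F x * g x)).
      by apply/funext => x; ring.
    apply: sub; apply: itv_integrableD; first exact: itv_integrableZ pG.1.
    exact: itv_integrableZ.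
  apply: le_trans (lint_norm ii) _; rewrite /gam -lintZ; last exact: sub ig.
  apply: lint_le; [exact: itv_integrable_norm|exact: sub (itv_integrableZ _ ig)|].
  move=> x xst; rewrite normrM ler_wpM2r//; have /andP[sx xt] := xst.
  have sab : a <= s <= b by apply: ab'; rewrite lexx.
  apply: le_trans (primitive_lipschitz pF fC (ab' _ xst) sab) _.
  rewrite ler_wpM2l// distrC ger0_norm ?subr_ge0// lerD2r//.
apply: le_trans (lerD b1 b2) _.
by rewrite le_eqVlt; apply/orP; left; apply/eqP; ring.
Qed.

Lemma primitive_sum a b I (r : seq I) (F f : I -> R -> R) :
  (forall i, primitive a b (F i) (f i)) ->
  primitive a b (fun x => \sum_(i <- r) F i x) (fun x => \sum_(i <- r) f i x).
Proof.
move=> pF; split; first by apply: itv_integrable_sum => i; have [] := pF i.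
move=> s t as_ st tb; rewrite -sumrB lint_sum => [|i].
  by apply: eq_bigr => i _; have [_ ->] := pF i.
by have [fi _] := pF i; exact: itv_integrableS fi.
Qed.

End Primitive.

(** * Positive definite matrices *)

Section Euclid.
Context {R : realType}.
Implicit Types (p q : nat).

Lemma euclidE p (u v : 'cV[R]_p) : euclid u v = (u^T *m v) ord0 ord0.
Proof. by rewrite mxE; apply: eq_bigr => j _; rewrite mxE. Qed.

Lemma euclidC p (u v : 'cV[R]_p) : euclid u v = euclid v u.
Proof. by apply: eq_bigr => j _; rewrite mulrC. Qed.

Lemma euclidDl p (u v w : 'cV[R]_p) : euclid (u + v) w = euclid u w + euclid v w.
Proof. by rewrite !euclidE linearD mulmxDl mxE. Qed.

Lemma euclidZl p c (u w : 'cV[R]_p) : euclid (c *: u) w = c * euclid u w.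
Proof. by rewrite !euclidE linearZ/= -scalemxAl mxE. Qed.

Lemma euclid_linear p (v : 'cV[R]_p) : linear (euclid^~ v).
Proof. by move=> c x y; rewrite euclidDl euclidZl. Qed.

Lemma euclidDr p (u v w : 'cV[R]_p) : euclid w (u + v) = euclid w u + euclid w v.
Proof. by rewrite !(euclidC w) euclidDl. Qed.

Lemma euclidZr p c (u w : 'cV[R]_p) : euclid w (c *: u) = c * euclid w u.
Proof. by rewrite !(euclidC w) euclidZl. Qed.

Lemma euclid_delta p (u : 'cV[R]_p) j : euclid (delta_mx j ord0) u = u j ord0.
Proof.
rewrite /euclid (bigD1 j)//= mxE !eqxx mul1r big1 ?addr0// => i ij.
by rewrite mxE (negbTE ij) mul0r.
Qed.

Lemma euclid_mulmx p q (A : 'M[R]_(p, q)) u v : euclid (A *m u) v = euclid u (A^T *m v).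
Proof. by rewrite !euclidE trmx_mul mulmxA. Qed.

Lemma euclid_col_mx p q (u u' : 'cV[R]_p) (v v' : 'cV[R]_q) :
  euclid (col_mx u v) (col_mx u' v') = euclid u u' + euclid v v'.
Proof.
rewrite /euclid big_split_ord/=; congr (_ + _); apply: eq_bigr => j _.
  by rewrite !col_mxEu.
by rewrite !col_mxEd.
Qed.

Lemma entry_le_norm p q (A : 'M[R]_(p, q)) i j : `|A i j| <= `|A|.
Proof.
rewrite [leRHS]mx_normrE; exact: (le_bigmax _ (fun ij => `|A ij.1 ij.2|) (i, j)).
Qed.

Lemma norm_le_entries p q (A : 'M[R]_(p, q)) : `|A| <= \sum_i \sum_j `|A i j|.
Proof.
rewrite [leLHS]mx_normrE; apply: bigmax_le => [|[i j] _ /=].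
  by apply: sumr_ge0 => i _; exact: sumr_ge0.
rewrite (bigD1 i)//= (bigD1 j)//= -addrA lerDl addr_ge0//; first exact: sumr_ge0.
by apply: sumr_ge0 => k _; exact: sumr_ge0.
Qed.

Lemma euclid_bounded p : exists K, forall x y : 'cV[R]_p,
  `|euclid x y| <= K * (`|x| * `|y|).
Proof.
exists p%:R => x y; apply: le_trans (ler_norm_sum _ _ _) _.
apply: (@le_trans _ _ (\sum_(j < p) `|x| * `|y|)).
  by apply: ler_sum => j _; rewrite normrM ler_pM// entry_le_norm.
by rewrite sumr_const card_ord mulr_natl.
Qed.

Section PosDef.
Variable p : nat.
Implicit Types A B : 'M[R]_p.

Lemma posdef_unit A : posdef A -> A \in unitmx.
Proof.
move=> [As Ap]; apply/contraT; rewrite -row_free_unit -kermx_eq0 -nz_row_eq0 => v0.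
set v := nz_row _ in v0.
have vA : v *m A = 0 by apply/sub_kermxP; exact: nz_row_sub.
have := Ap v^T; rewrite trmx_eq0 => /(_ v0).
by rewrite -{1}As -trmx_mul vA trmx0 euclidE mulmx0 mxE ltxx.
Qed.

(* Cauchy-Schwarz for the form of [A]. *)
Lemma posdef_entry A (y : 'cV[R]_p) k : posdef A ->
  0 < invmx A k k /\ y k ord0 ^+ 2 <= invmx A k k * euclid y (A *m y).
Proof.
move=> Ap; have uA := posdef_unit Ap; have [As Apos] := Ap.
pose w : 'cV[R]_p := invmx A *m delta_mx k ord0.
have Aw : A *m w = delta_mx k ord0 by rewrite mulmxA mulmxV// mul1mx.
have wk z : euclid z (A *m w) = z k ord0 by rewrite Aw euclidC euclid_delta.
have dk : w k ord0 = invmx A k k.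
  rewrite mxE (bigD1 k)//= mxE !eqxx mulr1 big1 ?addr0// => i ik.
  by rewrite mxE (negbTE ik) mulr0.
have w0 : w != 0.
  apply/eqP => w0; move: Aw; rewrite w0 mulmx0 => /matrixP/(_ k ord0).
  by rewrite !mxE !eqxx => /eqP; rewrite eq_sym oner_eq0.
have d0 : 0 < invmx A k k by rewrite -dk -(wk w) Apos.
split=> //; set d := invmx A k k in dk d0 *; set e := euclid y (A *m y).
have pos (z : 'cV[R]_p) : 0 <= euclid z (A *m z).
  have [->|z0] := eqVneq z 0; last exact/ltW/Apos.
  by rewrite mulmx0 euclidE mulmx0 mxE.
have := pos (y + (- (y k ord0) / d) *: w).
rewrite mulmxDr -scalemxAr !(euclidDl, euclidDr, euclidZl, euclidZr) !wk dk -/e.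
have -> : euclid w (A *m y) = y k ord0 by rewrite -{1}As -euclid_mulmx euclidC wk.
have -> : e + - y k ord0 / d * y k ord0 + (- y k ord0 / d * y k ord0 +
   - y k ord0 / d * (- y k ord0 / d * d)) = e - y k ord0 ^+ 2 / d.
  by field; rewrite gt_eqF.
by rewrite subr_ge0 ler_pdivrMr// mulrC.
Qed.

Lemma invmx_entry_bound A : posdef A -> exists C, forall B, posdef B ->
  (forall x, euclid x (A *m x) <= euclid x (B *m x)) ->
  forall i j, `|invmx B i j| <= C.
Proof.
move=> Ap; pose d k := invmx A k k; pose C := \sum_k d k.
have d0 k : 0 < d k by have [] := posdef_entry 0 k Ap.
have dC k : d k <= C.
  by rewrite /C (bigD1 k)//= lerDl sumr_ge0// => i _; exact/ltW/d0.
exists C => B Bp AB i j; have uB := posdef_unit Bp.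
pose y : 'cV[R]_p := invmx B *m delta_mx j ord0.
have By : B *m y = delta_mx j ord0 by rewrite mulmxA mulmxV// mul1mx.
have yk k : y k ord0 = invmx B k j.
  rewrite mxE (bigD1 j)//= mxE !eqxx mulr1 big1 ?addr0// => l lj.
  by rewrite mxE (negbTE lj) mulr0.
have h k : y k ord0 ^+ 2 <= d k * y j ord0.
  have [_ h1] := posdef_entry y k Ap; apply: le_trans h1 _.
  apply: ler_wpM2l; first exact/ltW/d0.
  by apply: le_trans (AB y) _; rewrite By euclidC euclid_delta.
have yj0 : 0 <= y j ord0 by rewrite -(pmulr_rge0 _ (d0 j)) (le_trans _ (h j))// sqr_ge0.
have yjd : y j ord0 <= d j.
  have [->|yn] := eqVneq (y j ord0) 0; first exact/ltW/d0.
  have yp : 0 < y j ord0 by rewrite lt_def yn.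
  by have := h j; rewrite expr2 ler_pM2r.
have C0 : 0 <= C by apply: le_trans (dC j); exact/ltW/d0.
rewrite -yk -ler_sqr ?nnegrE// real_normK ?num_real//.
apply: le_trans (h i) _; rewrite expr2; apply: ler_pM => //; first exact/ltW/d0.
exact: le_trans yjd (dC j).
Qed.

End PosDef.

Lemma posdef_block p q (A : 'M[R]_p) (B : 'M[R]_q) : posdef A -> posdef B ->
  posdef (block_mx A 0 0 B).
Proof.
move=> [As Ap] [Bs Bp]; split; first by rewrite tr_block_mx !trmx0 As Bs.
move=> x; rewrite -[x]vsubmxK; set u := usubmx x; set v := dsubmx x => uv0.
rewrite mul_block_col !mul0mx addr0 add0r euclid_col_mx.
have [u0|u0] := eqVneq u 0.
  rewrite u0 mulmx0 {1}/euclid big1 ?add0r => [|j _]; last by rewrite mxE mul0r.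
  by apply: Bp; apply: contraNneq uv0 => v0; rewrite u0 v0 col_mx0.
apply: ltr_pwDl; first exact: Ap.
have [->|v0] := eqVneq v 0; last exact/ltW/Bp.
by rewrite mulmx0 /euclid big1// => j _; rewrite mxE mul0r.
Qed.

Lemma invmx_block p q (A : 'M[R]_p) (B : 'M[R]_q) : A \in unitmx -> B \in unitmx ->
  invmx (block_mx A 0 0 B) = block_mx (invmx A) 0 0 (invmx B).
Proof.
move=> uA uB.
have e : block_mx (invmx A) 0 0 (invmx B) *m block_mx A 0 0 B = 1%:M.
  by rewrite mulmx_block !mul0mx !mulmx0 !addr0 add0r !mulVmx// -scalar_mx_block.
have u : block_mx A 0 0 B \in unitmx by have [] := mulmx1_unit e.
by rewrite -[LHS]mul1mx -e -mulmxA mulmxV// mulmx1.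
Qed.

End Euclid.

(** * Limits and densities of matrix-valued functions *)

Section MatrixCalculus.
Context {R : realType}.

Lemma cvg_sum_seq {V : normedModType R} {T} {F : set_system T} {FF : Filter F}
    I (r : seq I) (f : I -> T -> V) (l : I -> V) :
  (forall i, f i t @[t --> F] --> l i) ->
  \sum_(i <- r) f i t @[t --> F] --> \sum_(i <- r) l i.
Proof.
move=> fl; elim: r => [|i r ih].
  by rewrite big_nil; under eq_fun do rewrite big_nil; exact: cvg_cst.
by rewrite big_cons; under eq_fun do rewrite big_cons; exact: cvgD.
Qed.

Lemma cvg_mx {T} {F : set_system T} {FF : Filter F} p q
    (f : T -> 'M[R]_(p, q)) (l : 'M[R]_(p, q)) :
  (forall i j, f t i j @[t --> F] --> l i j) -> f @ F --> l.
Proof.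
move=> fl; apply: (squeeze_norm (g := fun t => \sum_i \sum_j `|(f t - l) i j|)).
  by apply: nearW => t; exact: norm_le_entries.
have z : \sum_(i < p) \sum_(j < q) (0 : R) = 0.
  by rewrite big1// => i _; rewrite big1.
rewrite -[X in _ --> X]z.
apply: cvg_sum_seq => i; apply: cvg_sum_seq => j.
by under eq_fun do rewrite !mxE; exact: cvg_dist0.
Qed.

Lemma clamp_lipschitz (a b x y : R) :
  `|Num.max a (Num.min y b) - Num.max a (Num.min x b)| <= `|y - x|.
Proof.
wlog xy : x y / x <= y.
  move=> hw; have [xy|/ltW yx] := leP x y; first exact: hw.
  by rewrite distrC (distrC y); exact: hw.
have h (u v : R) : u <= v -> Num.max a u <= Num.max a v <= Num.max a u + (v - u).
  by move=> uv; rewrite /Num.max; case: ltP => ?; case: ltP => ?; apply/andP; split; lra.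
have h' : Num.min x b <= Num.min y b <= Num.min x b + (y - x).
  by rewrite /Num.min; case: ltP => ?; case: ltP => ?; apply/andP; split; lra.
have /andP[h1 h2] := h' => {h'}; have /andP[h3 h4] := h _ _ h1.
rewrite !ger0_norm ?subr_ge0//; lra.
Qed.

Lemma lipschitz_measurable a b (F : R -> R) K : a <= b ->
  (forall s t, a <= s <= b -> a <= t <= b -> `|F t - F s| <= K * `|t - s|) ->
  measurable_fun `[a, b] F.
Proof.
(* Composition with the projection onto [[a, b]] extends [F] to a continuous function on the
   line. *)
move=> ab hF; pose c (x : R) := Num.max a (Num.min x b).
have cab x : a <= c x <= b.
  by rewrite /c le_max lexx/= ge_max ab ge_min lexx orbT.
have cc : continuous (F \o c).
  move=> x; apply: (squeeze_norm (g := fun y => `|K| * `|c y - c x|)).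
    apply: nearW => y; apply: le_trans (hF _ _ (cab x) (cab y)) _.
    by rewrite ler_wpM2r// ler_norm.
  rewrite -[X in _ --> X](mulr0 `|K|); apply: cvgM; first exact: cvg_cst.
  apply: cvg_dist0; apply: (squeeze_norm (g := fun y => `|y - x|)).
    by apply: nearW => y; exact: clamp_lipschitz.
  exact/cvg_dist0/cvg_id.
apply: (eq_measurable_fun (F \o c)).
  by move=> x; rewrite inE/= in_itv/= => /andP[ax xb]; rewrite /= /c min_l// max_r.
by apply: measurable_funTS; exact: continuous_measurable_fun.
Qed.

Lemma mulmx3E p (X Y Z : 'M[R]_p) i j :
  (X *m Y *m Z) i j = \sum_l \sum_k X i k * Z l j * Y k l.
Proof.
rewrite mxE; apply: eq_bigr => l _; rewrite mxE mulr_suml.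
by apply: eq_bigr => k _; ring.
Qed.

(** The identity [N t - N s = - N s (A t - A s) N t] first shows that [N] is Lipschitz. Used a
    second time, it makes the increment of [N] plus the integral of [N B N] of order [(t - s) ^+ 2],
    so that [flat_increments] applies. *)
Lemma primitive_invmx p a b (A B : R -> 'M[R]_p) (C CB : R) : a <= b ->
  (forall s, a <= s <= b -> A s \in unitmx) ->
  (forall i j, primitive a b (fun s => A s i j) (fun s => B s i j)) ->
  (forall s i j, a <= s <= b -> `|invmx (A s) i j| <= C) ->
  (forall s i j, a <= s <= b -> `|B s i j| <= CB) ->
  forall i j, primitive a b (fun s => invmx (A s) i j)
    (fun s => - (invmx (A s) *m B s *m invmx (A s)) i j).
Proof.
move=> ab uA pA NC BC; pose N s : 'M[R]_p := invmx (A s).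
have ab' : a <= a <= b by rewrite lexx.
have C0 : forall i j : 'I_p, 0 <= C by move=> i j; apply: le_trans (NC a i j ab').
have CB0 : forall i j : 'I_p, 0 <= CB by move=> i j; apply: le_trans (BC a i j ab').
have dN s t : a <= s <= b -> a <= t <= b -> N t - N s = - (N s *m (A t - A s) *m N t).
  move=> sab tab; rewrite mulmxBr mulmxBl mulVmx ?uA// mul1mx -mulmxA.
  by rewrite mulmxV ?uA// mulmx1 opprB.
pose K := \sum_(l < p) \sum_(k < p) C * C * CB.
have NL i j s t : a <= s <= b -> a <= t <= b -> `|N t i j - N s i j| <= K * `|t - s|.
  move=> sab tab; have /matrixP/(_ i j) := dN s t sab tab.
  rewrite [LHS]mxE [(- N s) i j]mxE => ->; rewrite mxE mulmx3E normrN.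
  rewrite /K !mulr_suml; apply: le_trans (ler_norm_sum _ _ _) _.
  apply: ler_sum => l _; apply: le_trans (ler_norm_sum _ _ _) _.
  apply: ler_sum => k _; rewrite !normrM -[leRHS]mulrA.
  apply: ler_pM; rewrite ?mulr_ge0//; first by apply: ler_pM; rewrite ?NC.
  rewrite !mxE; exact: (primitive_lipschitz (pA k l) (fun x => BC x k l)).
have mN i j : measurable_fun `[a, b] (fun s => N s i j).
  exact: (lipschitz_measurable ab (NL i j)).
have iterm i j k l : itv_integrable a b (fun s => N s i k * N s l j * B s k l).
  apply: (@itv_integrableM _ _ _ _ _ (C * C)) => [x xab||].
  - by rewrite normrM ler_pM// NC.
  - exact: measurable_funM.
  - by have [] := pA k l.
move=> i j.
have iNBN : itv_integrable a b (fun s => (N s *m B s *m N s) i j).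
  have -> : (fun s => (N s *m B s *m N s) i j) =
     (fun s => \sum_l \sum_k N s i k * N s l j * B s k l).
    by apply/funext => s; rewrite mulmx3E.
  by apply: itv_integrable_sum => l; apply: itv_integrable_sum => k.
have Nc F : itv_integrable a b F -> itv_integrable a b (fun x => - F x).
  move=> iF; have := itv_integrableZ (-1) iF.
  by have -> : (fun x => -1 * F x) = (fun x => - F x) by
     apply/funext => x; rewrite mulN1r.
split; first exact: Nc.
move=> s0 t0 as0 s0t0 t0b.
have is0 : itv_integrable s0 t0 (fun s => (N s *m B s *m N s) i j).
  exact: itv_integrableS iNBN.
pose Phi u := N u i j + lint (fun s => (N s *m B s *m N s) i j) s0 u.
have -> : lint (fun s => - (N s *m B s *m N s) i j) s0 t0 =
   - lint (fun s => (N s *m B s *m N s) i j) s0 t0.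
  rewrite -mulN1r -lintZ//; apply: eq_lint => x _; by rewrite mulN1r.
suff : Phi t0 = Phi s0 by rewrite /Phi [in RHS]lint_itv1// addr0 -/(N t0) -/(N s0) => <-;
  by rewrite opprD addrA subrr add0r.
apply: (@flat_increments _ Phi id (\sum_(l < p) \sum_(k < p) 2 * C * K * CB)) => //.
move=> s t s0s st tt0.
have as_ := le_trans as0 s0s; have tb := le_trans tt0 t0b.
have sab : a <= s <= b by rewrite as_ (le_trans st).
have tab : a <= t <= b by rewrite tb (le_trans as_).
have sub h : itv_integrable a b h -> itv_integrable s t h by exact: itv_integrableS.
pose D l k u := N u i k * N u l j * B u k l - N s i k * N t l j * B u k l.
have iD l k : itv_integrable s t (D l k).
  have -> : D l k = (fun u => N u i k * N u l j * B u k l +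
      (- (N s i k * N t l j)) * B u k l).
    by apply/funext => u; rewrite /D; ring.
  apply: itv_integrableD; first exact: sub.
  by apply: itv_integrableZ; apply: sub; have [] := pA k l.
have -> : Phi t - Phi s = lint (fun u => \sum_l \sum_k D l k u) s t.
  rewrite lint_sum => [|l]; last by apply: itv_integrable_sum => k.
  have dNs : N t i j - N s i j = - \sum_l \sum_k N s i k * N t l j * lint (fun u => B u k l) s t.
    have /matrixP/(_ i j) := dN s t sab tab.
    rewrite [LHS]mxE [(- N s) i j]mxE => ->; rewrite mxE mulmx3E; congr (- _).
    apply: eq_bigr => l _; apply: eq_bigr => k _; rewrite !mxE.
    by have [_ <-] := pA k l.
  have -> : Phi t - Phi s = (N t i j - N s i j) + lint (fun u => (N u *m B u *m N u) i j) s t.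
    rewrite /Phi (lint_split s0s st); first by ring.
    exact: itv_integrableS is0.
  rewrite dNs addrC (@eq_lint _ _ (fun u => \sum_l \sum_k N u i k * N u l j * B u k l)); last first.
    by move=> u _; rewrite mulmx3E.
  rewrite lint_sum => [|l]; last by apply: itv_integrable_sum => k; exact: sub.
  rewrite -sumrB; apply: eq_bigr => l _; rewrite !lint_sum// => [|k]; last exact: sub.
  rewrite -sumrB; apply: eq_bigr => k _; rewrite -lintZ; last by apply: sub; have [] := pA k l.
  rewrite -lintB//; first exact: sub.
  by apply/itv_integrableZ/sub; have [] := pA k l.
apply: le_trans (lint_bound (C := \sum_(l < p) \sum_(k < p) 2 * C * K * CB * (t - s)) st _ _) _.
- by apply: itv_integrable_sum => l; apply: itv_integrable_sum => k.
- move=> u /andP[su ut]; have uab : a <= u <= b by rewrite (le_trans as_ su) (le_trans ut tb).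
  apply: le_trans (ler_norm_sum _ _ _) _; apply: ler_sum => l _.
  apply: le_trans (ler_norm_sum _ _ _) _; apply: ler_sum => k _.
  have -> : D l k u = ((N u i k - N s i k) * N u l j - N s i k * (N t l j - N u l j)) * B u k l.
    by rewrite /D; ring.
  have h1 := NL i k s u sab uab; have h2 := NL l j u t uab tab.
  have K0 : 0 <= K.
    by apply: sumr_ge0 => ? _; apply: sumr_ge0 => ? _; rewrite !mulr_ge0// ?(C0 i j)// (CB0 i j).
  have h1' : `|N u i k - N s i k| <= K * (t - s).
    apply: le_trans h1 _; rewrite ler_wpM2l// ger0_norm ?subr_ge0// lerD2r//.
  have h2' : `|N t l j - N u l j| <= K * (t - s).
    apply: le_trans h2 _; rewrite ler_wpM2l// ger0_norm ?subr_ge0// lerD2l lerN2//.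
  have h3 : `|(N u i k - N s i k) * N u l j - N s i k * (N t l j - N u l j)| <=
      2 * C * (K * (t - s)).
    apply: le_trans (ler_normB _ _) _; rewrite !normrM.
    have := ler_pM (normr_ge0 _) (normr_ge0 _) h1' (NC u l j uab).
    have := ler_pM (normr_ge0 _) (normr_ge0 _) (NC s i k sab) h2'.
    by move=> e1 e2; apply: le_trans (lerD e2 e1) _;
       rewrite le_eqVlt; apply/orP; left; apply/eqP; ring.
  rewrite normrM; apply: le_trans (ler_pM _ _ h3 (BC u k l uab)) _ => //.
  by rewrite le_eqVlt; apply/orP; left; apply/eqP; ring.
rewrite le_eqVlt; apply/orP; left; apply/eqP.
rewrite -mulrA !mulr_suml; apply: eq_bigr => l _.
by apply: eq_bigr => k _; ring.
Qed.

End MatrixCalculus.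

(** * Uniqueness for the Riccati equation *)

Section Gronwall.
Context {R : realType}.

Lemma lint_expR (lam t tr : R) : 0 < lam -> t <= tr ->
  lint (fun s => expR (lam * (tr - s))) t tr <= expR (lam * (tr - t)) / lam.
Proof.
move=> l0 ttr.
have c s : is_derive s (1 : R) (fun s => lam * (tr - s)) (- lam).
  by apply: is_derive_eq; rewrite /GRing.scale/=; ring.
rewrite (_ : lint _ t tr = (- lam^-1 * expR (lam * (tr - tr))) - (- lam^-1 * expR (lam * (tr - t)))).
  rewrite subrr mulr0 expR0 mulr1 mulNr opprK addrC mulrC.
  by rewrite gerBl invr_ge0 ltW.
apply: (FTC2 (F := fun s => - lam^-1 * expR (lam * (tr - s)))) => //.
  move=> s; apply: (continuous_comp (f := fun s => lam * (tr - s)) (g := expR)).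
    by apply: differentiable_continuous; apply/derivable1_diffP; have [] := c s.
  exact: continuous_expR.
move=> s _; apply: is_derive_eq; rewrite /GRing.scale/=; field.
by rewrite gt_eqF.
Qed.

(* Weighting by [exp (lam (tr - s))] makes the Volterra operator a contraction. *)
Lemma volterra_zero X (W : R -> X -> R) (nx : X -> R) (t1 tr M C0 : R) :
  0 <= M -> 0 <= C0 -> (forall x, 0 <= nx x) ->
  (forall s x, t1 <= s <= tr -> W s x <= C0 * nx x) ->
  (forall phi : R -> R, continuous phi -> (forall s, 0 <= phi s) ->
    (forall s x, t1 <= s <= tr -> W s x <= phi s * nx x) ->
    forall t x, t1 <= t <= tr -> W t x <= M * lint phi t tr * nx x) ->
  forall t x, t1 <= t <= tr -> W t x <= 0.
Proof.
move=> M0 C00 nx0 W0 step.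
(* This makes [M / lam] at most one half, so each use of [step] halves the constant. *)
pose lam := 2 * M + 1.
have l0 : 0 < lam by rewrite /lam; lra.
(* Only continuous majorants of [W] are integrated, since [W] itself is not known to be
   measurable. *)
have half n s x : t1 <= s <= tr -> W s x <= C0 / 2 ^+ n * expR (lam * (tr - s)) * nx x.
  elim: n s x => [|n ih] s x st.
    rewrite expr0 divr1; apply: le_trans (W0 _ _ st) _; rewrite ler_wpM2r//.
    have /andP[_ str] := st.
    rewrite ler_peMr// -expR0 ler_expR mulr_ge0 ?subr_ge0// ltW//.
  have c0 : 0 <= C0 / 2 ^+ n by rewrite divr_ge0// exprn_ge0.
  have ce : continuous (fun s => expR (lam * (tr - s))).
    move=> u; apply: continuous_comp; last exact: continuous_expR.
    by apply: cvgM; [exact: cvg_cst|apply: cvgB; [exact: cvg_cst|exact: cvg_id]].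
  pose phi (s : R) := C0 / 2 ^+ n * expR (lam * (tr - s)).
  have cphi : continuous phi by move=> u; apply: cvgM; [exact: cvg_cst|exact: ce].
  have phi0 u : 0 <= phi u by rewrite mulr_ge0// expR_ge0.
  apply: le_trans (step phi cphi phi0 ih s x st) _.
  rewrite ler_wpM2r// lintZ; last exact: continuous_itv_integrable.
  have /andP[_ str] := st.
  have := lint_expR l0 str; set I := lint _ _ _; set E := expR _ => hI.
  have E0 : 0 <= E by exact: expR_ge0.
  apply: (@le_trans _ _ (M * (C0 / 2 ^+ n * (E / lam)))).
    by rewrite ler_wpM2l// ler_wpM2l.
  have -> : M * (C0 / 2 ^+ n * (E / lam)) = (C0 / 2 ^+ n * E) * (M / lam) by ring.
  have -> : C0 / 2 ^+ n.+1 * E = (C0 / 2 ^+ n * E) * 2^-1.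
    by rewrite exprS invfM; ring.
  rewrite ler_wpM2l ?mulr_ge0//; rewrite ler_pdivrMr// /lam; lra.
move=> t x tt; apply/ler_addgt0Pl => e e0; rewrite addr0.
pose D := C0 * expR (lam * (tr - t)) * nx x.
have D0 : 0 <= D by rewrite !mulr_ge0// expR_ge0.
have lim0 : D * (1 / 2 ^+ n) @[n --> \oo] --> D * 0.
  apply: cvgM; first exact: cvg_cst.
  have := @cvg_geometric R 1 (2^-1) _; rewrite normfV ger0_norm//.
  rewrite invf_lt1// ltr1n => /(_ isT); apply: cvg_near_eq.
  by apply: nearW => n; rewrite /geometric/= exprVn.
rewrite mulr0 in lim0.
have [n hn] : exists n, D * (1 / 2 ^+ n) <= e.
  move/cvgrPdistC_le : lim0 => /(_ e e0)[n _ /(_ n (leqnn n))] /=.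
  by rewrite subr0 => /(le_trans (ler_norm _)) h; exists n.
apply: le_trans (half n t x tt) _; apply: le_trans hn.
by rewrite le_eqVlt; apply/orP; left; apply/eqP; rewrite /D; ring.
Qed.

End Gronwall.

Section Uniqueness.
Context {R : realType} {H : completeNormedModType R}.
Variables (ip : H -> H -> R) (ipH : inner ip).
Variables (S : R -> H -> H) (S_sg : C0_semigroup S).
Variables (Q : H -> H) (Qb : bounded_op Q) (tl tr : R).
Local Notation Sa := (Sadj ip S).

(** Up to sign the quadratic terms differ by [U1 Q (U1 - U2) + (U1 - U2) Q U2]. The last summand
    evaluates the difference at another vector, so the Gronwall argument works with a majorant of
    operator type, uniform in [x]; local boundedness provides the initial one. *)
Lemma riccati_mild_unique UT U1 U2 : riccati_mild ip S Q tl tr UT U1 ->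
  riccati_mild ip S Q tl tr UT U2 ->
  forall t x, tl < t <= tr -> U1 t x = U2 t x.
Proof.
move=> [b1 l1 e1] [b2 l2 e2] t1 x1 /andP[tlt1 t1r].
have [C1' hC1] := l1 t1 (introT andP (conj tlt1 t1r)).
have [C2' hC2] := l2 t1 (introT andP (conj tlt1 t1r)).
have [C1 C10 {}hC1] : exists2 C, 0 <= C & forall s x, t1 <= s <= tr -> `|U1 s x| <= C * `|x|.
  exists `|C1'| => // s x st; apply: le_trans (hC1 s x st) _.
  by rewrite ler_wpM2r// ler_norm.
have [C2 C20 {}hC2] : exists2 C, 0 <= C & forall s x, t1 <= s <= tr -> `|U2 s x| <= C * `|x|.
  exists `|C2'| => // s x st; apply: le_trans (hC2 s x st) _.
  by rewrite ler_wpM2r// ler_norm.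
have [q q0 hq] := bounded_opP Qb.
have [M M0 hM] := semigroup_bound S_sg (tr - t1).
have hMa s : 0 <= s <= tr - t1 -> forall x, `|Sa s x| <= M * `|x|.
  by move=> sr; have /andP[s0 _] := sr; apply: Sadj_bound => // x; exact: hM.
pose K := M * (C1 * q * M + q * C2 * M).
have K0 : 0 <= K by rewrite mulr_ge0// addr_ge0// !mulr_ge0.
suff h : forall t x, t1 <= t <= tr -> `|U1 t x - U2 t x| <= 0.
  apply/eqP; rewrite -subr_eq0 -normr_le0; apply: h; by rewrite lexx.
apply: (@volterra_zero _ H (fun t x => `|U1 t x - U2 t x|) (fun x => `|x|) t1 tr K (C1 + C2)) => //.
- by rewrite addr_ge0.
- by move=> s x st; rewrite mulrDl (le_trans (ler_normB _ _))// lerD ?hC1 ?hC2.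
move=> phi cphi phi0 hphi t x tt; have /andP[t1t ttr] := tt.
have tlt : tl < t <= tr by rewrite (lt_le_trans tlt1).
have [[v1 B1] ->] := e1 t x tlt; have [[v2 B2] ->] := e2 t x tlt.
rewrite (bint_eq ipH B1) (bint_eq ipH B2) opprB addrC subrKA.
have ih : itv_integrable t tr (fun s => K * `|x| * phi s).
  exact/itv_integrableZ/continuous_itv_integrable.
have -> : K * lint phi t tr * `|x| = lint (fun s => K * `|x| * phi s) t tr.
  by rewrite lintZ; [ring|exact: continuous_itv_integrable].
apply: (bochner_itv_dist ipH B2 B1 (null_measurable0 _) ih) => s /andP[ts sr] _.
have st1 : t1 <= s <= tr by rewrite sr (le_trans t1t).
have tls : tl < s <= tr by rewrite sr (lt_le_trans tlt1)// (le_trans t1t).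
have sr1 : 0 <= s - t <= tr - t1 by rewrite subr_ge0 ts lerB.
have sab : bounded_op (Sa (s - t)) by apply: Sadj_bounded => //; rewrite subr_ge0.
set z := S (s - t) x.
have hz : `|z| <= M * `|x| by exact: hM.
rewrite -(bounded_opB _ _ sab); apply: le_trans (hMa _ sr1 _) _.
rewrite /K -!mulrA ler_wpM2l//.
have -> : U2 s (Q (U2 s z)) - U1 s (Q (U1 s z)) =
   - (U1 s (Q (U1 s z - U2 s z)) + (U1 s (Q (U2 s z)) - U2 s (Q (U2 s z)))).
  by rewrite (bounded_opB _ _ Qb) (bounded_opB _ _ (b1 _ tls)) subrKA opprB.
rewrite normrN; apply: le_trans (ler_normD _ _) _; rewrite mulrDl; apply: lerD.
  apply: le_trans (hC1 _ _ st1) _; rewrite -!mulrA ler_wpM2l//.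
  apply: le_trans (hq _) _; rewrite ler_wpM2l//.
  apply: le_trans (hphi s z st1) _; rewrite mulrC.
  by rewrite mulrA ler_wpM2r.
apply: le_trans (hphi s _ st1) _.
rewrite (_ : q * (C2 * M) * _ = phi s * (q * (C2 * (M * `|x|)))); last by ring.
rewrite ler_wpM2l//; apply: le_trans (hq _) _; rewrite ler_wpM2l//.
by apply: le_trans (hC2 _ _ st1) _; rewrite ler_wpM2l.
Qed.

End Uniqueness.

(** * The equations on one interval *)

Section Interval.
Context {R : realType} {H : completeNormedModType R}.
Variables (ip : H -> H -> R) (ipH : inner ip).
Variables (S : R -> H -> H) (S_sg : C0_semigroup S).
Variables (Q : H -> H) (Qb : bounded_op Q).
Hypothesis Qsym : forall x y, ip (Q x) y = ip x (Q y).
Hypothesis Qpos : forall x, 0 <= ip (Q x) x.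
Variables (tl tr : R) (p : nat) (b : 'I_p -> H).
Hypothesis tlr : tl < tr.
Local Notation Sa := (Sadj ip S).

Let Sb t : 0 <= t -> bounded_op (S t). Proof. by case: S_sg => + _ _ _; exact. Qed.
Let Sab t : 0 <= t -> bounded_op (Sa t). Proof. exact: Sadj_bounded. Qed.

(** The maximum with 0 freezes the vector for [s > tr], which makes it continuous in [s] on the
    whole line. *)
Definition gen (i : 'I_p) (s : R) : H := Sa (Num.max 0 (tr - s)) (b i).

(** When [b] is [stack_gen], [ev s] is the stacked operator at time [s] and [comb s] its adjoint
    ([Lstack_ev], [Lstack_adj_comb]); [covm s] is then the operator times [Q] times the adjoint.
    Leaving [b] arbitrary lets one analysis serve all intervals. *)
Definition ev (s : R) (x : H) : 'cV[R]_p := \col_i ip x (gen i s).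

Definition comb (s : R) (c : 'cV[R]_p) : H := \sum_i c i ord0 *: gen i s.

Definition covm (s : R) : 'M[R]_p := \matrix_(i, j) ip (Q (gen j s)) (gen i s).

Lemma gen_continuous i : continuous (gen i).
Proof.
move=> s; have k : tr - u @[u --> s] --> tr - s.
  by apply: cvgB; [exact: cvg_cst|exact: cvg_id].
have h := @semigroup_continuous R H _ (Sadj_semigroup ipH S_sg) (b i) (tr - s).
by have := cvg_comp _ _ k h; apply.
Qed.

Lemma gen_bound : exists2 B, 0 <= B & forall i s, tl <= s <= tr -> `|gen i s| <= B.
Proof.
have [M M0 hM] := semigroup_bound (Sadj_semigroup ipH S_sg) (tr - tl).
exists (M * \sum_i `|b i|); first by rewrite mulr_ge0// sumr_ge0.
move=> i s /andP[ls sr]; rewrite /gen max_r ?subr_ge0//.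
apply: le_trans (hM _ _ _) _; first by rewrite subr_ge0 sr lerD2l lerN2.
by rewrite ler_wpM2l// (bigD1 i)//= lerDl sumr_ge0.
Qed.

Lemma Sadj_gen i t s : t <= s -> s <= tr -> Sa (s - t) (gen i s) = gen i t.
Proof.
move=> ts sr; rewrite /gen !max_r ?subr_ge0//; last exact: le_trans sr.
by rewrite -(SadjD ipH) ?subr_ge0// addrC subrKA.
Qed.

Lemma comb_linear s : linear (comb s).
Proof.
move=> c u v; rewrite /comb scaler_sumr -big_split/=; apply: eq_bigr => i _.
by rewrite !mxE scalerDl scalerA.
Qed.

Lemma combD s u v : comb s (u + v) = comb s u + comb s v.
Proof. by have := comb_linear s 1 u v; rewrite !scale1r. Qed.

Lemma combB s u v : comb s (u - v) = comb s u - comb s v.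
Proof. by rewrite -scaleN1r addrC comb_linear scaleN1r addrC. Qed.

Lemma ev_linear s : linear (ev s).
Proof.
by move=> c x y; apply/colP => i; rewrite !mxE (ipDl ipH) (ipZl ipH).
Qed.

Lemma Sadj_comb c t s : t <= s -> s <= tr -> Sa (s - t) (comb s c) = comb t c.
Proof.
move=> ts sr; rewrite /comb (bounded_op_sum _ _ _ (Sab _)) ?subr_ge0//.
by apply: eq_bigr => i _; rewrite (bounded_opZ _ _ (Sab _)) ?subr_ge0// Sadj_gen.
Qed.

Lemma ev_S x t s : t <= s -> s <= tr -> ev s (S (s - t) x) = ev t x.
Proof.
move=> ts sr; apply/colP => i; rewrite !mxE (SadjP ipH S_sg) ?subr_ge0//.
by rewrite Sadj_gen.
Qed.

Lemma ip_comb x s c : ip x (comb s c) = euclid (ev s x) c.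
Proof.
rewrite (ip_sumr ipH) /euclid; apply: eq_bigr => i _.
by rewrite (ipZr ipH) mxE mulrC.
Qed.

Lemma ev_Q_comb s c : ev s (Q (comb s c)) = covm s *m c.
Proof.
apply/colP => i; rewrite !mxE /comb (bounded_op_sum _ _ _ Qb) (ip_suml ipH).
by apply: eq_bigr => j _; rewrite mxE (bounded_opZ _ _ Qb) (ipZl ipH) mulrC.
Qed.

Lemma covm_sym s : (covm s)^T = covm s.
Proof. by apply/matrixP => i j; rewrite !mxE Qsym (ipC ipH). Qed.

Lemma euclid_covm s c : euclid c (covm s *m c) = ip (Q (comb s c)) (comb s c).
Proof. by rewrite ip_comb ev_Q_comb euclidC. Qed.

Lemma covm_continuous i j : continuous (fun s => covm s i j).
Proof.
move=> s; under eq_fun do rewrite mxE.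
apply: (ip_cvg ipH); last exact: gen_continuous.
by have := cvg_comp _ _ (@gen_continuous j s) (Qb.2 (gen j s)); apply.
Qed.

Lemma covm_bound : exists C : R, forall s i j, tl <= s <= tr -> `|covm s i j| <= C.
Proof.
have [B B0 hB] := gen_bound; have [C C0 hC] := bounded_opP Qb.
exists (C * B * B) => s i j st; rewrite mxE; apply: le_trans (ip_cauchy ipH _ _) _.
apply: ler_pM => //; last exact: hB.
by apply: le_trans (hC _) _; rewrite ler_wpM2l// hB.
Qed.

Lemma comb_bound : exists2 B, 0 <= B & forall s (c : 'cV[R]_p) C, tl <= s <= tr ->
  (forall i, `|c i ord0| <= C) -> `|comb s c| <= B * C.
Proof.
have [B B0 hB] := gen_bound; exists (\sum_(i < p) B); first exact: sumr_ge0.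
move=> s c C st cC; rewrite mulr_suml; apply: le_trans (ler_norm_sum _ _ _) _.
by apply: ler_sum => i _; rewrite normrZ mulrC ler_pM// hB.
Qed.

Lemma ev_bound : exists2 B, 0 <= B & forall s x i, tl <= s <= tr ->
  `|ev s x i ord0| <= B * `|x|.
Proof.
have [B B0 hB] := gen_bound; exists B => // s x i st.
by rewrite mxE mulrC; apply: le_trans (ip_cauchy ipH _ _) _; rewrite ler_wpM2l// hB.
Qed.

Section Riccati.
Variables (R0 : 'M[R]_p) (R0pos : posdef R0) (RR : R -> 'M[R]_p).
Hypothesis RRE : forall s, tl <= s <= tr -> forall i j,
  RR s i j = R0 i j + lint (fun u => covm u i j) s tr.

Let N s : 'M[R]_p := invmx (RR s).

Let covi i j u v : itv_integrable u v (fun s => covm s i j).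
Proof. exact/continuous_itv_integrable/covm_continuous. Qed.

Lemma RR_euclid s x : tl <= s <= tr ->
  euclid x (RR s *m x) = euclid x (R0 *m x) + lint (fun u => euclid x (covm u *m x)) s tr.
Proof.
move=> st.
have E (A : 'M[R]_p) : euclid x (A *m x) = \sum_i \sum_j x i ord0 * x j ord0 * A i j.
  rewrite /euclid; apply: eq_bigr => i _; rewrite mxE mulr_sumr.
  by apply: eq_bigr => j _; ring.
rewrite (@eq_lint _ _ (fun u => \sum_i \sum_j x i ord0 * x j ord0 * covm u i j)) => [|u _]; last exact: E.
rewrite !E lint_sum => [|i]; last first.
  by apply: itv_integrable_sum => j; exact: itv_integrableZ.
rewrite -big_split/=; apply: eq_bigr => i _; rewrite lint_sum => [|j]; last exact: itv_integrableZ.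
rewrite -big_split/=; apply: eq_bigr => j _; rewrite lintZ// RRE//; ring.
Qed.

(** Positivity of [Q] makes [covm] positive semidefinite. This lower bound by a fixed form gives the
    invertibility of [RR s] and a bound on its inverse that is uniform in [s]. *)
Lemma RR_ge s x : tl <= s <= tr -> euclid x (R0 *m x) <= euclid x (RR s *m x).
Proof.
move=> st; rewrite RR_euclid// lerDl; apply: lint_ge0 => u _.
by rewrite euclid_covm.
Qed.

Lemma RR_posdef s : tl <= s <= tr -> posdef (RR s).
Proof.
move=> st; split.
  apply/matrixP => i j; rewrite mxE !RRE// -[in LHS]R0pos.1 mxE; congr (_ + _).
  by apply: eq_lint => u _; rewrite -[in LHS]covm_sym mxE.
by move=> x x0; apply: lt_le_trans (RR_ge _ st); exact: R0pos.2.
Qed.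

Lemma RR_primitive i j : primitive tl tr (fun s => RR s i j) (fun s => (- covm s) i j).
Proof.
have e : (fun s => (- covm s) i j) = (fun s => -1 * covm s i j).
  by apply/funext => s; rewrite mxE mulN1r.
rewrite e; split; first exact: itv_integrableZ.
move=> s t ls st tr_.
have h1 : tl <= s <= tr by rewrite ls (le_trans st).
have h2 : tl <= t <= tr by rewrite tr_ (le_trans ls).
rewrite lintZ// !RRE// (lint_split st tr_ (covi i j s tr)); ring.
Qed.

Lemma N_bound : exists C : R, forall s i j, tl <= s <= tr -> `|N s i j| <= C.
Proof.
have [C hC] := invmx_entry_bound R0pos; exists C => s i j st.
by apply: hC; [exact: RR_posdef|move=> x; exact: RR_ge].
Qed.

Lemma N_primitive i j :
  primitive tl tr (fun s => N s i j) (fun s => (N s *m covm s *m N s) i j).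
Proof.
have [C hC] := N_bound; have [CP hP] := covm_bound.
have hP' s k l : tl <= s <= tr -> `|(- covm s) k l| <= CP.
  by move=> st; rewrite mxE normrN hP.
have := primitive_invmx (ltW tlr) (fun s st => posdef_unit (RR_posdef st))
   RR_primitive hC hP' i j.
apply: eq_primitive => s st //.
by rewrite mulmxN mulNmx mxE opprK.
Qed.

Definition Uloc (s : R) (x : H) : H := comb s (N s *m ev s x).

Lemma Uloc_bound : exists2 C, 0 <= C & forall s x, tl <= s <= tr -> `|Uloc s x| <= C * `|x|.
Proof.
have [B B0 hB] := comb_bound; have [D D0 hD] := ev_bound; have [C hC] := N_bound.
exists (B * \sum_(j < p) `|C| * D).
  by rewrite mulr_ge0// sumr_ge0// => j _; rewrite mulr_ge0.
move=> s x st; rewrite -mulrA; apply: hB => // i; rewrite mxE.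
rewrite mulr_suml; apply: le_trans (ler_norm_sum _ _ _) _; apply: ler_sum => j _.
rewrite normrM -mulrA ler_pM ?hD//.
by apply: le_trans (hC _ _ _ st) (ler_norm _).
Qed.

Lemma Uloc_linear s : linear (Uloc s).
Proof.
by move=> c x y; rewrite /Uloc ev_linear mulmxDr -scalemxAr comb_linear.
Qed.

Lemma Uloc_bounded s : tl <= s <= tr -> bounded_op (Uloc s).
Proof.
move=> st; have [C C0 hC] := Uloc_bound.
by apply: (linear_bounded_op (C := C) (Uloc_linear s)) => x; exact: hC.
Qed.

Lemma Uloc_riccati_integrand t s x : tl <= t -> t <= s <= tr ->
  Sa (s - t) (Uloc s (Q (Uloc s (S (s - t) x)))) =
  comb t (N s *m covm s *m N s *m ev t x).
Proof.
move=> lt /andP[ts st].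
by rewrite /Uloc ev_S// ev_Q_comb Sadj_comb// -!mulmxA.
Qed.

Lemma riccati_mild_Uloc : riccati_mild ip S Q tl tr (Uloc tr) Uloc.
Proof.
split.
- by move=> t /andP[lt tt]; apply: Uloc_bounded; rewrite ltW.
- move=> t /andP[lt tt]; have [C C0 hC] := Uloc_bound; exists C => s x /andP[ts st].
  by apply: hC; rewrite st andbT (le_trans (ltW lt)).
move=> t x /andP[/ltW lt tt] g.
have ic i : itv_integrable t tr (fun s => (N s *m covm s *m N s *m ev t x) i ord0).
  have -> : (fun s => (N s *m covm s *m N s *m ev t x) i ord0) =
     (fun s => \sum_j ev t x j ord0 * (N s *m covm s *m N s) i j).
    by apply/funext => s; rewrite mxE; apply: eq_bigr => j _; rewrite mulrC.
  apply: itv_integrable_sum => j; apply: itv_integrableZ.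
  by have [ij _] := N_primitive i j; exact: itv_integrableS ij.
have gE s : t <= s <= tr -> g s = \sum_i (N s *m covm s *m N s *m ev t x) i ord0 *: gen i t.
  by move=> st; rewrite /g Uloc_riccati_integrand.
have B := bochner_finite_rank ipH (fun i => gen i t) ic.
have {B} B : is_bochner_itv t tr g (comb t (N tr *m ev t x) - comb t (N t *m ev t x)).
  apply: (bochner_congr (null_measurable0 _) _ (v := _)) => [s st _|].
    by rewrite gE.
  move: B; congr (is_bochner _ _ _ _); rewrite -combB; apply: eq_bigr => i _.
  congr (_ *: _); rewrite -mulmxBl mxE.
  under eq_lint do rewrite mxE.
  rewrite lint_sum => [|j]; last first.
    under eq_fun do rewrite mulrC; apply: itv_integrableZ.
    by have [ij _] := N_primitive i j; exact: itv_integrableS ij.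
  apply: eq_bigr => j _; under eq_lint do rewrite mulrC.
  rewrite lintZ; last by have [ij _] := N_primitive i j; exact: itv_integrableS ij.
  by have [_ <-] := N_primitive i j => //; rewrite mulrC !mxE.
split; first by eexists; exact: B.
rewrite (bint_eq ipH B) /Uloc Sadj_comb// ev_S// opprB addrC subrK.
by [].
Qed.

Lemma N_right_cvg i j : N s i j @[s --> tl^'+] --> N tl i j.
Proof.
have := primitive_within (ltW tlr) (N_primitive i j).
by move=> /(continuous_within_itvP _ tlr)[].
Qed.

Lemma gen_right_dist i : `|gen i s - gen i tl| @[s --> tl^'+] --> 0.
Proof. by apply: cvg_dist0; apply: cvg_at_right_filter; exact: gen_continuous. Qed.

(** A finite sum of rank one operators with convergent coefficients and vectors converges in norm.
    The limit is the value of the local formula at [tl], a point that the half-open interval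
    excludes. *)
Lemma Uloc_right_limit : op_right_limit Uloc tl (Uloc tl).
Proof.
have ltl : tl <= tl <= tr by rewrite lexx ltW.
split; first exact: Uloc_bounded.
move=> e e0; have [B B0 hB] := gen_bound; have [C hC] := N_bound.
(* One term for each factor that varies with [s]: the coefficient, the vector paired with [x], the
   vector carrying the sum. *)
pose G i j s := `|N s i j - N tl i j| * B * B + `|C| * `|gen j s - gen j tl| * B +
   `|C| * B * `|gen i s - gen i tl|.
have G0 : \sum_i \sum_j G i j s @[s --> tl^'+] --> 0.
  have z : \sum_(i < p) \sum_(j < p) (0 : R) = 0.
    by rewrite big1// => i _; rewrite big1.
  rewrite -[X in _ --> X]z.
  apply: cvg_sum_seq => i; apply: cvg_sum_seq => j.
  have -> : 0 = 0 * B * B + `|C| * 0 * B + `|C| * B * 0 :> R by ring.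
  have h1 := cvg_dist0 (@N_right_cvg i j); have h2 := @gen_right_dist j.
  have h3 := @gen_right_dist i.
  apply: cvgD; first apply: cvgD.
  - by apply: cvgM; [apply: cvgM; [exact: h1|exact: cvg_cst]|exact: cvg_cst].
  - by apply: cvgM; [apply: cvgM; [exact: cvg_cst|exact: h2]|exact: cvg_cst].
  - by apply: cvgM; [exact: cvg_cst|exact: h3].
move/cvgrPdistC_le : G0 => /(_ e e0); near_simpl => G0.
near=> s => x.
have st : tl <= s <= tr.
  apply/andP; split; near: s; first exact: nbhs_right_ge.
  exact: nbhs_right_le.
have Ge : \sum_i \sum_j G i j s <= e.
  have : `|\sum_i \sum_j G i j s - 0| <= e by near: s.
  by rewrite subr0; apply: le_trans; exact: ler_norm.
apply: le_trans (ler_wpM2r (normr_ge0 x) Ge).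
have UE t : Uloc t x = \sum_i \sum_j (N t i j * ip x (gen j t)) *: gen i t.
  rewrite /Uloc /comb; apply: eq_bigr => i _; rewrite -scaler_suml mxE.
  by congr (_ *: _); apply: eq_bigr => j _; rewrite mxE.
rewrite !UE -sumrB mulr_suml; apply: le_trans (ler_norm_sum _ _ _) _.
apply: ler_sum => i _; rewrite -sumrB mulr_suml; apply: le_trans (ler_norm_sum _ _ _) _.
apply: ler_sum => j _.
have -> : (N s i j * ip x (gen j s)) *: gen i s - (N tl i j * ip x (gen j tl)) *: gen i tl =
   ((N s i j - N tl i j) * ip x (gen j s)) *: gen i s +
   (N tl i j * ip x (gen j s - gen j tl)) *: gen i s +
   (N tl i j * ip x (gen j tl)) *: (gen i s - gen i tl).
  rewrite -scalerDl scalerBr (ipBr ipH).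
  rewrite (_ : _ + N tl i j * _ = N s i j * ip x (gen j s) - N tl i j * ip x (gen j tl)); last by ring.
  by rewrite scalerBl subrKA.
have term (c A D E : R) (u v : H) : `|c| <= A -> `|u| <= D -> `|v| <= E ->
    `|(c * ip x u) *: v| <= A * D * E * `|x|.
  move=> cA uD vE; rewrite normrZ normrM.
  have iD : `|ip x u| <= `|x| * D.
    by apply: le_trans (ip_cauchy ipH _ _) _; rewrite ler_wpM2l.
  apply: le_trans (ler_pM _ _ (ler_pM _ _ cA iD) vE) _; rewrite ?mulr_ge0//.
  by rewrite le_eqVlt; apply/orP; left; apply/eqP; ring.
have NC : `|N tl i j| <= `|C| by apply: le_trans (hC _ _ _ ltl) (ler_norm _).
rewrite /G [leRHS]mulrDl [X in _ <= X + _]mulrDl.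
apply: le_trans (ler_normD _ _) _; apply: lerD.
  by apply: le_trans (ler_normD _ _) _; apply: lerD; apply: term; rewrite ?hB.
by apply: term; rewrite ?hB.
Unshelve. all: by end_near. Qed.

(** * The second equation on one interval *)

Section Backward.
Variables (a : R -> H) (h : R -> R).
Hypothesis am : strongly_measurable tl tr a.
Hypothesis ih : itv_integrable tl tr h.
Hypothesis ah : forall s, tl <= s <= tr -> `|a s| <= h s.
Variables (y al0 : 'cV[R]_p) (al : R -> 'cV[R]_p).
Hypothesis alE : forall s, tl <= s <= tr -> forall i,
  al s i ord0 = al0 i ord0 + lint (fun u => ip (a u) (gen i u)) s tr.

Let beta s := y - al s.

Lemma obs_integrable i : itv_integrable tl tr (fun u => ip (a u) (gen i u)).
Proof.
have [B B0 hB] := gen_bound.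
apply: (itv_integrable_le (g := fun u => B * h u)); last exact: itv_integrableZ.
  apply: (strongly_measurable_ip ipH am) => v; apply: measurable_funTS.
  apply: continuous_measurable_fun => s; apply: (ip_cvg ipH); first exact: cvg_cst.
  exact: gen_continuous.
move=> s st; apply: le_trans (ip_cauchy ipH _ _) _.
by rewrite mulrC ler_pM ?hB ?ah.
Qed.

Lemma beta_primitive i :
  primitive tl tr (fun s => beta s i ord0) (fun u => ip (a u) (gen i u)).
Proof.
split; first exact: obs_integrable.
move=> s t ls st tr_.
have h1 : tl <= s <= tr by rewrite ls (le_trans st).
have h2 : tl <= t <= tr by rewrite tr_ (le_trans ls).
have := lint_split st tr_ (itv_integrableS ls (lexx _) (obs_integrable i)).
rewrite !mxE !alE// => ->; ring.
Qed.

Definition Vloc (s : R) : H := comb s (N s *m beta s).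

(** Product rule for [N beta]; the same vector is the coefficient of the integrand of the second
    equation, which is why [Vloc] solves it. *)
Let rate s : 'cV[R]_p := N s *m (covm s *m (N s *m beta s)) + N s *m ev s (a s).

Lemma Nbeta_primitive i :
  primitive tl tr (fun s => (N s *m beta s) i ord0) (fun s => rate s i ord0).
Proof.
have [C hC] := N_bound; have [CP hP] := covm_bound.
have bd k l s : tl <= s <= tr -> `|(N s *m covm s *m N s) k l| <=
    \sum_(i < p) \sum_(j < p) C * C * CP.
  move=> st; rewrite mulmx3E; apply: le_trans (ler_norm_sum _ _ _) _.
  apply: ler_sum => i' _; apply: le_trans (ler_norm_sum _ _ _) _.
  apply: ler_sum => j' _; rewrite !normrM ler_pM ?mulr_ge0 ?hP//.
  by rewrite ler_pM ?hC.
have := primitive_sum (index_enum 'I_p) (fun j =>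
  primitiveM (ltW tlr) (N_primitive i j) (bd i j) (beta_primitive j)).
apply: eq_primitive => s st; first by rewrite mxE.
rewrite big_split/= [RHS]mxE; congr (_ + _).
  by rewrite !mulmxA mxE.
by rewrite mxE; apply: eq_bigr => j _; rewrite mxE.
Qed.

Lemma backward_integrand t s : tl <= t -> t <= s <= tr ->
  Sa (s - t) (Uloc s (Q (Vloc s))) + Sa (s - t) (Uloc s (a s)) = comb t (rate s).
Proof.
by move=> lt /andP[ts st]; rewrite /Uloc /Vloc ev_Q_comb !Sadj_comb// -combD.
Qed.

Lemma backward_mild_Vloc : backward_mild ip S Q tl tr Uloc a (Vloc tr) Vloc.
Proof.
move=> t /andP[/ltW lt tt] g.
have ic i : itv_integrable t tr (fun s => rate s i ord0).
  by have [ij _] := Nbeta_primitive i; exact: itv_integrableS ij.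
have B := bochner_finite_rank ipH (fun i => gen i t) ic.
have {B} B : is_bochner_itv t tr g (comb t (N tr *m beta tr) - comb t (N t *m beta t)).
  apply: (bochner_congr (null_measurable0 _) _ (v := _)) => [s st _|].
    by rewrite /g backward_integrand.
  move: B; congr (is_bochner _ _ _ _); rewrite -combB; apply: eq_bigr => i _.
  by congr (_ *: _); have [_ <-] := Nbeta_primitive i; rewrite // !mxE.
split; first by eexists; exact: B.
by rewrite (bint_eq ipH B) /Vloc Sadj_comb// opprB addrC subrK.
Qed.

Lemma Vloc_right_cvg : Vloc s @[s --> tl^'+] --> Vloc tl.
Proof.
apply: cvg_sum_seq => i; apply: cvgZ.
  have := primitive_within (ltW tlr) (Nbeta_primitive i).
  by move=> /(continuous_within_itvP _ tlr)[].
by apply: cvg_at_right_filter; exact: gen_continuous.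
Qed.

End Backward.

(** * Uniqueness for the second equation among possibly unbounded solutions *)

Section BackwardUniqueness.
Variables (a : R -> H) (VT : H) (V1 V2 : R -> H).
Hypothesis mild1 : backward_mild ip S Q tl tr Uloc a VT V1.
Hypothesis mild2 : backward_mild ip S Q tl tr Uloc a VT V2.
Local Notation mu := (@lebesgue_measure R).

Let W s := V1 s - V2 s.
Let coef s : 'cV[R]_p := N s *m ev s (Q (W s)).

(** The terms with [a] cancel in the difference of the two equations, and transport to time [t]
    turns what remains into [comb t (coef s)]. *)
Let W_bound t h M : tl < t <= tr -> null_measurable mu M -> itv_integrable t tr h ->
  (forall s, t <= s <= tr -> ~ M s -> `|comb t (coef s)| <= h s) ->
  `|W t| <= lint h t tr.
Proof.
move=> tt nM ih hM; have /andP[tlt ttr] := tt.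
have [[v1 B1] e1] := mild1 tt; have [[v2 B2] e2] := mild2 tt.
rewrite /W e1 e2 (bint_eq ipH B1) (bint_eq ipH B2) opprB addrC subrKA.
apply: (bochner_itv_dist ipH B2 B1 nM ih) => s tst Ms.
rewrite opprD addrACA subrr addr0 distrC.
have /andP[ts st] := tst.
have st' : tl <= s <= tr by rewrite st andbT (le_trans (ltW tlt)).
have sab : bounded_op (Sa (s - t)) by apply: Sab; rewrite subr_ge0.
rewrite -(bounded_opB _ _ sab) -(bounded_opB _ _ (Uloc_bounded st')).
by rewrite -(bounded_opB _ _ Qb) /Uloc Sadj_comb// hM.
Qed.

Let W_dominated t : tl < t <= tr -> exists h M, [/\ null_measurable mu M,
  itv_integrable t tr h, forall s, 0 <= h s &
  forall s, t <= s <= tr -> ~ M s -> `|comb t (coef s)| <= h s].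
Proof.
move=> tt; have /andP[tlt ttr] := tt.
have [[v1 B1] _] := mild1 tt; have [[v2 B2] _] := mild2 tt.
have [h1 [M1 [nM1 ih1 h10 hM1]]] := bochner_itv_norm ipH B1.
have [h2 [M2 [nM2 ih2 h20 hM2]]] := bochner_itv_norm ipH B2.
exists (fun s => h1 s + h2 s), (M1 `|` M2); split.
- exact: null_measurableU.
- exact: itv_integrableD.
- by move=> s; exact: addr_ge0.
move=> s tst Ms; have /andP[ts st] := tst.
have st' : tl <= s <= tr by rewrite st andbT (le_trans (ltW tlt)).
have sab : bounded_op (Sa (s - t)) by apply: Sab; rewrite subr_ge0.
have -> : comb t (coef s) =
   (Sa (s - t) (Uloc s (Q (V1 s))) + Sa (s - t) (Uloc s (a s))) -
   (Sa (s - t) (Uloc s (Q (V2 s))) + Sa (s - t) (Uloc s (a s))).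
  rewrite opprD addrACA subrr addr0.
  rewrite -(bounded_opB _ _ sab) -(bounded_opB _ _ (Uloc_bounded st')).
  by rewrite -(bounded_opB _ _ Qb) /Uloc Sadj_comb.
apply: le_trans (ler_normB _ _) _; apply: lerD.
  by apply: hM1 => // ?; apply: Ms; left.
by apply: hM2 => // ?; apply: Ms; right.
Qed.

Let coef0 s : W s = 0 -> coef s = 0.
Proof.
move=> W0; rewrite /coef W0 (bounded_op0 Qb).
have -> : ev s 0 = 0 by apply/colP => i; rewrite !mxE (ip0l ipH).
exact: mulmx0.
Qed.

(** The integrand vanishes off the null set formed by [t] alone. This starts the argument at [tr]
    and later includes the infimum [tau]. *)
Let W_zero_left t : tl < t <= tr -> (forall s, t < s <= tr -> W s = 0) -> W t = 0.
Proof.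
move=> tt W0; apply/eqP; rewrite -normr_le0.
have -> : 0 = lint (fun=> 0 : R) t tr.
  by rewrite lint_cst ?mul0r//; have /andP[] := tt.
apply: (@W_bound _ _ [set t]) => //.
- split; first exact: measurable_set1.
  exact: lebesgue_measure_set1.
- by apply: continuous_itv_integrable; exact: cst_continuous.
move=> s /andP[ts st] /= nst; rewrite coef0.
  by rewrite /comb big1 ?normr0// => i _; rewrite mxE scale0r.
by apply: W0; rewrite st andbT lt_def ts andbT; apply/eqP.
Qed.

(** Its left kernel consists of the linear relations between the [gen i t], which turns statements
    on relations into statements on ranks. *)
Let gram t : 'M[R]_p := \matrix_(i, j) ip (gen i t) (gen j t).

Let gram_comb t (c : 'rV[R]_p) i : (c *m gram t) ord0 i = ip (comb t c^T) (gen i t).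
Proof.
rewrite mxE /comb (ip_suml ipH); apply: eq_bigr => j _.
by rewrite (ipZl ipH) !mxE.
Qed.

Let gram0 t (c : 'rV[R]_p) : c *m gram t = 0 <-> comb t c^T = 0.
Proof.
split=> [h|h].
  apply/eqP; rewrite -normr_eq0 -sqrf_eq0 -(ipxx ipH) {2}/comb (ip_sumr ipH).
  rewrite big1// => i _; rewrite (ipZr ipH) -gram_comb h.
  by rewrite [X in _ * X]mxE mulr0.
by apply/rowP => i; rewrite gram_comb h (ip0l ipH) mxE.
Qed.

Let comb_ker_left t s c : t <= s -> s <= tr -> comb s c = 0 -> comb t c = 0.
Proof.
move=> ts st c0; rewrite -(Sadj_comb c ts st) c0 (bounded_op0 (Sab _))//.
by rewrite subr_ge0.
Qed.

(* The kernels of the [comb t] grow as [t] decreases; they are constant on an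
   interval to the left of any [tau], and there [comb t] is controlled by
   [comb t0]. *)
Let comb_control tau : tl < tau <= tr -> exists t0 C, [/\ tl < t0 < tau, 0 <= C &
  forall t c, t0 <= t < tau -> `|comb t c| <= C * `|comb t0 c|].
Proof.
move=> /andP[tltau tautr].
(* [t0] is a time of maximal rank in []tl, tau[]. At later times the relations are among those at
   [t0], and the rank is no larger, so the relations coincide. *)
pose P := fun k : nat => `[< exists2 t, tl < t < tau & \rank (gram t) = k >].
have exP : exists k, P k.
  exists (\rank (gram ((tl + tau) / 2))); apply/asboolP.
  by exists ((tl + tau) / 2) => //; apply/andP; split; lra.
have ubP k : P k -> (k <= p)%N by move=> /asboolP[t _ <-]; exact: rank_leq_row.
case: (ex_maxnP exP ubP) => k /asboolP[t0 /andP[tlt0 t0tau] rt0] kmax.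
have [B B0 hB] := comb_bound; have [B' B'0 hB'] := gen_bound.
pose G := gram t0; pose Gi := pinvmx G.
pose K := \sum_i \sum_j `|Gi i j|.
exists t0, (B * (K * B')); split; first by rewrite tlt0.
  by rewrite !mulr_ge0// sumr_ge0// => i _; rewrite sumr_ge0.
move=> t c /andP[t0t ttau]; have ttr : t <= tr by apply: le_trans (ltW ttau) _.
have ker_eq (u : 'rV[R]_p) : comb t0 u^T = 0 -> comb t u^T = 0.
  move=> /gram0 u0; apply/gram0.
  have sub : (kermx (gram t) <= kermx (gram t0))%MS.
    apply/rV_subP => v /sub_kermxP v0; apply/sub_kermxP/gram0.
    by apply: (comb_ker_left t0t ttr); apply/gram0.
  have rk : (\rank (kermx (gram t0)) <= \rank (kermx (gram t)))%N.
    rewrite !mxrank_ker leq_sub2l// rt0 kmax//.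
    by apply/asboolP; exists t => //; rewrite ttau (lt_le_trans tlt0).
  have eqk : (kermx (gram t0) <= kermx (gram t))%MS.
    by have [_ <-] := mxrank_leqif_sup sub; rewrite eqn_leq mxrankS.
  apply/sub_kermxP/(submx_trans _ eqk); exact/sub_kermxP.
(* [pi] differs from [c] by a relation, so [comb t] takes the same value on both; its entries are
   computed from the pairings of [comb t0 c] with the [gen i t0], hence are bounded by a multiple of
   the norm of [comb t0 c]. *)
pose pi := (c^T *m G *m Gi)^T : 'cV[R]_p.
have combE : comb t c = comb t pi.
  apply/eqP; rewrite -subr_eq0 -combB; apply/eqP.
  rewrite -[c - pi]trmxK; apply: ker_eq; apply/gram0.
  rewrite linearB/= mulmxBl /pi trmxK -/G mulmxKpV ?submxMl// subrr//.
rewrite combE -mulrA; apply: hB.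
  by rewrite ttr andbT (le_trans (ltW tlt0)).
move=> j; rewrite mxE mxE.
apply: le_trans (ler_norm_sum _ _ _) _; rewrite -mulrA mulr_suml.
apply: ler_sum => i _; rewrite normrM mulrC; apply: ler_pM => //.
  by rewrite (bigD1 j)//= lerDl sumr_ge0.
rewrite gram_comb trmxK; apply: le_trans (ip_cauchy ipH _ _) _.
by rewrite mulrC ler_wpM2r// hB'// ltW//= (le_trans t0t).
Qed.

Lemma backward_mild_unique t : tl < t <= tr -> V1 t = V2 t.
Proof.
move=> tt; apply/eqP; rewrite -subr_eq0; apply/eqP; rewrite -/(W t).
pose E := [set t | tl < t <= tr /\ forall s, t <= s <= tr -> W s = 0].
have Etr : E tr.
  split; first by rewrite tlr lexx.
  move=> s; rewrite -eq_le => /eqP <-; apply: W_zero_left; first by rewrite tlr lexx.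
  by move=> s' /andP[/lt_le_trans h /h]; rewrite ltxx.
have lbE : lbound E tl by move=> x [/andP[/ltW]].
have infE : has_inf E by split; [exists tr|exists tl].
pose tau := inf E.
have tautl : tl <= tau by apply: lb_le_inf => //; exists tr.
have tautr : tau <= tr by apply: ge_inf => //; exact: infE.2.
have right s : tau < s <= tr -> W s = 0.
  move=> /andP[taus str].
  have [|e [_ We] es] := @inf_adherent R E (s - tau) _ infE; first by rewrite subr_gt0.
  by apply: We; rewrite str andbT ltW//; move: es; rewrite -/tau addrC subrK.
have [tautl'|] := leP tau tl.
  by have /andP[h1 h2] := tt; apply: right; rewrite h2 (le_lt_trans tautl').
move=> tltau; exfalso.
have tautt : tl < tau <= tr by rewrite tltau.
have Wtau s : tau <= s <= tr -> W s = 0.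
  move=> /andP[]; rewrite le_eqVlt => /predU1P[<- _|taus st]; last by apply: right; rewrite taus.
  exact: (W_zero_left tautt).
have [t0 [C [/andP[tlt0 t0tau] C0 hC]]] := comb_control tautt.
have t0r : tl < t0 <= tr by rewrite tlt0 (le_trans (ltW t0tau)).
(* The equation at [t0] controls the integrand only after transport to [t0]; [hC] carries this
   control back to each [s] in [[t0, tau[], which bounds [W s] by a constant. *)
have [h [M [nM ih h0 hM]]] := W_dominated t0r.
have [CU CU0 hCU] := Uloc_bound; have [q q0 hq] := bounded_opP Qb.
have [Ms Ms0 hMs] := semigroup_bound (Sadj_semigroup ipH S_sg) (tr - tl).
have W0 : forall t (_ : unit), t0 <= t <= tr -> `|W t| <= 0.
  apply: (@volterra_zero _ unit (fun t _ => `|W t|) (fun=> 1) t0 tr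
     (Ms * CU * q) (lint (fun s => C * h s) t0 tr)) => //.
  - by rewrite !mulr_ge0.
  - by apply: lint_ge0 => s _; rewrite mulr_ge0.
  - move=> s _ /andP[t0s str]; rewrite mulr1.
    have ih' : itv_integrable t0 tr (fun s => C * h s) by exact: itv_integrableZ.
    have [staus|sltau] := leP tau s.
      rewrite Wtau ?staus// normr0; apply: lint_ge0 => u _; exact: mulr_ge0.
    rewrite (lint_split t0s str ih') -[leLHS]add0r; apply: lerD.
      by apply: lint_ge0 => u _; rewrite mulr_ge0.
    apply: W_bound nM _ _; first by rewrite str (lt_le_trans tlt0).
      exact: itv_integrableS ih'.
    move=> u /andP[su utr] Mu.
    apply: le_trans (hC s _ _) _; first by rewrite t0s.
    by rewrite ler_wpM2l// hM// utr (le_trans t0s).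
  move=> phi cphi phi0 hphi s _ /andP[t0s str]; rewrite mulr1.
  have ip_ : itv_integrable s tr phi by exact: continuous_itv_integrable.
  rewrite -lintZ//; apply: W_bound (null_measurable0 _) _ _.
  - by rewrite str (lt_le_trans tlt0).
  - exact: itv_integrableZ.
  move=> u /andP[su utr] _.
  have uab : tl <= u <= tr.
    by rewrite utr andbT (le_trans (ltW tlt0))// (le_trans t0s).
  rewrite -(Sadj_comb (coef u) su utr) -!mulrA.
  apply: le_trans (hMs _ _ _) _.
    by rewrite subr_ge0 su lerB// (le_trans (ltW tlt0)).
  rewrite ler_wpM2l//; apply: le_trans (hCU u (Q (W u)) uab) _.
  rewrite ler_wpM2l//; apply: le_trans (hq _) _; rewrite ler_wpM2l//.
  have := hphi u Datatypes.tt; rewrite mulr1; apply.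
  by rewrite utr (le_trans t0s).
have Et0 : E t0.
  by split=> // s st; apply/eqP; rewrite -normr_le0; exact: (W0 s Datatypes.tt).
have : tau <= t0 by apply: ge_inf => //; exact: infE.2.
by rewrite leNgt t0tau.
Qed.

End BackwardUniqueness.

End Riccati.
End Interval.

(** * Integrals in the definitions of the model *)

Section ConcreteIntegrals.
Context {R : realType} {H : completeNormedModType R}.
Variables (ip : H -> H -> R) (ipH : inner ip).
Variables (S : R -> H -> H) (S_sg : C0_semigroup S).
Variables (Q : H -> H) (Qb : bounded_op Q).
Local Notation Sa := (Sadj ip S).

Lemma lint_reflect (phi : R -> R) t c : continuous phi -> t <= c ->
  lint (fun u => phi (c - u)) 0 (c - t) = lint phi t c.
Proof.
move=> cphi tc; pose F u := - lint phi (t - 1) (c - u).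
have dF u : 0 <= u <= c - t -> is_derive u (1 : R) F (phi (c - u)).
  move=> /andP[u0 ut].
  have d1 : is_derive (c - u) (1 : R) (lint phi (t - 1)) (phi (c - u)).
    by apply: lint_derive => //; lra.
  have d2 : is_derive u (1 : R) (fun u => c - u) (-1).
    by apply: is_derive_eq; ring.
  have d3 := @is_derive1_comp R (lint phi (t - 1)) (fun u => c - u) u _ _ d1 d2.
  have := is_deriveN d3; rewrite mulrN1 opprK; exact.
have -> : lint (fun u => phi (c - u)) 0 (c - t) = F (c - t) - F 0.
  apply: (FTC2 (F := F)) => //; first by rewrite subr_ge0.
  move=> u; have k : c - v @[v --> u] --> c - u.
    by apply: cvgB; [exact: cvg_cst|exact: cvg_id].
  by have := cvg_comp _ _ k (cphi (c - u)); apply.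
rewrite /F subr0 opprK opprB addrC subrKC.
have h1 : t - 1 <= t by lra.
rewrite (lint_split h1 tc (continuous_itv_integrable _ _ cphi)); ring.
Qed.

Lemma semigroup_joint_continuous (T : R -> H -> H) (v : R -> H) : C0_semigroup T ->
  continuous v -> continuous (fun u : R => T (Num.max 0 u) (v u)).
Proof.
move=> T_sg cv u0; have [M M0 hM] := semigroup_bound T_sg (`|u0| + 1).
have Tb t : 0 <= t -> bounded_op (T t) by case: T_sg => + _ _ _; exact.
have m0 (u : R) : 0 <= Num.max 0 u by rewrite le_max lexx.
apply: (squeeze_norm (g := fun u => M * `|v u - v u0| +
   `|T (Num.max 0 u) (v u0) - T (Num.max 0 u0) (v u0)|)).
  near=> u.
  have -> : T (Num.max 0 u) (v u) - T (Num.max 0 u0) (v u0) =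
     T (Num.max 0 u) (v u - v u0) + (T (Num.max 0 u) (v u0) - T (Num.max 0 u0) (v u0)).
    by rewrite (bounded_opB _ _ (Tb _ (m0 u))) subrKA.
  apply: le_trans (ler_normD _ _) _; rewrite lerD2r hM// m0/=.
  have : `|u - u0| < 1 by near: u; exists 1 => //= u; rewrite /ball_/= distrC.
  rewrite ge_max addr_ge0//= => h.
  have := ler_norm (u - u0); have := ler_norm u0; lra.
rewrite -[X in _ --> X](addr0 0) -[X in _ --> X + _](mulr0 M); apply: cvgD.
  by apply: cvgM; [exact: cvg_cst|apply: cvg_dist0; exact: cv].
by apply: cvg_dist0; exact: semigroup_continuous.
Unshelve. all: by end_near. Qed.

Let max_bound (T : R -> H -> H) : C0_semigroup T -> forall r0, exists2 M, 0 <= M &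
  forall r x, `|r| <= r0 -> `|T (Num.max 0 r) x| <= M * `|x|.
Proof.
move=> T_sg r0; have [M M0 hM] := semigroup_bound T_sg (`|r0|); exists M => // r x rr.
apply: hM; rewrite le_max lexx ge_max normr_ge0/=.
exact: le_trans (ler_norm r) (le_trans rr (ler_norm _)).
Qed.

Let m0 (u : R) : 0 <= Num.max 0 u. Proof. by rewrite le_max lexx. Qed.
Let Sb t : 0 <= t -> bounded_op (S t). Proof. by case: S_sg => + _ _ _; exact. Qed.
Let Sab t : 0 <= t -> bounded_op (Sa t). Proof. exact: Sadj_bounded. Qed.

(** Moving [S u] across the pairing leaves [Q] between two vectors of the form [Sadj u b]; replacing
    [u] by [tr - u] turns these into values of [gen]. *)
Lemma ip_Qint tr t p (b : 'I_p -> H) i j : t <= tr ->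
  ip (Qint ip S Q (tr - t) (b j)) (b i) = lint (fun u => covm ip S Q tr b u i j) t tr.
Proof.
move=> ttr; pose K (u : R) x := S (Num.max 0 u) (Q (Sa (Num.max 0 u) x)).
have [q q0 hq] := bounded_opP Qb.
have Kbound r0 : exists M, forall r x, `|r| <= r0 -> `|K r x| <= M * `|x|.
  have [M1 M10 hM1] := max_bound S_sg r0.
  have [M2 M20 hM2] := max_bound (Sadj_semigroup ipH S_sg) r0.
  exists (M1 * (q * M2)) => r x rr; apply: le_trans (hM1 _ _ rr) _.
  rewrite -mulrA ler_wpM2l//; apply: le_trans (hq _) _.
  by rewrite -mulrA ler_wpM2l// hM2.
have Klin r : linear (K r).
  by move=> c x y; rewrite /K (Sab (m0 r)).1 Qb.1 (Sb (m0 r)).1.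
have mK : strongly_measurable 0 (tr - t) (fun u => K u (b j)).
  apply: (strongly_measurable_comp (c := id) (K := K) _ _ _ Kbound
    (strongly_measurable_cst _ _ _)).
  - exact: measurable_id.
  - move=> r; have [M hM] := Kbound `|r|.
    by apply: (linear_bounded_op (C := M) (Klin r)) => x; exact: hM.
  - move=> x; apply: semigroup_joint_continuous => // u.
    have h := @semigroup_continuous R H _ (Sadj_semigroup ipH S_sg) x u.
    by have := cvg_comp _ _ h (Qb.2 _); apply.
have [M hM] := Kbound `|tr - t|.
have [||v Bv hv] := bochner_itv ipH mK (h := fun=> M * `|b j|).
- by apply: continuous_itv_integrable; exact: cst_continuous.
- move=> u /andP[u0 ut]; apply: hM.
  by rewrite !ger0_norm ?subr_ge0.
have Bv' : is_bochner_itv 0 (tr - t) (fun u => S u (Q (Sa u (b j)))) v.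
  apply: bochner_congr (null_measurable0 _) _ Bv => u.
  by rewrite /= in_itv/= => /andP[u0 _] _; rewrite /K max_r.
rewrite /Qint (bint_eq ipH Bv'); have [_ ->] := hv (b i).
have cc : continuous (fun u => covm ip S Q tr b u i j) by exact: covm_continuous.
rewrite -(lint_reflect cc ttr).
apply: eq_lint => u /andP[u0 ut].
by rewrite /K mxE /gen subKr !max_r// (SadjP ipH S_sg).
Qed.

Lemma ip_drift tr t p (b : 'I_p -> H) i a (h : R -> R) : t <= tr ->
  strongly_measurable t tr a -> itv_integrable t tr h ->
  (forall s, t <= s <= tr -> `|a s| <= h s) ->
  ip (bint t tr (fun s => S (tr - s) (a s))) (b i) =
  lint (fun u => ip (a u) (gen ip S tr b i u)) t tr.
Proof.
move=> ttr ma ih ah; pose K (u : R) x := S (Num.max 0 u) x.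
have Kbound r0 : exists M, forall r x, `|r| <= r0 -> `|K r x| <= M * `|x|.
  by have [M _ hM] := max_bound S_sg r0; exists M.
have mK : strongly_measurable t tr (fun s => K (tr - s) (a s)).
  apply: (strongly_measurable_comp (c := fun s => tr - s) (K := K) _ _ _ Kbound ma).
  - by apply: measurable_funB.
  - by move=> r; exact: Sb.
  - by move=> x; exact: semigroup_continuous.
have [M hM] := Kbound `|tr - t|.
have [||v Bv hv] := bochner_itv ipH mK (h := fun s => `|M| * h s).
- exact: itv_integrableZ.
- move=> u /andP[u0 ut]; apply: le_trans (hM _ _ _) _.
    by rewrite !ger0_norm ?subr_ge0// lerD2l lerN2.
  apply: le_trans (ler_wpM2r (normr_ge0 _) (ler_norm M)) _.
  by rewrite ler_wpM2l// ah// u0.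
have Bv' : is_bochner_itv t tr (fun s => S (tr - s) (a s)) v.
  apply: bochner_congr (null_measurable0 _) _ Bv => u.
  by rewrite /= in_itv/= => /andP[_ ut] _; rewrite /K max_r// subr_ge0.
rewrite (bint_eq ipH Bv'); have [_ ->] := hv (b i).
apply: eq_lint => u /andP[tu ut].
by rewrite /K /gen max_r ?subr_ge0// (SadjP ipH S_sg) ?subr_ge0.
Qed.

(* [g] is [f] with value 0 on [N], so that simple functions converge to it
   everywhere. *)
Lemma bochner_representative a b (f : R -> H) : bochner_exists a b f ->
  exists (g : R -> H) (h : R -> R) N, [/\ null_measurable (@lebesgue_measure R) N,
    forall x, ~ N x -> f x = g x, strongly_measurable a b g,
    itv_integrable a b h & forall x, a <= x <= b -> `|g x| <= h x].
Proof.
move=> [v Bf]; have [h [N1 [nN1 ih h0 fh]]] := bochner_itv_norm ipH Bf.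
have [s [si [N0 [mN0 N00 sub]] _ _]] := Bf.
pose N := N0 `|` N1; have nN : null_measurable (@lebesgue_measure R) N.
  exact: null_measurableU.
exists (fun x => \1_(~` N) x *: f x), h, N; split=> //.
- by move=> x Nx; rewrite indicE mem_set// scale1r.
- exists (fun n => [seq (p.1 `&` ~` N, p.2) | p <- s n]); split.
    move=> n; apply: simple_integrable_itv => _ /mapP[p /si[mp _] ->]/=.
    by apply: measurableI => //; apply: measurableC; exact: nN.1.
  move=> x xab.
  have -> : (fun n => simple_fun [seq (p.1 `&` ~` N, p.2) | p <- s n] x) =
      (fun n => \1_(~` N) x *: simple_fun (s n) x).
    apply/funext => n; rewrite /simple_fun big_map scaler_sumr.
    by apply: eq_bigr => p _ /=; rewrite indicI scalerA mulrC.
  have [Nx|Nx] := pselect (N x).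
    rewrite indicE memNset => [|]; last by move/(_ Nx).
    by rewrite scale0r; under eq_fun do rewrite scale0r; exact: cvg_cst.
  apply: cvgZ; first exact: cvg_cst.
  apply: contrapT => hx; apply/Nx; left; apply: sub => /= h'; exact/hx/h'.
- move=> x xab; rewrite indicE; have [/set_mem Nx|_] := boolP (x \in ~` N).
    by rewrite scale1r fh// => N1x; apply: Nx; right.
  by rewrite scale0r normr0.
Qed.

(** Stated as an equality of predicates so that [bint], which is a [get], takes the same value for
    both functions without any proof of existence. *)
Lemma is_bochner_itv_congr a b (f g : R -> H) N :
  null_measurable (@lebesgue_measure R) N ->
  (forall x, a <= x <= b -> ~ N x -> f x = g x) ->
  is_bochner_itv a b f = is_bochner_itv a b g.
Proof.
move=> nN fg; apply/funext => v; apply/propext; split.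
  by apply: (bochner_congr nN).
by apply: (bochner_congr nN) => x xab Nx; rewrite fg.
Qed.

Lemma riccati_mild_congr tl tr UT UT' U U' : (forall x, UT x = UT' x) ->
  (forall s x, tl < s <= tr -> U s x = U' s x) ->
  riccati_mild ip S Q tl tr UT U -> riccati_mild ip S Q tl tr UT' U'.
Proof.
move=> UUT UU [b1 l1 e1].
have UU' s : tl < s <= tr -> U s = U' s by move=> st; apply/funext => x; exact: UU.
split.
- by move=> t tt; rewrite -UU'//; exact: b1.
- move=> t tt; have [C hC] := l1 t tt; exists C => s x /andP[ts st].
  by rewrite -UU ?hC ?ts// st andbT; have /andP[/lt_le_trans -> ] := tt.
move=> t x tt; have := e1 t x tt => /=.
set g := (fun s => _); set g' := (fun s => _).
have -> : bochner_exists t tr g = bochner_exists t tr g'.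
  rewrite /bochner_exists (@is_bochner_itv_congr _ _ g g' _ (null_measurable0 _))//.
  move=> s /andP[ts st] _; rewrite /g /g' UU' // st andbT.
  by have /andP[/lt_le_trans -> ] := tt.
have -> : bint t tr g = bint t tr g'.
  rewrite /bint (@is_bochner_itv_congr _ _ g g' _ (null_measurable0 _))//.
  move=> s /andP[ts st] _; rewrite /g /g' UU' // st andbT.
  by have /andP[/lt_le_trans -> ] := tt.
by rewrite UU// UUT.
Qed.

Lemma backward_mild_congr tl tr U U' a a' VT VT' V V' N :
  null_measurable (@lebesgue_measure R) N -> (forall s, ~ N s -> a s = a' s) ->
  VT = VT' -> (forall s x, tl < s <= tr -> U s x = U' s x) ->
  (forall s, tl < s <= tr -> V s = V' s) ->
  backward_mild ip S Q tl tr U a VT V -> backward_mild ip S Q tl tr U' a' VT' V'.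
Proof.
move=> nN aa <- UU VV e1 t tt; have := e1 t tt => /=.
set g := (fun s => _); set g' := (fun s => _).
have gg s : t <= s <= tr -> ~ N s -> g s = g' s.
  move=> /andP[ts st] Ns; have st' : tl < s <= tr.
    by rewrite st andbT; have /andP[/lt_le_trans -> ] := tt.
  by rewrite /g /g' !UU// VV// aa.
have -> : bochner_exists t tr g = bochner_exists t tr g'.
  by rewrite /bochner_exists (is_bochner_itv_congr nN gg).
have -> : bint t tr g = bint t tr g' by rewrite /bint (is_bochner_itv_congr nN gg).
by rewrite VV.
Qed.

End ConcreteIntegrals.

(** * The equations on all intervals *)

Section Gluing.
Context {R : realType} {H : completeNormedModType R}.
Variables (ip : H -> H -> R) (ipH : inner ip).
Variables (S : R -> H -> H) (S_sg : C0_semigroup S).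
Variables (Q : H -> H) (Qb : bounded_op Q).
Hypothesis Qsym : forall x y, ip (Q x) y = ip x (Q y).
Hypothesis Qpos : forall x, 0 <= ip (Q x) x.
Variables (n : nat) (tm : nat -> R) (tm0 : tm 0%N = 0).
Hypothesis tm_lt : forall i, (i < n)%N -> tm i < tm i.+1.
Variables (m : nat) (L : H -> 'cV[R]_m) (L_bounded : bounded_op L).
Variables (Sigma : 'M[R]_m) (Sigma_pos : posdef Sigma).

Let Sb t : 0 <= t -> bounded_op (S t). Proof. by case: S_sg => + _ _ _; exact. Qed.
Let S0 x : S 0 x = x. Proof. by case: S_sg. Qed.
Let SD s t x : 0 <= s -> 0 <= t -> S (s + t) x = S s (S t x).
Proof. by case: S_sg => _ _ + _; exact. Qed.

(* ]ts k, te k] is the interval followed by [k] observation times. *)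
Local Notation te k := (tm (n - k)%N).
Local Notation ts k := (tm (n - k.+1)%N).
Local Notation Lst := (Lstack S L n tm).
Local Notation Lad k := (@Lstack_adj R H ip S m L n tm k).
Local Notation RM := (Rmx ip S Q L Sigma n tm).

Definition stack_gen (k : nat) (j : 'I_(stacked_dim m k)) : H :=
  Lad k (te k) (delta_mx j ord0).

Local Notation bk := stack_gen.

Lemma tm_le i j : (i <= j)%N -> (j <= n)%N -> tm i <= tm j.
Proof.
elim: j => [|j ih]; first by rewrite leqn0 => /eqP ->.
rewrite leq_eqVlt ltnS => /predU1P[->//|ij] jn.
by apply: le_trans (ltW (tm_lt jn)); apply: ih => //; exact: ltnW.
Qed.

Lemma te_le j k : (j <= k)%N -> te k <= te j.
Proof. by move=> jk; apply: tm_le; [exact: leq_sub2l|exact: leq_subr]. Qed.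

Lemma ts_lt_te k : (k < n)%N -> ts k < te k.
Proof. by move=> kn; rewrite -[X in _ < tm X]subnSK// tm_lt// subnS prednK ?subn_gt0// leq_subr. Qed.

Lemma ts_ge0 k : 0 <= ts k.
Proof. by rewrite -tm0 tm_le// leq_subr. Qed.

Lemma te_le_tmn k : te k <= tm n.
Proof. by apply: tm_le => //; exact: leq_subr. Qed.

Lemma Lstack_semigroup k t u x : t <= u -> u <= te k ->
  Lst k t x = Lst k u (S (u - t) x).
Proof.
move=> tu; elim: k => [|k ih] ute /=.
  rewrite subn0 in ute; rewrite -SD ?subr_ge0//; congr (L (S _ _)).
  by rewrite subrKA.
rewrite -ih; last by apply: le_trans ute _; exact: te_le.
by rewrite -SD ?subr_ge0// subrKA.
Qed.

Lemma norm_col_mx p q (u : 'cV[R]_p) (v : 'cV[R]_q) :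
  `|col_mx u v| <= `|u| + `|v|.
Proof.
rewrite [leLHS]mx_normrE; apply: bigmax_le => [|[i j] _ /=]; first exact: addr_ge0.
rewrite mxE; case: splitP => i' _.
  by apply: le_trans (entry_le_norm _ _ _) _; rewrite lerDl.
by apply: le_trans (entry_le_norm _ _ _) _; rewrite lerDr.
Qed.

Lemma Lstack_bounded k t : t <= te k -> bounded_op (Lst k t).
Proof.
have Lb s : 0 <= s -> bounded_op (fun x => L (S s x)).
  move=> s0; have [C C0 hC] := bounded_opP L_bounded; have [D D0 hD] := bounded_opP (Sb s0).
  apply: (linear_bounded_op (C := C * D)) => [c x y|x].
    by rewrite (Sb s0).1 L_bounded.1.
  by apply: le_trans (hC _) _; rewrite -mulrA ler_wpM2l.
elim: k => [|k ih] tte /=.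
  by apply: Lb; rewrite subn0 in tte; rewrite subr_ge0.
have b1 : bounded_op (fun x => L (S (tm (n - k.+1)%N - t) x)) by apply: Lb; rewrite subr_ge0.
have b2 : bounded_op (Lst k t) by apply: ih; apply: le_trans tte (te_le _).
have [C C0 hC] := bounded_opP b1; have [D D0 hD] := bounded_opP b2.
apply: (linear_bounded_op (C := C + D)) => [c x y|x].
  by rewrite b1.1 b2.1 -add_col_mx -scale_col_mx.
by apply: le_trans (norm_col_mx _ _) _; rewrite mulrDl lerD.
Qed.

Lemma Lstack_adjP k t x z : t <= te k -> euclid (Lst k t x) z = ip x (Lad k t z).
Proof.
move=> tte; apply: (adjointP ipH).
- exact: euclid_linear.
- exact: euclid_bounded.
- exact: Lstack_bounded.
Qed.

Lemma LadjP x z : euclid (L x) z = ip x (Ladj ip L z).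
Proof.
by apply: (adjointP ipH) => //; [exact: euclid_linear|exact: euclid_bounded].
Qed.

Lemma Lstack_ev k t x : t <= te k -> Lst k t x = ev ip S (te k) (bk (k := k)) t x.
Proof.
move=> tte; apply/colP => j; rewrite mxE /gen max_r ?subr_ge0// -(SadjP ipH S_sg) ?subr_ge0//.
by rewrite -Lstack_adjP// -Lstack_semigroup// euclidC euclid_delta.
Qed.

Lemma Lstack_adj_comb k t z : t <= te k -> Lad k t z = comb ip S (te k) (bk (k := k)) t z.
Proof.
move=> tte; apply: (ip_inj ipH) => x; rewrite !(ipC ipH _ x).
by rewrite -Lstack_adjP// Lstack_ev// (ip_comb ipH).
Qed.

Lemma Lstack0_end x : Lst 0 (tm n) x = L x.
Proof. by rewrite /= subrr S0. Qed.

Lemma LstackS_end k x : Lst k.+1 (ts k) x = col_mx (L x) (Lst k (ts k) x).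
Proof. by rewrite /= subrr S0. Qed.

Lemma Lstack_adj0_end z : Lad 0 (tm n) z = Ladj ip L z.
Proof.
apply: (ip_inj ipH) => x; rewrite !(ipC ipH _ x) -LadjP -Lstack_adjP ?subn0//.
by rewrite Lstack0_end.
Qed.

Lemma Lstack_adjS_end k u v :
  Lad k.+1 (ts k) (col_mx u v) = Ladj ip L u + Lad k (ts k) v.
Proof.
apply: (ip_inj ipH) => x; rewrite !(ipC ipH _ x) (ipDr ipH) -LadjP -!Lstack_adjP//.
  by rewrite LstackS_end euclid_col_mx.
exact: te_le.
Qed.

(** The value of [Rmx] at the right end [te k], where the integral term vanishes; it is the [R0] of
    the local analysis. *)
Definition Rend (k : nat) : 'M[R]_(stacked_dim m k) :=
  match k with
  | 0%N => Sigma
  | k'.+1 => block_mx Sigma 0 0 (lim (RM k' s @[s --> (ts k')^'+]))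
  end.

Lemma Rmx_entry k t i j : t <= te k -> RM k t i j = Rend k i j +
  lint (fun u => covm ip S Q (te k) (bk (k := k)) u i j) t (te k).
Proof.
move=> tte; rewrite -(ip_Qint ipH S_sg Qb _ _ _ tte).
have Lo x : ip x (bk i) = Lst k (te k) x i ord0.
  by rewrite /stack_gen -Lstack_adjP// euclidC euclid_delta.
rewrite Lo /stack_gen; case: k i j tte Lo => [|k] i j tte _.
  rewrite /= mxE mxE; rewrite subn0 in tte *; congr (_ + _).
  by rewrite subrr S0 Lstack_adj0_end.
by rewrite /= mxE; congr (_ + _); rewrite mxE.
Qed.

Let Rmx_entry' k s : ts k <= s <= te k -> forall i j, RM k s i j = Rend k i j +
  lint (fun u => covm ip S Q (te k) (bk (k := k)) u i j) s (te k).
Proof. by move=> /andP[_ st] i j; exact: Rmx_entry. Qed.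

Lemma Rmx_right_cvg k : (k < n)%N -> RM k s @[s --> (ts k)^'+] --> RM k (ts k).
Proof.
move=> kn; have lt := ts_lt_te kn; apply: cvg_mx => i j.
have := primitive_within (ltW lt) (RR_primitive ipH S_sg Qb (@Rmx_entry' k) i j).
by move=> /(continuous_within_itvP _ lt)[].
Qed.

(** Shows that the [lim] inside the recursive definition is a genuine limit, given by the formula of
    interval [k] at its left end. *)
Lemma Rmx_right_lim k : (k < n)%N -> lim (RM k s @[s --> (ts k)^'+]) = RM k (ts k).
Proof. by move=> kn; apply: cvg_lim; [exact: norm_hausdorff|exact: Rmx_right_cvg]. Qed.

(** [RR_posdef] carries positive definiteness from the right end of an interval to its left end, and
    the block with [Sigma] carries it to the right end of the preceding interval. *)
Lemma Rend_posdef k : (k < n)%N -> posdef (Rend k).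
Proof.
elim: k => [//|k ih] kn; have kn' := ltnW kn.
rewrite /= Rmx_right_lim//; apply: posdef_block => //.
apply: (RR_posdef ipH S_sg Qb Qsym Qpos (ih kn') (@Rmx_entry' k)).
by rewrite lexx ltW// ts_lt_te.
Qed.

Lemma Rmx_posdef k t : (k < n)%N -> ts k <= t <= te k -> posdef (RM k t).
Proof.
by move=> kn; apply: (RR_posdef ipH S_sg Qb Qsym Qpos (Rend_posdef kn) (@Rmx_entry' k)).
Qed.

Lemma Rmx_end k : RM k (te k) = Rend k.
Proof. by apply/matrixP => i j; rewrite Rmx_entry// lint_itv1// addr0. Qed.

Lemma obs_index_itv k t : (k < n)%N -> ts k < t <= te k -> (n - obs_index n tm t)%N = k.
Proof.
move=> kn /andP[tst tte].
suff -> : obs_index n tm t = (n - k)%N by rewrite subKn// ltnW.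
rewrite /obs_index (@big_cat_nat _ _ _ (n - k))//=; last by rewrite leqW// leq_subr.
rewrite big_nat (eq_bigr (fun=> 1%N)); last first.
  move=> j /andP[_ jk]; rewrite (_ : tm j < t)//.
  apply: le_lt_trans tst; apply: tm_le; last exact: leq_subr.
  by rewrite subnS -ltnS prednK ?subn_gt0.
rewrite -big_nat sum_nat_const_nat subn0 muln1 big_nat big1 ?addn0// => j /andP[kj jn].
rewrite ltNge (le_trans tte)//; exact: tm_le.
Qed.

Local Notation U := (Ufun ip S Q L Sigma n tm).
Local Notation Uk k := (Uloc ip S (te k) (bk (k := k)) (RM k)).

Lemma Ufun_loc k t x : (k < n)%N -> ts k < t <= te k -> U t x = Uk k t x.
Proof.
move=> kn tt; have /andP[tst tte] := tt.
rewrite /Ufun gt_eqF ?(le_lt_trans (ts_ge0 k))// /Upos (obs_index_itv kn tt).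
by rewrite Lstack_adj_comb// Lstack_ev.
Qed.

Lemma near_ts k : (k < n)%N -> \forall s \near (ts k)^'+, ts k < s <= te k.
Proof.
move=> kn; have lt := ts_lt_te kn; near=> s; apply/andP; split.
  by near: s; exact: nbhs_right_gt.
by near: s; exact: nbhs_right_le.
Unshelve. all: by end_near. Qed.

Lemma Uk_right_limit k : (k < n)%N -> op_right_limit U (ts k) (Uk k (ts k)).
Proof.
move=> kn.
have [b hU] := Uloc_right_limit ipH S_sg Qb Qsym Qpos (ts_lt_te kn) (Rend_posdef kn)
  (@Rmx_entry' k).
split=> // e e0; have := hU e e0; apply: filterS2 (near_ts kn) => s st h x.
by rewrite (Ufun_loc _ kn).
Qed.

Lemma op_right_limitE F t W : @op_right_limit R H F t W -> op_right_lim F t = W.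
Proof.
move=> [_ hF]; apply/funext => x; apply: cvg_lim; first exact: norm_hausdorff.
apply/cvgrPdistC_le => e e0.
have e1 : 0 < e / (`|x| + 1) by rewrite divr_gt0// ltr_wpDl.
have := hF _ e1; apply: filterS => s /(_ x) h; apply: le_trans h _.
rewrite mulrAC ler_pdivrMr; last by rewrite ltr_wpDl.
by apply: ler_wpM2l; [exact: ltW|rewrite lerDl].
Qed.

(** Origin of the jump: at an observation time [Rend] is block diagonal, so its inverse separates
    the new observation, which contributes the term in [Sigma], from the later ones, which
    contribute the right limit of [U]. *)
Lemma Uk_end k x : (k < n)%N ->
  Uk k (te k) x = Uterm ip S Q L Sigma n tm (n - k) x.
Proof.
move=> kn; rewrite /Uloc -Lstack_adj_comb// -Lstack_ev// Rmx_end /Uterm.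
(* For [k = 0] the index is [n] and [Uterm] adds 0; otherwise [n - k < n] and it adds the right
   limit. *)
case: k kn => [|k] kn.
  by rewrite subn0 ltnn addr0 Lstack_adj0_end Lstack0_end.
rewrite ltn_subrL ltn0Sn (leq_ltn_trans _ kn)//=.
have kn' := ltnW kn.
rewrite (op_right_limitE (Uk_right_limit kn')) Rmx_right_lim//.
have le := ltW (ts_lt_te kn').
rewrite invmx_block; last 2 first.
- exact: posdef_unit.
- by apply: posdef_unit; apply: Rmx_posdef => //; rewrite lexx.
rewrite subrr S0 mul_block_col !mul0mx addr0 add0r Lstack_adjS_end.
by rewrite /Uloc -Lstack_adj_comb// -Lstack_ev.
Qed.

Lemma riccati_Ufun k : (k < n)%N ->
  unique_riccati_mild ip S Q (ts k) (te k) (Uterm ip S Q L Sigma n tm (n - k)) U.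
Proof.
move=> kn.
have mild : riccati_mild ip S Q (ts k) (te k) (Uterm ip S Q L Sigma n tm (n - k)) U.
  apply: riccati_mild_congr (riccati_mild_Uloc ipH S_sg Qb Qsym Qpos (ts_lt_te kn)
    (Rend_posdef kn) (@Rmx_entry' k)) => [x|s x st]; first by rewrite Uk_end.
  by rewrite (Ufun_loc _ kn).
split=> // U' mild' t x tt.
exact: (riccati_mild_unique ipH S_sg Qb mild' mild).
Qed.

(** * The functions [alpha] and [V] for one trajectory *)

Section Drift.
Variables (a : R -> H) (h : R -> R) (y : nat -> 'cV[R]_m).
Hypothesis am : strongly_measurable 0 (tm n) a.
Hypothesis ih : itv_integrable 0 (tm n) h.
Hypothesis ah : forall s, 0 <= s <= tm n -> `|a s| <= h s.

Local Notation al k := (alpha S L n tm a k).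
Local Notation yp k := (yplus n y k).

Definition alpha_end (k : nat) : 'cV[R]_(stacked_dim m k) :=
  match k with
  | 0%N => 0
  | k'.+1 => col_mx 0 (lim (al k' s @[s --> (ts k')^'+]))
  end.

Let am_loc t k : 0 <= t -> strongly_measurable t (te k) a.
Proof. by move=> t0; apply: strongly_measurableS am => //; exact: te_le_tmn. Qed.

Let ih_loc t k : 0 <= t -> itv_integrable t (te k) h.
Proof. by move=> t0; apply: itv_integrableS ih => //; exact: te_le_tmn. Qed.

Let ah_loc t k s : 0 <= t -> t <= s <= te k -> `|a s| <= h s.
Proof.
move=> t0 /andP[ts st]; apply: ah; rewrite (le_trans t0)//=.
by apply: le_trans st _; exact: te_le_tmn.
Qed.

Lemma alpha_entry k t i : 0 <= t <= te k -> al k t i ord0 = alpha_end k i ord0 +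
  lint (fun u => ip (a u) (gen ip S (te k) (bk (k := k)) i u)) t (te k).
Proof.
move=> /andP[t0 tte].
rewrite -(ip_drift ipH S_sg _ _ tte (@am_loc t k t0) (@ih_loc t k t0) (fun s => @ah_loc t k s t0)).
have Lo x : ip x (bk i) = Lst k (te k) x i ord0.
  by rewrite /stack_gen -Lstack_adjP// euclidC euclid_delta.
rewrite Lo; case: k i tte Lo => [|k] i tte _; last by rewrite [LHS]mxE.
by rewrite [alpha_end _]/= mxE add0r /= subn0 subrr S0.
Qed.

Let alpha_entry' k s : ts k <= s <= te k -> forall i,
  al k s i ord0 = alpha_end k i ord0 +
  lint (fun u => ip (a u) (gen ip S (te k) (bk (k := k)) i u)) s (te k).
Proof.
by move=> /andP[tss st] i; apply: alpha_entry; rewrite st (le_trans (ts_ge0 k)).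
Qed.

Let beta_prim k := beta_primitive ipH S_sg (@am_loc _ k (ts_ge0 k))
  (@ih_loc _ k (ts_ge0 k)) (fun s => @ah_loc _ k s (ts_ge0 k)) (yp k) (@alpha_entry' k).

Lemma alpha_right_lim k : (k < n)%N -> lim (al k s @[s --> (ts k)^'+]) = al k (ts k).
Proof.
move=> kn; have lt := ts_lt_te kn; apply: cvg_lim; first exact: norm_hausdorff.
(* Absolute continuity is available for [y - alpha], from which [alpha] is recovered. *)
have -> : al k = (fun s => yp k - (yp k - al k s)).
  by apply/funext => s; rewrite subKr.
apply: cvgB; first exact: cvg_cst.
apply: cvg_mx => i j; rewrite (ord1 j).
have := primitive_within (ltW lt) (@beta_prim k i).
by move=> /(continuous_within_itvP _ lt)[].
Qed.

Lemma alpha_at_end k : al k (te k) = alpha_end k.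
Proof.
apply/colP => i; rewrite alpha_entry ?lint_itv1 ?addr0// lexx andbT.
by rewrite -tm0; apply: tm_le => //; exact: leq_subr.
Qed.

Local Notation V := (Vfun ip S Q L Sigma n tm a y).
Local Notation VT := (Vterm ip S Q L Sigma n tm a y).
Local Notation Vk k := (Vloc ip S (te k) (bk (k := k)) (RM k) (yp k) (al k)).

Lemma Vfun_loc k t : (k < n)%N -> ts k < t <= te k -> V t = Vk k t.
Proof.
move=> kn tt; have /andP[tst tte] := tt.
rewrite /Vfun gt_eqF ?(le_lt_trans (ts_ge0 k))// /Vpos (obs_index_itv kn tt).
by rewrite Lstack_adj_comb.
Qed.

Lemma Vk_right_cvg k : (k < n)%N -> V s @[s --> (ts k)^'+] --> Vk k (ts k).
Proof.
move=> kn.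
have hV := Vloc_right_cvg ipH S_sg Qb Qsym Qpos (ts_lt_te kn) (Rend_posdef kn)
  (@Rmx_entry' k) (@am_loc _ k (ts_ge0 k)) (@ih_loc _ k (ts_ge0 k))
  (fun s => @ah_loc _ k s (ts_ge0 k)) (@alpha_entry' k).
apply: (cvg_near_eq _ (hV (yp k))); apply: filterS (near_ts kn) => s st.
by rewrite (Vfun_loc kn).
Qed.

Lemma Vk_end k : (k < n)%N -> Vk k (te k) = VT (n - k).
Proof.
move=> kn; rewrite /Vloc -Lstack_adj_comb// Rmx_end alpha_at_end /Vterm.
case: k kn => [|k] kn; first by rewrite subn0 ltnn addr0 Lstack_adj0_end /= subr0.
rewrite ltn_subrL ltn0Sn (leq_ltn_trans _ kn)//=.
have kn' := ltnW kn.
rewrite (cvg_lim _ (Vk_right_cvg kn')); last exact: norm_hausdorff.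
rewrite Rmx_right_lim// alpha_right_lim//.
have le := ltW (ts_lt_te kn').
rewrite invmx_block; last 2 first.
- exact: posdef_unit.
- by apply: posdef_unit; apply: Rmx_posdef => //; rewrite lexx.
rewrite opp_col_mx add_col_mx subr0 mul_block_col !mul0mx addr0 add0r.
by rewrite Lstack_adjS_end /Vloc -Lstack_adj_comb.
Qed.

Lemma backward_Vfun k : (k < n)%N ->
  unique_backward_mild ip S Q (ts k) (te k) U a (VT (n - k)) V.
Proof.
move=> kn; have UE s x : ts k < s <= te k -> Uk k s x = U s x.
  by move=> st; rewrite (Ufun_loc _ kn).
have mild : backward_mild ip S Q (ts k) (te k) U a (VT (n - k)) V.
  rewrite -Vk_end//.
  have h0 := backward_mild_Vloc ipH S_sg Qb Qsym Qpos (ts_lt_te kn) (Rend_posdef kn)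
    (@Rmx_entry' k) (@am_loc _ k (ts_ge0 k)) (@ih_loc _ k (ts_ge0 k))
    (fun s => @ah_loc _ k s (ts_ge0 k)) (yp k) (@alpha_entry' k).
  apply: backward_mild_congr (null_measurable0 _) _ _ UE _ h0 => //.
  by move=> s st; rewrite (Vfun_loc kn).
split=> // V' mild' t tt.
(* Local uniqueness is stated with the local formula [Uk k], which agrees with [U] on the half-open
   interval. *)
have toUk W : backward_mild ip S Q (ts k) (te k) U a (VT (n - k)) W ->
    backward_mild ip S Q (ts k) (te k) (Uk k) a (VT (n - k)) W.
  by apply: (backward_mild_congr (null_measurable0 _)) => // s x st; rewrite UE.
exact: (backward_mild_unique ipH S_sg Qb Qsym Qpos (ts_lt_te kn) (Rend_posdef kn)
  (@Rmx_entry' k) (toUk _ mild') (toUk _ mild)).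
Qed.

End Drift.

End Gluing.

(** * Independence of the model from the values of [a] on a null set *)

Section Representative.
Context {R : realType} {H : completeNormedModType R}.
Variables (ip : H -> H -> R) (S : R -> H -> H) (Q : H -> H).
Variables (m : nat) (L : H -> 'cV[R]_m) (Sigma : 'M[R]_m).
Variables (n : nat) (tm : nat -> R) (y : nat -> 'cV[R]_m).
Variables (a g : R -> H) (N : set R).
Hypothesis nN : null_measurable (@lebesgue_measure R) N.
Hypothesis ag : forall s, ~ N s -> a s = g s.

(** A change on a null set alters no integral, and [alpha] sees the trajectory only through
    integrals; the equality therefore holds at every time. *)
Lemma alpha_congr : alpha S L n tm a = alpha S L n tm g.
Proof.
have bE t c : bint t c (fun s => S (c - s) (a s)) = bint t c (fun s => S (c - s) (g s)).
  rewrite /bint (is_bochner_itv_congr (g := fun s => S (c - s) (g s)) nN)// => s _ Ns.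
  by rewrite ag.
apply: functional_extensionality_dep => k; apply/funext => t.
elim: k t => [|k ih] t /=; first by rewrite bE.
have -> : alpha S L n tm a k = alpha S L n tm g k by apply/funext => s; exact: ih.
by rewrite bE.
Qed.

Lemma Vfun_congr : Vfun ip S Q L Sigma n tm a y = Vfun ip S Q L Sigma n tm g y.
Proof.
have VE : Vpos ip S Q L Sigma n tm a y = Vpos ip S Q L Sigma n tm g y.
  by apply/funext => t; rewrite /Vpos alpha_congr.
by apply/funext => t; rewrite /Vfun VE.
Qed.

Lemma Vterm_congr : Vterm ip S Q L Sigma n tm a y = Vterm ip S Q L Sigma n tm g y.
Proof. by apply/funext => t; rewrite /Vterm Vfun_congr. Qed.

End Representative.

Lemma dot_inner {R : realType} {H : completeNormedModType R} (ip : {dot H for idfun}) :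
  (forall x : H, ip x x = `|x| ^+ 2) -> inner ip.
Proof.
move=> ipE; split=> // [x y|x y z|c x z].
- by rewrite hermC expr0 mul1r.
- exact: linearDl.
- exact: linearZl_LR.
Qed.

Theorem theorem2p9 (R : realType)
  (* the real Hilbert space H *)
  (H : completeNormedModType R) (ip : {dot H for idfun})
  (ipE : forall x : H, ip x x = `|x| ^+ 2)
  (domA : set H) (A : H -> H) (S : R -> H -> H)
  (S_semigroup : C0_semigroup S) (A_gen : generates domA A S)
  (Q : H -> H) (Q_cov : covariance_op ip Q)
  (* the stochastic basis *)
  (d : measure_display) (Omega : measurableType d) (P : probability Omega R)
  (Ft : R -> set (set Omega)) (Ft_filtration : filtration Ft)
  (n : nat) (n_gt0 : (0 < n)%N) (tm : nat -> R) (tm0 : tm 0%N = 0)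
  (tm_lt : forall i, (i < n)%N -> tm i < tm i.+1)
  (a : R -> Omega -> H) (a_pred : predictable Ft a)
  (a_int : forall w, bochner_exists 0 (tm n) (a ^~ w))
  (m : nat) (L : H -> 'cV[R]_m) (L_bounded : bounded_op L)
  (Sigma : 'M[R]_m) (Sigma_pos : posdef Sigma)
  (y : nat -> 'cV[R]_m) :
  let U := Ufun ip S Q L Sigma n tm in
  let V w := Vfun ip S Q L Sigma n tm (a ^~ w) y in
  let UT := Uterm ip S Q L Sigma n tm in
  let VT w := Vterm ip S Q L Sigma n tm (a ^~ w) y in
  (* the right limits of U and V exist at t_0, ..., t_(n-1) *)
  (forall i, (i < n)%N ->
     op_right_limit U (tm i) (op_right_lim U (tm i)) /\
     forall w, cvg (V w s @[s --> (tm i)^'+])) /\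
  (forall i, (0 < i <= n)%N ->
     unique_riccati_mild ip S Q (tm i.-1) (tm i) (UT i) U /\
     forall w, unique_backward_mild ip S Q (tm i.-1) (tm i) U (a ^~ w)
                 (VT w i) (V w)).
Proof.
move=> U V UT VT; have ipH := dot_inner ipE; have [Qb Qsym Qpos _] := Q_cov.
(* Each trajectory is exchanged for a strongly measurable one with an integrable majorant
   everywhere, as the analysis of one interval requires. *)
have rep w := bochner_representative ipH (a_int w).
split=> [i i_n|i /andP[i0 i_n]].
  (* Here [tm i] is the left end of the interval followed by [k] observation times, so
     [k = n - i.+1]. *)
  have [k kn ->] : exists2 k, (k < n)%N & i = (n - k.+1)%N.
    by exists (n - i.+1)%N; [rewrite ltn_subrL|rewrite -subSn// subSS subKn// ltnW].
  have rl := Uk_right_limit ipH S_semigroup Qb Qsym Qpos tm0 tm_lt L_bounded Sigma_pos kn.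
  split; first by rewrite (op_right_limitE rl).
  move=> w; have [g [h [N [nN ag mg ih gh]]]] := rep w.
  rewrite /V (Vfun_congr _ _ _ _ _ _ _ _ nN ag).
  have rc := Vk_right_cvg ipH S_semigroup Qb Qsym Qpos tm0 tm_lt L_bounded Sigma_pos
    mg ih gh kn.
  exact: cvgP (rc y).
(* Here [tm i] is the right end of its interval, so [k = n - i]. *)
have [k kn [-> ->]] : exists2 k, (k < n)%N & i = (n - k)%N /\ i.-1 = (n - k.+1)%N.
  exists (n - i)%N; first by rewrite ltn_subrL i0.
  by rewrite subnS subKn.
split; first exact: riccati_Ufun.
move=> w; have [g [h [N [nN ag mg ih gh]]]] := rep w.
have [mild uniq] := backward_Vfun ipH S_semigroup Qb Qsym Qpos tm0 tm_lt L_bounded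
  Sigma_pos y mg ih gh kn.
rewrite /V /VT (Vfun_congr _ _ _ _ _ _ _ _ nN ag) (Vterm_congr _ _ _ _ _ _ _ _ nN ag).
split.
  by apply: backward_mild_congr nN _ _ _ _ mild => // s Ns; rewrite ag.
by move=> V' mild'; apply: uniq; exact: backward_mild_congr nN ag _ _ _ mild'.
Qed.
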